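(* Let $\Omega\subset\mathbb C$ be a convex domain with $\Omega\neq\mathbb C$, and let $P$ be a conformal map of the unit disk $\mathbb D$ onto $\Omega$. Let $n\in\mathbb N\cup\{0\}$, $j\in\{-1,0,1,2,\ldots\}$, $c=(c_0,\ldots,c_n)\in\operatorname{Int}\mathcal C(n)$, and let $\gamma=(\gamma_0,\ldots,\gamma_n)$ be the Schur parameter of $c$. Then for each fixed $z_0\in\mathbb D\setminus\{0\}$, $Q_{\gamma,j}(z_0,\varepsilon)$ is a convex univalent function of $\varepsilon\in\overline{\mathbb D}$, and $$V_\Omega^j(z_0,c)=Q_{\gamma,j}(z_0,\overline{\mathbb D}):=\{Q_{\gamma,j}(z_0,\varepsilon):\varepsilon\in\overline{\mathbb D}\}.$$ Furthermore, for $g\in\mathcal F_\Omega(c)$ and $\varepsilon\in\partial\mathbb D$, the equality $$\int_0^{z_0}\zeta^j\{g(\zeta)-g(0)\}\,d\zeta=Q_{\gamma,j}(z_0,\varepsilon)$$ holds if and only if $g(z)\equiv P(\omega_{\gamma,\varepsilon}(z))$ in $\mathbb D$.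
   Context: $\mathbb D=\{z\in\mathbb C:|z|<1\}$. $H_1^\infty(\mathbb D)$ is the set of analytic functions $\omega$ on $\mathbb D$ with $\sup_{\mathbb D}|\omega|\le 1$. $\mathcal C(n)\subset\mathbb C^{n+1}$ is the set of $c=(c_0,\ldots,c_n)$ for which there is $\omega\in H_1^\infty(\mathbb D)$ with $\omega(z)=c_0+c_1z+\cdots+c_nz^n+\cdots$ (Taylor expansion at $0$); $\operatorname{Int}\mathcal C(n)$ is its interior in $\mathbb C^{n+1}$. Schur parameter of $c\in\operatorname{Int}\mathcal C(n)$: put $c^{(0)}=c$, $\gamma_0=c_0^{(0)}=c_0$, and recursively, given $c^{(i)}=(c^{(i)}_0,\ldots,c^{(i)}_{n-i})$ with $\gamma_i=c_0^{(i)}$, $|\gamma_i|<1$ and $i<n$, define $c^{(i+1)}=(c_0^{(i+1)},\ldots,c_{n-i-1}^{(i+1)})$ by $$c_0^{(i+1)}=\frac{c_1^{(i)}}{1-|\gamma_i|^2},\qquad c_p^{(i+1)}=\frac{c_{p+1}^{(i)}+\overline{\gamma_i}\sum_{\ell=1}^p c_{p-\ell}^{(i+1)}c_\ell^{(i)}}{1-|\gamma_i|^2}\quad(1\le p\le n-i-1),$$ and $\gamma_{i+1}=c_0^{(i+1)}$. For $c\in\operatorname{Int}\mathcal C(n)$ all $|\gamma_0|,\ldots,|\gamma_n|$ are $<1$ (a theorem of Schur), so $\gamma=(\gamma_0,\ldots,\gamma_n)$ is well defined. For $a\in\mathbb D$, $\sigma_a(z)=\dfrac{z+a}{1+\overline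 a z}$. For $\varepsilon\in\overline{\mathbb D}$ and $z\in\mathbb D$, $$\omega_{\gamma,\varepsilon}(z)=\sigma_{\gamma_0}(z\sigma_{\gamma_1}(\cdots z\sigma_{\gamma_n}(\varepsilon z)\cdots)),\qquad Q_{\gamma,j}(z,\varepsilon)=\int_0^z\zeta^j\{P(\omega_{\gamma,\varepsilon}(\zeta))-P(c_0)\}\,d\zeta.$$ $\mathcal F_\Omega(c)$ is the set of analytic $g$ on $\mathbb D$ with $g(\mathbb D)\subset\Omega$ and $(P^{-1}\circ g)(z)=c_0+c_1z+\cdots+c_nz^n+\cdots$ in $\mathbb D$, and $$V_\Omega^j(z_0,c)=\left\{\int_0^{z_0}\zeta^j(g(\zeta)-g(0))\,d\zeta:\ g\in\mathcal F_\Omega(c)\right\}.$$ (For $j=-1$ the integrands have a removable singularity at $0$.) A convex univalent function of $\varepsilon\in\overline{\mathbb D}$ means an analytic function that is injective on $\overline{\mathbb D}$ and maps $\mathbb D$ onto a convex domain. *)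

(* Defs.v *)
From Stdlib Require Import Reals ZArith ClassicalEpsilon.
From Coquelicot Require Export Coquelicot.

Open Scope R_scope.

Definition disk (z : C) : Prop := Cmod z < 1.
Definition cdisk (z : C) : Prop := Cmod z <= 1.

Definition analytic_at (f : C -> C) (z0 : C) : Prop :=
  exists (a : nat -> C) (r : R), 0 < r /\
    forall z : C, Cmod (z - z0)%C < r ->
      is_pseries (K := C_AbsRing) (V := C_NormedModule) a (z - z0)%C (f z).

(* Each point comes with a full neighbourhood on which [f] is a power series,
   so on a set [A] that is not open this is analyticity on an open set
   containing [A]. *)
Definition analytic_on (A : C -> Prop) (f : C -> C) : Prop :=
  forall z : C, A z -> analytic_at f z.

Definition injective_on (A : C -> Prop) (f : C -> C) : Prop :=
  forall z w : C, A z -> A w -> f z = f w -> z = w.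

Definition image (f : C -> C) (A : C -> Prop) (w : C) : Prop :=
  exists z : C, A z /\ f z = w.

Definition convex_set (A : C -> Prop) : Prop :=
  forall (z w : C) (t : R), A z -> A w -> 0 <= t <= 1 ->
    A (RtoC (1 - t) * z + RtoC t * w)%C.

(* Connectedness is implied by convexity. *)
Definition convex_domain (A : C -> Prop) : Prop :=
  open A /\ (exists z : C, A z) /\ convex_set A.

Definition conformal_map (P : C -> C) (Omega : C -> Prop) : Prop :=
  analytic_on disk P /\ injective_on disk P /\
  forall w : C, image P disk w <-> Omega w.

(* The inverse [Omega -> disk] of a conformal map [P] of [disk] onto [Omega];
   unspecified outside [Omega]. *)
Definition disk_inv (P : C -> C) (w : C) : C :=
  epsilon (inhabits (RtoC 0)) (fun z : C => disk z /\ P z = w).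

Definition convex_univalent (f : C -> C) : Prop :=
  analytic_on cdisk f /\ injective_on cdisk f /\ convex_domain (image f disk).

(* A point (c_0, ..., c_n) of C^(n+1) is represented by [c : nat -> C], whose
   values beyond index [n] are irrelevant to every notion below. *)

(* f(z) = c_0 + c_1 z + ... + c_n z^n + ... in the unit disk *)
Definition taylor_on_disk (n : nat) (c : nat -> C) (f : C -> C) : Prop :=
  exists a : nat -> C,
    (forall k : nat, (k <= n)%nat -> a k = c k) /\
    forall z : C, disk z ->
      is_pseries (K := C_AbsRing) (V := C_NormedModule) a z (f z).

Definition H1_infty (w : C -> C) : Prop :=
  analytic_on disk w /\ forall z : C, disk z -> Cmod (w z) <= 1.

Definition coeff_body (n : nat) (c : nat -> C) : Prop :=
  exists w : C -> C, H1_infty w /\ taylor_on_disk n c w.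

Definition Int_coeff_body (n : nat) (c : nat -> C) : Prop :=
  exists delta : R, 0 < delta /\
    forall c' : nat -> C,
      (forall k : nat, (k <= n)%nat -> Cmod (c' k - c k)%C < delta) ->
      coeff_body n c'.

(* [d i p] is c^(i)_p, for i <= n and p <= n - i. *)
Definition schur_parameter (n : nat) (c gamma : nat -> C) : Prop :=
  exists d : nat -> nat -> C,
    (forall p : nat, (p <= n)%nat -> d 0%nat p = c p) /\
    (forall i : nat, (i <= n)%nat -> gamma i = d i 0%nat) /\
    (forall i : nat, (i < n)%nat ->
       d (S i) 0%nat = (d i 1%nat / RtoC (1 - Cmod (gamma i) ^ 2))%C) /\
    (forall i p : nat, (i < n)%nat -> (1 <= p <= n - i - 1)%nat ->
       d (S i) p =
         ((d i (S p) +
             Cconj (gamma i) *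
               sum_n_m (fun l : nat => d (S i) (p - l)%nat * d i l)%C 1 p)
            / RtoC (1 - Cmod (gamma i) ^ 2))%C).

Definition sigma (a z : C) : C := ((z + a) / (1 + Cconj a * z))%C.

Fixpoint omega (n : nat) (gamma : nat -> C) (eps z : C) : C :=
  match n with
  | O => sigma (gamma 0%nat) (eps * z)%C
  | S m => sigma (gamma 0%nat)
             (z * omega m (fun i : nat => gamma (S i)) eps z)%C
  end.

Definition Cpowz (z : C) (j : Z) : C :=
  match j with
  | Z0 => RtoC 1
  | Zpos p => Cpow z (Pos.to_nat p)
  | Zneg p => (/ Cpow z (Pos.to_nat p))%C
  end.

(* Integral from 0 to [z] along the segment: the integrands are analytic in
   the disk, so the path is immaterial. *)
Definition int_from_0 (f : C -> C) (z : C) : C :=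
  RInt (V := C_R_CompleteNormedModule)
    (fun t : R => (f (RtoC t * z) * z)%C) 0 1.

(* For j = -1 the value taken by the integrand at the removable singularity 0
   does not affect the integral. *)
Definition weighted_int (j : Z) (g : C -> C) (g0 z : C) : C :=
  int_from_0 (fun zeta : C => (Cpowz zeta j * (g zeta - g0))%C) z.

Definition Q (P : C -> C) (n : nat) (c gamma : nat -> C) (j : Z)
    (z eps : C) : C :=
  weighted_int j (fun zeta : C => P (omega n gamma eps zeta)) (P (c 0%nat)) z.

Definition F_class (Omega : C -> Prop) (P : C -> C) (n : nat) (c : nat -> C)
    (g : C -> C) : Prop :=
  analytic_on disk g /\ (forall z : C, disk z -> Omega (g z)) /\
  taylor_on_disk n c (fun z : C => disk_inv P (g z)).

Definition V_region (Omega : C -> Prop) (P : C -> C) (n : nat) (c : nat -> C)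
    (j : Z) (z0 w : C) : Prop :=
  exists g : C -> C,
    F_class Omega P n c g /\ w = weighted_int j g (g (RtoC 0)) z0.

(* Main.v *)
From Stdlib Require Import Reals ZArith Lra Lia Classical ClassicalEpsilon FunctionalExtensionality.
From Coquelicot Require Import Coquelicot.
Require Import Defs.
Open Scope R_scope.

(** By the Schur algorithm, the functions of the class are the [P (omega_w(z))], where
    [omega_w(z) = omega_{gamma,w(z)}(z)] and [w] is arbitrary in the unit ball of H^infinity.  For
    fixed [z], the map [e |-> P (omega_e(z))] is convex univalent, because automorphisms and
    contractions of the disk preserve convex maps (Study's theorem).  Hence the quotient of
    [P (omega_w(z)) - P (omega_e(z))] by [e] times the derivative of [P (omega_e(z))] in [e] has
    negative real part whenever [|w(z)| <= |e|] and [w(z) <> e].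

    Up to a power of [z], numerator and denominator are the derivatives of
    [R(z) = int_0^z zeta^j (P (omega_w) - P (omega_e))] and of [H(z) = e dQ/de (z, e)].  As [H] is
    starlike in [z], [Re (R'/H') < 0] gives [Re (R/H) < 0] (Sakaguchi and Libera): for [|e| = 1],
    every value of the region other than [Q(z0, e)] lies strictly inside the half-plane bounded by
    the tangent to the curve [Q(z0, .)] at [e].  Injectivity, convexity, surjectivity (by a
    nearest-point argument) and uniqueness are read off from this inequality.

    Starlikeness of [H] follows from [Re (z d/dz log (P'(omega_e) d omega_e/de)) > 0], which is
    proved by induction along the chain of automorphisms from
    [|(1 - |u|^2) P''(u)/P'(u) - 2 conj u| <= 2]. *)

Notation is_C_derive := (is_derive (K := C_AbsRing) (V := C_NormedModule)).
Notation is_C_pseries := (is_pseries (K := C_AbsRing) (V := C_NormedModule)).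
Notation is_path_derive := (is_derive (K := R_AbsRing) (V := C_R_NormedModule)).
Notation is_C_RInt := (is_RInt (V := C_R_NormedModule)).
Notation C_RInt := (RInt (V := C_R_CompleteNormedModule)).

(** * Complex numbers *)

Lemma re_minus (x y : C) : Re (x - y) = Re x - Re y.
Proof. reflexivity. Qed.

Lemma im_minus (x y : C) : Im (x - y) = Im x - Im y.
Proof. reflexivity. Qed.

#[global] Hint Rewrite re_mult im_mult re_plus im_plus re_minus im_minus re_opp im_opp
  re_RtoC im_RtoC re_conj im_conj : re_im.

Lemma RtoC_neq_0 (x : R) : x <> 0 -> RtoC x <> 0.
Proof. intros Hx E. now apply Hx, RtoC_inj. Qed.

Lemma RtoC_half : RtoC (1 / 2) = (1 / 2)%C.
Proof. apply RtoC_div; lra. Qed.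

Lemma RtoC_convex_weights (t : R) : (RtoC (1 - t) + RtoC t)%C = 1.
Proof. rewrite RtoC_minus. ring. Qed.

Lemma Cminus_0_r (x : C) : (x - 0)%C = x.
Proof. ring. Qed.

Lemma Cminus_diag (x : C) : (x - x)%C = 0.
Proof. ring. Qed.

Lemma Cmult_eq_reg_l (x y z : C) : x <> 0 -> (x * y)%C = (x * z)%C -> y = z.
Proof.
  intros Hx E. transitivity (/ x * (x * y))%C; [now field|]. rewrite E. now field.
Qed.

Lemma Re_Cminus_diag_div (x k : C) : Re ((x - x) / k) = 0.
Proof. unfold Cdiv. now rewrite Cminus_diag, Cmult_0_l, re_RtoC. Qed.

Lemma Cmod_minus_sym (x y : C) : Cmod (x - y) = Cmod (y - x).
Proof. rewrite <- Cmod_opp. f_equal. ring. Qed.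

Lemma Cmod_minus_le (x y : C) : Cmod (x - y) <= Cmod x + Cmod y.
Proof. unfold Cminus. rewrite <- (Cmod_opp y). apply Cmod_triangle. Qed.

Lemma Cmod_minus_triangle (x y z : C) : Cmod (x - z) <= Cmod (x - y) + Cmod (y - z).
Proof. replace (x - z)%C with ((x - y) + (y - z))%C by ring. apply Cmod_triangle. Qed.

Lemma Cmod_le_plus_minus (x y : C) : Cmod x <= Cmod y + Cmod (x - y).
Proof. replace x with (y + (x - y))%C at 1 by ring. apply Cmod_triangle. Qed.

Lemma Rabs_Cmod_minus (x y : C) : Rabs (Cmod x - Cmod y) <= Cmod (x - y).
Proof.
  generalize (Cmod_le_plus_minus x y) (Cmod_le_plus_minus y x).
  rewrite (Cmod_minus_sym y x). intros. apply Rabs_le. lra.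
Qed.

Lemma Cmod_R_pos (x : R) : 0 <= x -> Cmod (RtoC x) = x.
Proof. intro Hx. rewrite Cmod_R. now apply Rabs_pos_eq. Qed.

Lemma Cmult_Cconj (z : C) : (z * Cconj z)%C = RtoC (Cmod z ^ 2).
Proof. now rewrite <- Cmod2_conj, RtoC_pow. Qed.

Lemma Cconj_neq_0 (z : C) : z <> 0 -> Cconj z <> 0.
Proof. intro Hz. apply Cmod_gt_0. rewrite Cmod_conj. now apply Cmod_gt_0. Qed.

Lemma Re_le_Cmod (z : C) : Re z <= Cmod z.
Proof. eapply Rle_trans; [apply Rle_abs|apply re_le_Cmod]. Qed.

Lemma im_le_Cmod (z : C) : Rabs (Im z) <= Cmod z.
Proof. eapply Rle_trans; [apply Rmax_r|apply Rmax_Cmod]. Qed.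

Lemma Cmod_lt_of_sqr (z : C) (r : R) : 0 <= r -> Re z ^ 2 + Im z ^ 2 < r ^ 2 -> Cmod z < r.
Proof. rewrite <- Cmod2_alt. generalize (Cmod_ge_0 z). nra. Qed.

Lemma Cmod_mult_lt_1 (x y : C) : Cmod x < 1 -> Cmod y <= 1 -> Cmod (x * y) < 1.
Proof. rewrite Cmod_mult. generalize (Cmod_ge_0 x) (Cmod_ge_0 y). nra. Qed.

(** * Continuity and complex differentiability *)

Lemma locally_Cmod (z : C) (A : C -> Prop) :
  locally z A <-> exists d, 0 < d /\ forall w, Cmod (w - z) < d -> A w.
Proof.
  rewrite locally_C. split.
  - intros [d Hd]. exists d. split; [apply cond_pos|exact Hd].
  - intros [d [Hd HA]]. now exists (mkposreal d Hd).
Qed.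

Lemma locally_Cmod_lt (z : C) (d : R) : 0 < d -> locally z (fun w => Cmod (w - z) < d).
Proof. intro Hd. apply locally_Cmod. eauto. Qed.

Lemma continuous_Cmod_minus {U : UniformSpace} (f : U -> C) (x : U) :
  continuous f x <-> forall e, 0 < e -> locally x (fun y => Cmod (f y - f x) < e).
Proof.
  split.
  - intros Hf e He. apply (Hf (fun w => Cmod (w - f x) < e)). now apply locally_Cmod_lt.
  - intros Hf A HA. apply locally_Cmod in HA. destruct HA as [d [Hd HA]].
    change (locally x (fun y => A (f y))). generalize (Hf d Hd). apply filter_imp. auto.
Qed.

Lemma continuous_of_lipschitz (f : C -> C) (z : C) (L : R) :
  locally z (fun w => Cmod (f w - f z) <= L * Cmod (w - z)) -> continuous f z.
Proof.
  intro Hf. apply continuous_Cmod_minus. intros e He.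
  assert (PL : 0 < Rabs L + 1) by (generalize (Rabs_pos L); lra).
  generalize (filter_and _ _ Hf (locally_Cmod_lt z _ (Rdiv_lt_0_compat _ _ He PL))).
  apply filter_imp. intros w [Hw Hlt]. apply Rlt_div_r in Hlt; [|exact PL].
  generalize (Rle_abs L) (Cmod_ge_0 (w - z)). nra.
Qed.

Lemma continuous_C_AbsRing {U : UniformSpace} (f : U -> C) (x : U) :
  continuous f x <-> continuous (U := AbsRing_UniformSpace C_AbsRing) f x.
Proof. split; intros Hf A HA; apply Hf; now apply locally_C. Qed.

Section ContinuousOperations.
Context {U : UniformSpace}.

Lemma continuous_Cplus (f g : U -> C) (x : U) : continuous f x -> continuous g x ->
  continuous (fun y => f y + g y)%C x.
Proof. exact (continuous_plus (V := C_NormedModule) f g x). Qed.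

Lemma continuous_Cminus (f g : U -> C) (x : U) : continuous f x -> continuous g x ->
  continuous (fun y => f y - g y)%C x.
Proof. exact (continuous_minus (V := C_NormedModule) f g x). Qed.

Lemma continuous_Cmult (f g : U -> C) (x : U) : continuous f x -> continuous g x ->
  continuous (fun y => f y * g y)%C x.
Proof.
  rewrite !continuous_C_AbsRing. exact (continuous_mult (K := C_AbsRing) f g x).
Qed.

Lemma continuous_Cpow (f : U -> C) (n : nat) (x : U) : continuous f x ->
  continuous (fun y => f y ^ n)%C x.
Proof.
  intro Hf. induction n; simpl; [apply continuous_const|now apply continuous_Cmult].
Qed.

Lemma continuous_RtoC (f : U -> R) (x : U) : continuous f x ->
  continuous (fun y => RtoC (f y)) x.
Proof.
  intro Hf. apply (continuous_comp f RtoC); [exact Hf|].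
  apply continuous_Cmod_minus. intros e He. exists (mkposreal e He). intros y Hy.
  rewrite <- RtoC_minus, Cmod_R. exact Hy.
Qed.

Lemma continuous_Cmod (f : U -> C) (x : U) : continuous f x ->
  continuous (fun y => Cmod (f y)) x.
Proof.
  intros Hf. apply filterlim_locally. intro e.
  apply (filter_imp (fun y => Cmod (f y - f x) < e)).
  - intros y Hy. eapply Rle_lt_trans; [apply Rabs_Cmod_minus|exact Hy].
  - apply continuous_Cmod_minus; [exact Hf|apply cond_pos].
Qed.

Lemma continuous_Re (f : U -> C) (x : U) : continuous f x -> continuous (fun y => Re (f y)) x.
Proof. intro Hf. apply (continuous_comp f fst); [exact Hf|apply continuous_fst]. Qed.

Lemma continuous_gt (f : U -> R) (x : U) (k : R) : continuous f x -> k < f x ->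
  locally x (fun y => k < f y).
Proof. intros Hf Hk. exact (Hf (fun y : R => k < y) (open_gt k (f x) Hk)). Qed.

Lemma continuous_lt (f : U -> R) (x : U) (k : R) : continuous f x -> f x < k ->
  locally x (fun y => f y < k).
Proof. intros Hf Hk. exact (Hf (fun y : R => y < k) (open_lt k (f x) Hk)). Qed.

Lemma continuous_neq (f : U -> C) (x : U) (k : C) : continuous f x -> f x <> k ->
  locally x (fun y => f y <> k).
Proof.
  intros Hf Hk. apply (filter_imp (fun y => Cmod (f y - f x) < Cmod (f x - k))).
  - intros y Hy E. rewrite E, Cmod_minus_sym in Hy. lra.
  - apply continuous_Cmod_minus; [exact Hf|]. now apply Cmod_gt_0, Cminus_eq_contra.
Qed.

End ContinuousOperations.

Lemma is_C_derive_Cmod (f : C -> C) (z l : C) : is_C_derive f z l <->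
  forall e, 0 < e ->
    locally z (fun w => Cmod (f w - f z - l * (w - z)) <= e * Cmod (w - z)).
Proof.
  split.
  - intros [_ Hf] e He. apply locally_C.
    generalize (Hf z (fun P HP => HP) (mkposreal e He)). apply filter_imp. intros w Hw.
    rewrite (Cmult_comm l). exact Hw.
  - intros Hf. split; [apply is_linear_scal_l|]. intros x Hx [e He].
    apply (is_filter_lim_locally_unique (V := AbsRing_NormedModule C_AbsRing)) in Hx. subst x.
    apply locally_C.
    generalize (Hf e He). apply filter_imp. intros w Hw.
    rewrite (Cmult_comm l) in Hw. exact Hw.
Qed.

Lemma is_C_derive_continuous (f : C -> C) (z l : C) : is_C_derive f z l -> continuous f z.
Proof.
  intros Hf A HA. apply locally_C.
  apply (ex_derive_continuous (K := C_AbsRing) (V := C_NormedModule) f z); [now exists l|exact HA].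
Qed.

Lemma is_C_derive_functional (f : C -> C) (z l m : C) :
  is_C_derive f z l -> is_C_derive f z m -> l = m.
Proof. intros Hl Hm. rewrite <- (is_C_derive_unique f z l Hl). now apply is_C_derive_unique. Qed.

Lemma is_C_derive_eq (f : C -> C) (z l m : C) : l = m -> is_C_derive f z l -> is_C_derive f z m.
Proof. now intros ->. Qed.

Lemma is_C_derive_ext_loc (f g : C -> C) (z l : C) : locally z (fun w => f w = g w) ->
  is_C_derive f z l -> is_C_derive g z l.
Proof. intro E. apply is_derive_ext_loc. now apply locally_C. Qed.

Lemma is_C_derive_ext (f g : C -> C) (z l : C) : (forall w, f w = g w) ->
  is_C_derive f z l -> is_C_derive g z l.
Proof. exact (is_derive_ext (K := C_AbsRing) (V := C_NormedModule) f g z l). Qed.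

Lemma is_C_derive_const (k z : C) : is_C_derive (fun _ => k) z (RtoC 0).
Proof. exact (is_derive_const (K := C_AbsRing) (V := C_NormedModule) k z). Qed.

Lemma is_C_derive_id (z : C) : is_C_derive (fun w => w) z (RtoC 1).
Proof.
  apply is_C_derive_Cmod. intros e He. apply filter_forall. intro w.
  replace (w - z - 1 * (w - z))%C with (RtoC 0) by ring.
  rewrite Cmod_0. apply Rmult_le_pos; [lra|apply Cmod_ge_0].
Qed.

Lemma is_C_derive_plus (f g : C -> C) (z l m : C) : is_C_derive f z l -> is_C_derive g z m ->
  is_C_derive (fun w => f w + g w)%C z (l + m)%C.
Proof. exact (is_derive_plus (K := C_AbsRing) (V := C_NormedModule) f g z l m). Qed.

Lemma is_C_derive_minus (f g : C -> C) (z l m : C) : is_C_derive f z l -> is_C_derive g z m ->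
  is_C_derive (fun w => f w - g w)%C z (l - m)%C.
Proof. exact (is_derive_minus (K := C_AbsRing) (V := C_NormedModule) f g z l m). Qed.

Lemma is_C_derive_opp (f : C -> C) (z l : C) : is_C_derive f z l ->
  is_C_derive (fun w => - f w)%C z (- l)%C.
Proof. exact (is_derive_opp (K := C_AbsRing) (V := C_NormedModule) f z l). Qed.

Lemma is_C_derive_AbsRing (f : C -> C) (z l : C) :
  is_C_derive f z l <-> is_derive (V := AbsRing_NormedModule C_AbsRing) f z l.
Proof. split; intros [_ Hf]; (split; [apply is_linear_scal_l|exact Hf]). Qed.

Lemma is_C_derive_mult (f g : C -> C) (z l m : C) : is_C_derive f z l -> is_C_derive g z m ->
  is_C_derive (fun w => f w * g w)%C z (l * g z + f z * m)%C.
Proof.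
  rewrite !is_C_derive_AbsRing. intros Hf Hg.
  exact (is_derive_mult (K := C_AbsRing) f g z l m Hf Hg Cmult_comm).
Qed.

Lemma is_C_derive_comp (f g : C -> C) (z l m : C) : is_C_derive f (g z) l -> is_C_derive g z m ->
  is_C_derive (fun w => f (g w)) z (l * m)%C.
Proof.
  rewrite (is_C_derive_AbsRing g), Cmult_comm. intros Hf Hg.
  exact (is_derive_comp (V := C_NormedModule) f g z l m Hf Hg).
Qed.

Lemma is_C_derive_scal (k : C) (f : C -> C) (z l : C) : is_C_derive f z l ->
  is_C_derive (fun w => k * f w)%C z (k * l)%C.
Proof.
  intro Hf. apply (is_C_derive_eq _ _ (0 * f z + k * l)%C); [ring|].
  apply (is_C_derive_mult (fun _ => k)); [apply is_C_derive_const|exact Hf].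
Qed.

Lemma is_C_derive_affine (p q z : C) : is_C_derive (fun w => p + q * w)%C z q.
Proof.
  apply (is_C_derive_eq _ _ (0 + q * 1)%C); [ring|].
  apply is_C_derive_plus; [apply is_C_derive_const|]. apply is_C_derive_scal, is_C_derive_id.
Qed.

Lemma is_C_derive_pow (f : C -> C) (z l : C) (n : nat) : is_C_derive f z l ->
  is_C_derive (fun w => f w ^ S n)%C z (RtoC (INR (S n)) * f z ^ n * l)%C.
Proof.
  intro Hf. induction n as [|n IHn].
  - apply (is_C_derive_ext f); [intro; now rewrite Cpow_1_r|].
    apply (is_C_derive_eq _ _ l); [simpl; ring|exact Hf].
  - eapply is_C_derive_eq; [|exact (is_C_derive_mult f (fun w => f w ^ S n)%C z _ _ Hf IHn)].
    cbv beta. rewrite (S_INR (S n)), RtoC_plus, !Cpow_S. ring.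
Qed.

Lemma continuous_Cinv (z : C) : z <> 0 -> continuous Cinv z.
Proof.
  intros Hz. set (m := Cmod z). assert (Hm : 0 < m) by now apply Cmod_gt_0.
  apply continuous_Cmod_minus. intros e He.
  assert (Hd : 0 < Rmin (m / 2) (e * (m * m) / 2)).
  { apply Rmin_pos; [lra|]. assert (0 < e * (m * m)) by (repeat apply Rmult_lt_0_compat; lra).
    lra. }
  generalize (locally_Cmod_lt z _ Hd). apply filter_imp. intros w Hw.
  apply Rmin_Rgt_l in Hw. destruct Hw as [Hw1 Hw2].
  assert (Hmw : m / 2 < Cmod w).
  { generalize (Cmod_le_plus_minus z w). rewrite Cmod_minus_sym. fold m. lra. }
  assert (Hw : w <> RtoC 0) by (apply Cmod_gt_0; lra).
  replace (/ w - / z)%C with ((z - w) / (w * z))%C by (field; auto).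
  rewrite Cmod_div, Cmod_mult, Cmod_minus_sym by now apply Cmult_neq_0. fold m.
  apply Rlt_div_l; [apply Rmult_lt_0_compat; lra|].
  apply Rlt_le_trans with (e * m * (m / 2)); [lra|].
  rewrite (Rmult_comm (Cmod w)), <- Rmult_assoc.
  apply Rmult_le_compat_l; [apply Rmult_le_pos; lra|lra].
Qed.

Lemma continuous_Cdiv {U : UniformSpace} (f g : U -> C) (x : U) :
  continuous f x -> continuous g x -> g x <> 0 -> continuous (fun y => f y / g y)%C x.
Proof.
  intros Hf Hg Hx. apply continuous_Cmult; [exact Hf|].
  apply (continuous_comp g Cinv); [exact Hg|now apply continuous_Cinv].
Qed.

Lemma is_C_derive_Cinv (z : C) : z <> 0 -> is_C_derive Cinv z (- / (z * z))%C.
Proof.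
  intros Hz. apply is_C_derive_Cmod. intros e He.
  assert (Hc : 0 < e * Cmod z) by (apply Rmult_lt_0_compat; [exact He|now apply Cmod_gt_0]).
  generalize (filter_and _ _ (continuous_neq _ z 0 (continuous_id z) Hz)
    (proj1 (continuous_Cmod_minus Cinv z) (continuous_Cinv z Hz) _ Hc)).
  apply filter_imp. intros w [Hw Hlt].
  replace (/ w - / z - - / (z * z) * (w - z))%C with (- (/ w - / z) / z * (w - z))%C
    by (field; auto).
  rewrite Cmod_mult, Cmod_div, Cmod_opp by exact Hz.
  apply Rmult_le_compat_r; [apply Cmod_ge_0|].
  apply Rle_div_l; [now apply Cmod_gt_0|lra].
Qed.

Lemma is_C_derive_inv (f : C -> C) (z l : C) : is_C_derive f z l -> f z <> 0 ->
  is_C_derive (fun w => / f w)%C z (- l / (f z * f z))%C.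
Proof.
  intros Hf Hz. apply (is_C_derive_eq _ _ (- / (f z * f z) * l)%C); [now field|].
  apply (is_C_derive_comp Cinv f); [now apply is_C_derive_Cinv|exact Hf].
Qed.

Lemma is_C_derive_div (f g : C -> C) (z l m : C) : is_C_derive f z l -> is_C_derive g z m ->
  g z <> 0 -> is_C_derive (fun w => f w / g w)%C z ((l * g z - f z * m) / (g z * g z))%C.
Proof.
  intros Hf Hg Hz. apply (is_C_derive_eq _ _ (l * / g z + f z * (- m / (g z * g z)))%C);
    [now field|].
  apply (is_C_derive_mult f (fun w => / g w)%C); [exact Hf|now apply is_C_derive_inv].
Qed.

(** * Holomorphic functions *)

Definition disc (c : C) (r : R) (z : C) : Prop := Cmod (z - c) < r.

Lemma disc_0 (r : R) (z : C) : disc 0 r z <-> Cmod z < r.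
Proof. unfold disc. now rewrite Cminus_0_r. Qed.

Lemma disc_0_1 (z : C) : disc 0 1 z <-> disk z.
Proof. apply disc_0. Qed.

Lemma disc_center (c : C) (r : R) : 0 < r -> disc c r c.
Proof. intro Hr. unfold disc. now rewrite Cminus_diag, Cmod_0. Qed.

Lemma disk_0 : disk 0.
Proof. apply disc_0_1, disc_center. lra. Qed.

Lemma disk_Copp (z : C) : disk z -> disk (- z)%C.
Proof. unfold disk. now rewrite Cmod_opp. Qed.

Lemma disk_Cmult (k z : C) : Cmod k <= 1 -> disk z -> disk (k * z)%C.
Proof. intros Hk Hz. unfold disk. rewrite Cmult_comm. now apply Cmod_mult_lt_1. Qed.

Lemma disc_shift (c h : C) (r : R) : disc c r (c + h) <-> disc 0 r h.
Proof. unfold disc. now replace (c + h - c)%C with (h - 0)%C by ring. Qed.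

Lemma open_Cmod (A : C -> Prop) :
  open A <-> forall z, A z -> exists d, 0 < d /\ forall w, disc z d w -> A w.
Proof.
  split; intros HA z Hz; specialize (HA z Hz).
  - now apply locally_Cmod in HA.
  - now apply locally_Cmod.
Qed.

Lemma open_disc (c : C) (r : R) : open (disc c r).
Proof.
  apply open_Cmod. unfold disc. intros z Hz. exists (r - Cmod (z - c)). split; [lra|].
  intros w Hw. generalize (Cmod_minus_triangle w z c). lra.
Qed.

Lemma open_disk : open disk.
Proof. apply (open_ext (disc 0 1)); [exact disc_0_1|apply open_disc]. Qed.

(* With the derivative required to be continuous, Cauchy's formula needs no Goursat argument. *)
Definition holomorphic_on (A : C -> Prop) (f : C -> C) : Prop :=
  exists df : C -> C, forall z, A z -> is_C_derive f z (df z) /\ continuous df z.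

Lemma holomorphic_on_derive (A : C -> Prop) (f : C -> C) (z : C) :
  holomorphic_on A f -> A z -> is_C_derive f z (C_derive f z).
Proof.
  intros [df Hf] Hz. destruct (Hf z Hz) as [Hd _]. now rewrite (is_C_derive_unique _ _ _ Hd).
Qed.

Lemma holomorphic_on_continuous (A : C -> Prop) (f : C -> C) (z : C) :
  holomorphic_on A f -> A z -> continuous f z.
Proof. intros Hf Hz. eapply is_C_derive_continuous, holomorphic_on_derive; eassumption. Qed.

Lemma holomorphic_on_continuous_derive (A : C -> Prop) (f : C -> C) (z : C) :
  open A -> holomorphic_on A f -> A z -> continuous (C_derive f) z.
Proof.
  intros HA [df Hf] Hz. apply (continuous_ext_loc _ df); [|now apply Hf].
  generalize (HA z Hz). apply filter_imp. intros w Hw. symmetry. now apply is_C_derive_unique, Hf.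
Qed.

Lemma holomorphic_on_subset (A B : C -> Prop) (f : C -> C) :
  (forall z, B z -> A z) -> holomorphic_on A f -> holomorphic_on B f.
Proof. intros HBA [df Hf]. exists df. auto. Qed.

Lemma holomorphic_on_local (A : C -> Prop) (f : C -> C) :
  (forall z, A z -> exists r, 0 < r /\ holomorphic_on (disc z r) f) -> holomorphic_on A f.
Proof.
  intro H. exists (C_derive f). intros z Hz. destruct (H z Hz) as [r [Hr Hf]].
  assert (Dz := disc_center z r Hr). split; [now apply (holomorphic_on_derive (disc z r))|].
  apply (holomorphic_on_continuous_derive (disc z r)); auto. apply open_disc.
Qed.

Lemma holomorphic_on_ext (A : C -> Prop) (f g : C -> C) :
  open A -> (forall z, A z -> f z = g z) -> holomorphic_on A f -> holomorphic_on A g.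
Proof.
  intros HA E [df Hf]. exists df. intros z Hz. destruct (Hf z Hz) as [Hd Hc].
  split; [|exact Hc]. apply (is_C_derive_ext_loc f); [|exact Hd].
  generalize (HA z Hz). now apply filter_imp.
Qed.

Lemma holomorphic_on_comp (A B : C -> Prop) (f g : C -> C) :
  holomorphic_on B f -> holomorphic_on A g -> (forall z, A z -> B (g z)) ->
  holomorphic_on A (fun z => f (g z)).
Proof.
  intros [df Hf] [dg Hg] HAB. exists (fun z => df (g z) * dg z)%C. intros z Hz.
  destruct (Hg z Hz) as [Hg1 Hg2]. destruct (Hf (g z) (HAB z Hz)) as [Hf1 Hf2].
  split; [now apply (is_C_derive_comp f g)|]. apply continuous_Cmult; [|exact Hg2].
  apply (continuous_comp g df); [eapply is_C_derive_continuous; eassumption|exact Hf2].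
Qed.

Lemma holomorphic_on_Cinv : holomorphic_on (fun z => z <> 0) Cinv.
Proof.
  exists (fun z => - 1 / (z * z))%C. intros z Hz. split.
  - apply (is_C_derive_eq _ _ (- / (z * z))%C); [now field|now apply is_C_derive_Cinv].
  - apply continuous_Cdiv; [apply continuous_const| |now apply Cmult_neq_0].
    apply continuous_Cmult; apply continuous_id.
Qed.

Section HolomorphicOperations.
Context (A : C -> Prop).

Lemma holomorphic_on_const (k : C) : holomorphic_on A (fun _ => k).
Proof.
  exists (fun _ => RtoC 0). intros z _. split; [apply is_C_derive_const|apply continuous_const].
Qed.

Lemma holomorphic_on_id : holomorphic_on A (fun z => z).
Proof.
  exists (fun _ => RtoC 1). intros z _. split; [apply is_C_derive_id|apply continuous_const].
Qed.

Lemma holomorphic_on_plus (f g : C -> C) : holomorphic_on A f -> holomorphic_on A g ->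
  holomorphic_on A (fun z => f z + g z)%C.
Proof.
  intros [df Hf] [dg Hg]. exists (fun z => df z + dg z)%C. intros z Hz.
  destruct (Hf z Hz), (Hg z Hz). split; [now apply is_C_derive_plus|now apply continuous_Cplus].
Qed.

Lemma holomorphic_on_mult (f g : C -> C) : holomorphic_on A f -> holomorphic_on A g ->
  holomorphic_on A (fun z => f z * g z)%C.
Proof.
  intros [df Hf] [dg Hg]. exists (fun z => df z * g z + f z * dg z)%C. intros z Hz.
  destruct (Hf z Hz), (Hg z Hz). split; [now apply is_C_derive_mult|].
  apply continuous_Cplus; apply continuous_Cmult; auto; eapply is_C_derive_continuous; eassumption.
Qed.

Lemma holomorphic_on_scal (k : C) (f : C -> C) : holomorphic_on A f ->
  holomorphic_on A (fun z => k * f z)%C.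
Proof. apply holomorphic_on_mult, holomorphic_on_const. Qed.

Lemma holomorphic_on_minus (f g : C -> C) : holomorphic_on A f -> holomorphic_on A g ->
  holomorphic_on A (fun z => f z - g z)%C.
Proof.
  intros [df Hf] [dg Hg]. exists (fun z => df z - dg z)%C. intros z Hz.
  destruct (Hf z Hz), (Hg z Hz). split; [now apply is_C_derive_minus|now apply continuous_Cminus].
Qed.

Lemma holomorphic_on_opp (f : C -> C) : holomorphic_on A f -> holomorphic_on A (fun z => - f z)%C.
Proof.
  intros [df Hf]. exists (fun z => - df z)%C. intros z Hz. destruct (Hf z Hz) as [Hd Hc].
  split; [now apply is_C_derive_opp|]. exact (continuous_opp (V := C_NormedModule) df z Hc).
Qed.

Lemma holomorphic_on_div (f g : C -> C) : holomorphic_on A f -> holomorphic_on A g ->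
  (forall z, A z -> g z <> 0) -> holomorphic_on A (fun z => f z / g z)%C.
Proof.
  intros Hf Hg Hn. apply holomorphic_on_mult; [exact Hf|].
  exact (holomorphic_on_comp A (fun z => z <> 0) Cinv g holomorphic_on_Cinv Hg Hn).
Qed.

Lemma holomorphic_on_pow (f : C -> C) (n : nat) : holomorphic_on A f ->
  holomorphic_on A (fun z => f z ^ n)%C.
Proof.
  intro Hf. induction n; simpl; [apply holomorphic_on_const|now apply holomorphic_on_mult].
Qed.

End HolomorphicOperations.

Lemma holomorphic_on_shift (c : C) (r : R) (f : C -> C) :
  holomorphic_on (disc c r) f <-> holomorphic_on (disc 0 r) (fun h => f (c + h)%C).
Proof.
  split; intro Hf.
  - apply (holomorphic_on_comp _ (disc c r) f (fun h => c + h)%C); [exact Hf| |].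
    + apply holomorphic_on_plus; [apply holomorphic_on_const|apply holomorphic_on_id].
    + intro h. apply disc_shift.
  - apply (holomorphic_on_ext _ (fun w => f (c + (w - c))%C)); [apply open_disc| |].
    + intros w _. f_equal. ring.
    + apply (holomorphic_on_comp _ (disc 0 r) (fun h => f (c + h)%C) (fun w => w - c)%C);
        [exact Hf| |].
      * apply holomorphic_on_minus; [apply holomorphic_on_id|apply holomorphic_on_const].
      * intros w Hw. now apply disc_0.
Qed.

Lemma is_C_derive_shift (c : C) (f : C -> C) (h l : C) : is_C_derive f (c + h)%C l ->
  is_C_derive (fun w => f (c + w)%C) h l.
Proof.
  intro Hf. apply (is_C_derive_eq _ _ (l * (0 + 1))%C); [ring|].
  apply (is_C_derive_comp f (fun w => c + w)%C); [exact Hf|].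
  apply is_C_derive_plus; [apply is_C_derive_const|apply is_C_derive_id].
Qed.

(** * Integrals of complex-valued functions of a real variable *)

Lemma is_C_RInt_ext (f g : R -> C) (a b : R) (l : C) : a <= b ->
  (forall t, a < t < b -> f t = g t) -> is_C_RInt f a b l -> is_C_RInt g a b l.
Proof.
  intros Hab E. apply is_RInt_ext. now rewrite Rmin_left, Rmax_right.
Qed.

Lemma is_C_RInt_unique (f : R -> C) (a b : R) (l : C) : is_C_RInt f a b l -> C_RInt f a b = l.
Proof. exact (is_RInt_unique (V := C_R_CompleteNormedModule) f a b l). Qed.

Lemma is_C_RInt_C_RInt (f : R -> C) (a b : R) : (exists l : C, is_C_RInt f a b l) ->
  is_C_RInt f a b (C_RInt f a b).
Proof. intros [l Hl]. now rewrite (is_C_RInt_unique _ _ _ _ Hl). Qed.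

Lemma is_C_RInt_functional (f : R -> C) (a b : R) (l m : C) :
  is_C_RInt f a b l -> is_C_RInt f a b m -> l = m.
Proof. intros Hl Hm. rewrite <- (is_C_RInt_unique _ _ _ _ Hl). now apply is_C_RInt_unique. Qed.

Lemma is_C_RInt_minus (f g : R -> C) (a b : R) (l m : C) : is_C_RInt f a b l ->
  is_C_RInt g a b m -> is_C_RInt (fun t => f t - g t)%C a b (l - m)%C.
Proof. exact (is_RInt_minus (V := C_R_NormedModule) f g a b l m). Qed.

Lemma is_C_RInt_Re (f : R -> C) (a b : R) (l : C) : is_C_RInt f a b l ->
  is_RInt (fun t => Re (f t)) a b (Re l).
Proof. exact (is_RInt_fct_extend_fst (U := R_NormedModule) (V := R_NormedModule) f a b l). Qed.

Lemma is_C_RInt_Im (f : R -> C) (a b : R) (l : C) : is_C_RInt f a b l ->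
  is_RInt (fun t => Im (f t)) a b (Im l).
Proof. exact (is_RInt_fct_extend_snd (U := R_NormedModule) (V := R_NormedModule) f a b l). Qed.

Lemma is_C_RInt_scal (k : C) (f : R -> C) (a b : R) (l : C) : is_C_RInt f a b l ->
  is_C_RInt (fun t => k * f t)%C a b (k * l)%C.
Proof.
  intro Hf. generalize (is_C_RInt_Re _ _ _ _ Hf) (is_C_RInt_Im _ _ _ _ Hf). intros Hr Hi.
  apply (is_RInt_fct_extend_pair (U := R_NormedModule) (V := R_NormedModule)).
  - exact (is_RInt_minus _ _ _ _ _ _
      (is_RInt_scal _ _ _ (Re k) _ Hr) (is_RInt_scal _ _ _ (Im k) _ Hi)).
  - exact (is_RInt_plus _ _ _ _ _ _
      (is_RInt_scal _ _ _ (Re k) _ Hi) (is_RInt_scal _ _ _ (Im k) _ Hr)).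
Qed.

Lemma Cmod_is_C_RInt_le (f : R -> C) (a b : R) (l : C) (M : R) : a < b ->
  (forall t, a < t < b -> Cmod (f t) <= M) -> is_C_RInt f a b l -> Cmod l <= (b - a) * M.
Proof.
  intros Hab HM Hf.
  assert (HM0 : 0 <= M).
  { eapply Rle_trans; [apply Cmod_ge_0|apply (HM ((a + b) / 2)); lra]. }
  set (g := fun t => if Rlt_dec a t then if Rlt_dec t b then f t else RtoC 0 else RtoC 0).
  rewrite Cmod_norm. apply (norm_RInt_le_const (V := C_R_NormedModule) g a b); [lra| |].
  - intros t Ht. apply Rle_trans with (Cmod (g t)); [right; symmetry; apply Cmod_norm|]. unfold g.
    destruct (Rlt_dec a t); [|now rewrite Cmod_0].
    destruct (Rlt_dec t b); [apply HM; lra|now rewrite Cmod_0].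
  - apply (is_C_RInt_ext f); [lra| |exact Hf]. intros t Ht. unfold g.
    destruct (Rlt_dec a t); [|lra]. destruct (Rlt_dec t b); [reflexivity|lra].
Qed.

Lemma ex_C_RInt_continuous (f : R -> C) (a b : R) : a <= b ->
  (forall t, a <= t <= b -> continuous f t) -> exists l : C, is_C_RInt f a b l.
Proof.
  intros Hab Hf. apply (ex_RInt_continuous (V := C_R_CompleteNormedModule) f a b).
  now rewrite Rmin_left, Rmax_right.
Qed.

Lemma is_C_RInt_derive (g dg : R -> C) (a b : R) : a <= b ->
  (forall t, a <= t <= b -> is_path_derive g t (dg t)) ->
  (forall t, a <= t <= b -> continuous dg t) -> is_C_RInt dg a b (g b - g a)%C.
Proof.
  intros Hab Hg Hc. apply (is_RInt_derive (V := C_R_CompleteNormedModule) g dg a b);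
    now rewrite Rmin_left, Rmax_right.
Qed.

Lemma is_C_derive_filterdiff_R (f : C -> C) (z l : C) : is_C_derive f z l ->
  filterdiff (K := R_AbsRing) (U := C_R_NormedModule) (V := C_R_NormedModule) f (locally z)
    (fun h => h * l)%C.
Proof.
  intro Hf. split.
  - split.
    + intros x y. exact (Cmult_plus_distr_r x y l).
    + intros k x. rewrite !scal_R_Cmult. symmetry. apply Cmult_assoc.
    + exists (1 + Cmod l). split; [generalize (Cmod_ge_0 l); lra|]. intro x.
      rewrite <- !Cmod_norm, Cmod_mult, Rmult_comm.
      apply Rmult_le_compat_r; [apply Cmod_ge_0|lra].
  - intros x Hx [e He]. apply (is_filter_lim_locally_unique (V := C_R_NormedModule)) in Hx. subst x.
    generalize (proj1 (is_C_derive_Cmod f z l) Hf e He). apply filter_imp. intros w Hw.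
    rewrite <- !Cmod_norm, (Cmult_comm _ l). exact Hw.
Qed.

Lemma is_path_derive_comp (f : C -> C) (g : R -> C) (t : R) (l m : C) :
  is_C_derive f (g t) l -> is_path_derive g t m -> is_path_derive (fun s => f (g s)) t (l * m)%C.
Proof.
  intros Hf Hg. apply (filterdiff_ext_lin _ (fun s : R => scal s m * l)%C).
  - exact (filterdiff_comp' g f t _ _ Hg (is_C_derive_filterdiff_R _ _ _ Hf)).
  - intro s. rewrite !scal_R_Cmult, (Cmult_comm l). symmetry. apply Cmult_assoc.
Qed.

Lemma is_path_derive_affine (p q : C) (t : R) : is_path_derive (fun s => p + RtoC s * q)%C t q.
Proof.
  generalize (is_derive_plus (V := C_R_NormedModule) (fun _ => p) (fun s => RtoC s * q)%C t zero q).
  rewrite plus_zero_l. intro Hplus. apply Hplus.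
  - exact (is_derive_const (V := C_R_NormedModule) p t).
  - apply (filterdiff_ext (fun s : R => scal s q)); [intro; apply scal_R_Cmult|].
    apply filterdiff_linear, is_linear_scal_l.
Qed.

Lemma is_path_derive_ray (f : C -> C) (z l : C) (t : R) : is_C_derive f (RtoC t * z)%C l ->
  is_path_derive (fun s => f (RtoC s * z)%C) t (l * z)%C.
Proof.
  intro Hf. apply (is_derive_ext (fun s : R => f (0 + RtoC s * z)%C)).
  - intro s. now rewrite Cplus_0_l.
  - apply (is_path_derive_comp f (fun s => 0 + RtoC s * z)%C); [|apply is_path_derive_affine].
    now rewrite Cplus_0_l.
Qed.

Lemma continuous_ray {U : UniformSpace} (f : C -> C) (z : C) (g : U -> R) (x : U) :
  continuous f (RtoC (g x) * z)%C -> continuous g x -> continuous (fun y => f (RtoC (g y) * z)%C) x.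
Proof.
  intros Hf Hg. apply (continuous_comp (fun y => RtoC (g y) * z)%C f); [|exact Hf].
  apply continuous_Cmult; [now apply continuous_RtoC|apply continuous_const].
Qed.

Lemma is_path_derive_Re (g : R -> C) (t : R) (l : C) : is_path_derive g t l ->
  is_derive (fun s => Re (g s)) t (Re l).
Proof. intro Hg. exact (filterdiff_comp' _ fst t _ _ Hg (filterdiff_linear _ is_linear_fst)). Qed.

Lemma is_path_derive_Im (g : R -> C) (t : R) (l : C) : is_path_derive g t l ->
  is_derive (fun s => Im (g s)) t (Im l).
Proof. intro Hg. exact (filterdiff_comp' _ snd t _ _ Hg (filterdiff_linear _ is_linear_snd)). Qed.

Lemma RInt_param_const (G dG : R -> R -> R) (a b eta : R) : 0 < eta ->
  (forall u t, - eta < u < 1 + eta -> is_derive (fun v => G v t) u (dG u t)) ->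
  (forall u t, - eta < u < 1 + eta -> continuous (fun w : R * R => dG (fst w) (snd w)) (u, t)) ->
  (forall u, - eta < u < 1 + eta -> ex_RInt (G u) a b) ->
  (forall u, 0 <= u <= 1 -> is_RInt (dG u) a b 0) -> RInt (G 0) a b = RInt (G 1) a b.
Proof.
  intros Heta HG Hc Hi H0.
  assert (Hloc : forall u, 0 <= u <= 1 -> locally u (fun v => - eta < v < 1 + eta)).
  { intros u Hu. exists (mkposreal eta Heta). intros v Hv.
    change (Rabs (v - u) < eta) in Hv. apply Rabs_def2 in Hv. lra. }
  apply (eq_is_derive (V := R_NormedModule) (fun u => RInt (G u) a b)); [|lra]. intros u Hu.
  assert (E : RInt (fun t => Derive (fun v => G v t) u) a b = 0).
  { rewrite (RInt_ext _ (dG u)); [now apply is_RInt_unique, H0|].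
    intros t _. apply is_derive_unique, HG. lra. }
  change (zero : R) with 0. rewrite <- E. apply (is_derive_RInt_param G a b u).
  - generalize (Hloc u Hu). apply filter_imp. intros v Hv t _. eexists. now apply HG.
  - intros t _. apply (continuity_2d_pt_ext_loc dG).
    + exists (mkposreal eta Heta). intros v s Hv _. apply Rabs_def2 in Hv. simpl in Hv.
      symmetry. apply is_derive_unique, HG. lra.
    + apply continuity_2d_pt_filterlim. apply (Hc u t). lra.
  - generalize (Hloc u Hu). apply filter_imp. auto.
Qed.

Lemma is_C_RInt_param_const (G dG : R -> R -> C) (a b eta : R) (l : C) : 0 < eta ->
  (forall u t, - eta < u < 1 + eta -> is_path_derive (fun v => G v t) u (dG u t)) ->
  (forall u t, - eta < u < 1 + eta -> continuous (fun w : R * R => dG (fst w) (snd w)) (u, t)) ->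
  (forall u, - eta < u < 1 + eta -> exists m : C, is_C_RInt (G u) a b m) ->
  (forall u, 0 <= u <= 1 -> is_C_RInt (dG u) a b (RtoC 0)) ->
  is_C_RInt (G 0) a b l -> is_C_RInt (G 1) a b l.
Proof.
  intros Heta HG Hc Hi H0 Hl. destruct (Hi 1) as [m Hm]; [lra|].
  replace l with m; [exact Hm|]. apply injective_projections.
  - change (Re m = Re l). rewrite <- (is_RInt_unique _ _ _ _ (is_C_RInt_Re _ _ _ _ Hl)).
    rewrite <- (is_RInt_unique _ _ _ _ (is_C_RInt_Re _ _ _ _ Hm)). symmetry.
    apply (RInt_param_const (fun u t => Re (G u t)) (fun u t => Re (dG u t)) a b eta Heta).
    + intros u t Hu. exact (is_path_derive_Re _ _ _ (HG u t Hu)).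
    + intros u t Hu. apply (continuous_comp _ fst); [now apply Hc|apply continuous_fst].
    + intros u Hu. destruct (Hi u Hu) as [k Hk]. exists (Re k). now apply is_C_RInt_Re.
    + intros u Hu. exact (is_C_RInt_Re _ _ _ _ (H0 u Hu)).
  - change (Im m = Im l). rewrite <- (is_RInt_unique _ _ _ _ (is_C_RInt_Im _ _ _ _ Hl)).
    rewrite <- (is_RInt_unique _ _ _ _ (is_C_RInt_Im _ _ _ _ Hm)). symmetry.
    apply (RInt_param_const (fun u t => Im (G u t)) (fun u t => Im (dG u t)) a b eta Heta).
    + intros u t Hu. exact (is_path_derive_Im _ _ _ (HG u t Hu)).
    + intros u t Hu. apply (continuous_comp _ snd); [now apply Hc|apply continuous_snd].
    + intros u Hu. destruct (Hi u Hu) as [k Hk]. exists (Im k). now apply is_C_RInt_Im.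
    + intros u Hu. exact (is_C_RInt_Im _ _ _ _ (H0 u Hu)).
Qed.

(** * Compactness *)

(* [compactness_value_2d] only provides a uniform lower bound for a gauge, hence the monotonicity
   of [A] in the parameter. *)
Lemma compact_uniform (K : C -> Prop) (r : R) (A : R -> C -> Prop) :
  closed K -> (forall z, K z -> Cmod z <= r) ->
  (forall d d' w, 0 < d' <= d -> A d w -> A d' w) ->
  (forall z, K z -> exists d, 0 < d /\ locally z (A d)) ->
  exists d, 0 < d /\ forall w, K w -> A d w.
Proof.
  intros HK Hr Hmono HA.
  assert (Hgauge : forall p : R * R, exists d : posreal, forall w, K w ->
    Rabs (Re w - fst p) < d -> Rabs (Im w - snd p) < d -> A d w).
  { intro p. destruct (classic (K p)) as [Hp|Hp].
    - destruct (HA p Hp) as [d [Hd [e He]]].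
      exists (mkposreal _ (Rmin_pos _ _ Hd (cond_pos e))). simpl. intros w _ HRe HIm.
      apply (Hmono d); [split; [apply Rmin_pos; [exact Hd|apply cond_pos]|apply Rmin_l]|].
      apply He. split; (eapply Rlt_le_trans; [eassumption|apply Rmin_r]).
    - destruct (NNPP _ (fun Hn => Hp (HK p Hn))) as [e He].
      exists e. intros w Hw HRe HIm. exfalso. now apply (He w). }
  set (gauge := fun u v => proj1_sig (constructive_indefinite_description _ (Hgauge (u, v)))).
  destruct (compactness_value_2d (- r) r (- r) r gauge) as [d Hd].
  exists d. split; [apply cond_pos|]. intros w Hw. specialize (Hr w Hw).
  assert (Hre : - r <= Re w <= r).
  { apply Rabs_le_between. generalize (re_le_Cmod w). lra. }
  assert (Him : - r <= Im w <= r).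
  { apply Rabs_le_between. generalize (im_le_Cmod w). lra. }
  destruct (NNPP _ (Hd (Re w) (Im w) Hre Him)) as [u [v [_ [_ [HRe [HIm Hdd']]]]]].
  unfold gauge in *. destruct (constructive_indefinite_description _ _) as [d' Hd'].
  simpl in *. apply (Hmono d'); [split; [apply cond_pos|exact Hdd']|auto].
Qed.

Lemma compact_argmin (K : C -> Prop) (r : R) (phi : C -> R) : closed K ->
  (forall z, K z -> Cmod z <= r) -> (exists z, K z) -> (forall z, K z -> continuous phi z) ->
  exists z, K z /\ forall w, K w -> phi z <= phi w.
Proof.
  intros HK Hr [z0 Hz0] Hphi.
  destruct (compact_uniform K r (fun d w => - / d <= phi w) HK Hr) as [d [Hd Hlow]].
  { intros d d' w Hd Hw. generalize (Rinv_le_contravar d' d (proj1 Hd) (proj2 Hd)). lra. }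
  { intros z Hz. generalize (Rabs_pos (phi z)) (Rle_abs (- phi z)). rewrite Rabs_Ropp. intros Hp Hm.
    exists (/ (Rabs (phi z) + 1)). split; [apply Rinv_0_lt_compat; lra|].
    rewrite Rinv_inv. apply (filter_imp (fun w => - (Rabs (phi z) + 1) < phi w)); [intros; lra|].
    apply continuous_gt; [now apply Hphi|lra]. }
  destruct (completeness (fun x => forall z, K z -> x <= phi z)) as [m [Hub Hlub]].
  { exists (phi z0). intros x Hx. now apply Hx. }
  { exists (- / d). exact Hlow. }
  apply NNPP. intro Hno.
  assert (Hlt : forall z, K z -> m < phi z).
  { intros z Hz. apply Rnot_le_lt. intro Hle. apply Hno. exists z. split; [exact Hz|].
    intros w Hw. apply Rle_trans with m; [exact Hle|]. apply Hlub. intros x Hx. now apply Hx. }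
  destruct (compact_uniform K r (fun e w => m + e <= phi w) HK Hr) as [e [He Hinf]].
  { intros e e' w He Hw. lra. }
  { intros z Hz. specialize (Hlt z Hz). exists ((phi z - m) / 2). split; [lra|].
    apply (filter_imp (fun w => (m + phi z) / 2 < phi w)); [intros; lra|].
    apply continuous_gt; [now apply Hphi|lra]. }
  specialize (Hub (m + e) Hinf). lra.
Qed.

Lemma compact_Cmod_bounded (K : C -> Prop) (r : R) (f : C -> C) : closed K ->
  (forall z, K z -> Cmod z <= r) -> (forall z, K z -> continuous f z) ->
  exists B, 0 < B /\ forall z, K z -> Cmod (f z) <= B.
Proof.
  intros HK Hr Hf. destruct (classic (exists z, K z)) as [Hne|Hne].
  - destruct (compact_argmin K r (fun z => - Cmod (f z)) HK Hr Hne) as [z [Hz Hmax]].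
    + intros z Hz. apply (continuous_opp (V := R_NormedModule)), continuous_Cmod. auto.
    + exists (Cmod (f z) + 1). split; [generalize (Cmod_ge_0 (f z)); lra|].
      intros w Hw. specialize (Hmax w Hw). lra.
  - exists 1. split; [lra|]. intros z Hz. exfalso. eauto.
Qed.

Lemma continuous_Cmod_from (c z : C) : continuous (fun w => Cmod (w - c)) z.
Proof.
  apply continuous_Cmod, continuous_Cminus; [apply continuous_id|apply continuous_const].
Qed.

Lemma closed_Cmod_le (c : C) (r : R) : closed (fun z => Cmod (z - c) <= r).
Proof.
  apply (closed_comp (fun z => Cmod (z - c)) (fun x => x <= r)); [|apply closed_le].
  intro z. apply continuous_Cmod_from.
Qed.

Lemma closed_Cmod_eq (c : C) (r : R) : closed (fun z => Cmod (z - c) = r).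
Proof.
  apply (closed_comp (fun z => Cmod (z - c)) (fun x => x = r)); [|apply closed_eq].
  intro z. apply continuous_Cmod_from.
Qed.

Lemma bounded_on_closed_disc (c : C) (r : R) (f : C -> C) :
  (forall z, Cmod (z - c) <= r -> continuous f z) ->
  exists B, 0 < B /\ forall z, Cmod (z - c) <= r -> Cmod (f z) <= B.
Proof.
  apply (compact_Cmod_bounded _ (Cmod c + r)); [apply closed_Cmod_le|].
  intros z Hz. generalize (Cmod_le_plus_minus z c). lra.
Qed.

Lemma Cmod_argmin_closed_disc (c : C) (r : R) (f : C -> C) : 0 <= r ->
  (forall z, Cmod (z - c) <= r -> continuous f z) ->
  exists z, Cmod (z - c) <= r /\ forall w, Cmod (w - c) <= r -> Cmod (f z) <= Cmod (f w).
Proof.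
  intros Hr Hf. apply (compact_argmin _ (Cmod c + r) (fun z => Cmod (f z))).
  - apply closed_Cmod_le.
  - intros z Hz. generalize (Cmod_le_plus_minus z c). lra.
  - exists c. now rewrite Cminus_diag, Cmod_0.
  - intros z Hz. now apply continuous_Cmod, Hf.
Qed.

Lemma Cmod_argmin_circle (c : C) (r : R) (f : C -> C) : 0 <= r ->
  (forall z, Cmod (z - c) = r -> continuous f z) ->
  exists z, Cmod (z - c) = r /\ forall w, Cmod (w - c) = r -> Cmod (f z) <= Cmod (f w).
Proof.
  intros Hr Hf. apply (compact_argmin _ (Cmod c + r) (fun z => Cmod (f z))).
  - apply closed_Cmod_eq.
  - intros z Hz. generalize (Cmod_le_plus_minus z c). lra.
  - exists (c + RtoC r)%C. replace (c + RtoC r - c)%C with (RtoC r) by ring. now apply Cmod_R_pos.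
  - intros z Hz. now apply continuous_Cmod, Hf.
Qed.

(** * Cauchy's formula *)

Definition circle (r t : R) : C := (r * cos t, r * sin t).

Lemma Cmod_circle (r t : R) : 0 <= r -> Cmod (circle r t) = r.
Proof.
  intro Hr. unfold Cmod, circle. simpl.
  replace (r * cos t * (r * cos t * 1) + r * sin t * (r * sin t * 1))
    with (r * r * (Rsqr (sin t) + Rsqr (cos t))).
  - rewrite sin2_cos2, Rmult_1_r. now apply sqrt_square.
  - unfold Rsqr. ring.
Qed.

Lemma circle_2PI (r : R) : circle r (2 * PI) = circle r 0.
Proof. unfold circle. now rewrite sin_2PI, cos_2PI, sin_0, cos_0. Qed.

Lemma is_path_derive_circle (r t : R) : is_path_derive (circle r) t (Ci * circle r t)%C.
Proof.
  replace (Ci * circle r t)%C with ((- (r * sin t), r * cos t) : C)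
    by (apply injective_projections; simpl; ring).
  apply (filterdiff_ext_lin _ (fun s : R => (scal s (- (r * sin t)), scal s (r * cos t)))).
  - apply (filterdiff_comp'_2 (fun s => r * cos s) (fun s => r * sin s) (fun x y => (x, y)) t
      (fun s => scal s (- (r * sin t))) (fun s => scal s (r * cos t)) (fun x y => (x, y))).
    + change (is_derive (fun s => r * cos s) t (- (r * sin t))). auto_derive; [easy|ring].
    + change (is_derive (fun s => r * sin s) t (r * cos t)). auto_derive; [easy|ring].
    + apply (filterdiff_ext (fun u => u)); [now intros []|].
      apply (filterdiff_ext_lin _ (fun u => u)); [apply filterdiff_id|now intros []].
  - reflexivity.
Qed.

Lemma continuous_circle {U : UniformSpace} (r : R) (g : U -> R) (x : U) : continuous g x ->
  continuous (fun y => circle r (g y)) x.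
Proof.
  intro Hg. apply (continuous_comp g (circle r)); [exact Hg|].
  apply (ex_derive_continuous (V := C_R_NormedModule)). eexists. apply is_path_derive_circle.
Qed.

Lemma continuous_comp_circle (f : C -> C) (r t : R) : continuous f (circle r t) ->
  continuous (fun s => f (circle r s)) t.
Proof.
  intro Hf. apply (continuous_comp (circle r) f); [apply continuous_circle, continuous_id|exact Hf].
Qed.

Lemma circle_minus_ge (z : C) (r t : R) : Cmod z < r -> r - Cmod z <= Cmod (circle r t - z).
Proof.
  intro Hz. assert (Hz0 := Cmod_ge_0 z).
  generalize (Cmod_le_plus_minus (circle r t) z). rewrite Cmod_circle; lra.
Qed.

Lemma circle_minus_neq_0 (z : C) (r t : R) : Cmod z < r -> (circle r t - z)%C <> 0.
Proof. intro Hz. apply Cmod_gt_0. generalize (circle_minus_ge z r t Hz). lra. Qed.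

Lemma circle_neq_0 (r t : R) : 0 < r -> circle r t <> 0.
Proof. intro Hr. apply Cmod_gt_0. rewrite Cmod_circle; lra. Qed.

Lemma circle_RInt_of_primitive (g dg : C -> C) (r : R) :
  (forall t, is_C_derive g (circle r t) (dg (circle r t))) ->
  (forall t, continuous (fun s => dg (circle r s)) t) ->
  is_C_RInt (fun t => dg (circle r t) * circle r t)%C 0 (2 * PI) (RtoC 0).
Proof.
  intros Hg Hc. generalize PI_RGT_0. intro Hpi.
  assert (H : is_C_RInt (fun t => dg (circle r t) * (Ci * circle r t))%C 0 (2 * PI)
    (g (circle r (2 * PI)) - g (circle r 0))%C).
  { apply (is_C_RInt_derive (fun t => g (circle r t))); [lra| |].
    - intros t _. apply is_path_derive_comp; [apply Hg|apply is_path_derive_circle].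
    - intros t _. apply continuous_Cmult; [apply Hc|].
      apply continuous_Cmult; [apply continuous_const|apply continuous_circle, continuous_id]. }
  rewrite circle_2PI, Cminus_diag in H. apply (is_C_RInt_scal (- Ci)) in H.
  rewrite Cmult_0_r in H.
  apply (is_C_RInt_ext (fun t => - Ci * (dg (circle r t) * (Ci * circle r t)))%C);
    [lra| |exact H].
  intros t _. transitivity (- (Ci * Ci) * (dg (circle r t) * circle r t))%C; [ring|].
  replace (Ci * Ci)%C with (- RtoC 1)%C by (apply injective_projections; simpl; ring). ring.
Qed.

Lemma ex_circle_RInt (f : C -> C) (r : R) : (forall t, continuous f (circle r t)) ->
  exists l : C, is_C_RInt (fun t => f (circle r t)) 0 (2 * PI) l.
Proof.
  intro Hf. generalize PI_RGT_0. intro Hpi. apply ex_C_RInt_continuous; [lra|].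
  intros t _. now apply continuous_comp_circle.
Qed.

Lemma circle_RInt_param_const (F dg : R -> C -> C) (r eta : R) (l : C) : 0 < eta ->
  (forall u t, - eta < u < 1 + eta ->
    is_path_derive (fun v => F v (circle r t)) u (dg u (circle r t) * circle r t)%C) ->
  (forall u t, - eta < u < 1 + eta ->
    continuous (fun w : R * R => dg (fst w) (circle r (snd w))) (u, t)) ->
  (forall u t, - eta < u < 1 + eta -> continuous (F u) (circle r t)) ->
  (forall u, 0 <= u <= 1 -> exists g, forall t, is_C_derive g (circle r t) (dg u (circle r t))) ->
  is_C_RInt (fun t => F 0 (circle r t)) 0 (2 * PI) l ->
  is_C_RInt (fun t => F 1 (circle r t)) 0 (2 * PI) l.
Proof.
  intros Heta HF Hdg HFc Hg.
  apply (is_C_RInt_param_const (fun u t => F u (circle r t))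
    (fun u t => dg u (circle r t) * circle r t)%C 0 (2 * PI) eta); auto.
  - intros u t Hu. apply continuous_Cmult; [now apply Hdg|].
    apply continuous_circle, continuous_snd.
  - intros u Hu. apply (ex_circle_RInt (F u)). auto.
  - intros u Hu. destruct (Hg u Hu) as [g Hgu].
    apply (circle_RInt_of_primitive g (dg u)); [exact Hgu|]. intro t.
    apply (continuous_comp_2 (fun _ => u) (fun s => s) (fun u s => dg u (circle r s)));
      [apply continuous_const|apply continuous_id|apply Hdg; lra].
Qed.

Lemma continuous_Cauchy_kernel (z : C) (r t : R) : Cmod z < r ->
  continuous (fun w => w / (w - z))%C (circle r t).
Proof.
  intro Hz. apply continuous_Cdiv; [apply continuous_id| |now apply circle_minus_neq_0].
  apply continuous_Cminus; [apply continuous_id|apply continuous_const].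
Qed.

Lemma Cauchy_kernel_RInt (z : C) (r : R) : Cmod z < r ->
  is_C_RInt (fun t => circle r t / (circle r t - z))%C 0 (2 * PI) (RtoC (2 * PI)).
Proof.
  intro Hz. assert (Hz0 := Cmod_ge_0 z). generalize PI_RGT_0. intro Hpi.
  set (eta := (r - Cmod z) / r).
  assert (Heta : 0 < eta) by (apply Rdiv_lt_0_compat; lra).
  assert (Hn : forall u t, - eta < u < 1 + eta -> (circle r t + RtoC u * - z)%C <> 0).
  { intros u t Hu. replace (circle r t + RtoC u * - z)%C with (circle r t - RtoC u * z)%C by ring.
    apply circle_minus_neq_0. rewrite Cmod_mult, Cmod_R.
    assert (Hur : Rabs u <= 1 + eta) by (apply Rabs_le; lra).
    assert (E : eta * r = r - Cmod z) by (unfold eta; field; lra). nra. }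
  apply (is_C_RInt_ext (fun t => circle r t / (circle r t + RtoC 1 * - z))%C); [lra| |].
  { intros t _. f_equal. ring. }
  apply (circle_RInt_param_const (fun u w => w / (w + RtoC u * - z))%C
    (fun u w => z / ((w + RtoC u * - z) * (w + RtoC u * - z)))%C r eta);
    [exact Heta|intros u t Hu|intros u t Hu|intros u t Hu|intros u Hu|].
  - specialize (Hn u t Hu). set (c := circle r t) in *.
    replace (z / ((c + RtoC u * - z) * (c + RtoC u * - z)) * c)%C
      with (c * (- / ((c + RtoC u * - z) * (c + RtoC u * - z))) * - z)%C by (field; exact Hn).
    apply (is_path_derive_comp (fun w => c * / w)%C (fun u => c + RtoC u * - z)%C).
    + now apply is_C_derive_scal, is_C_derive_Cinv.
    + apply is_path_derive_affine.
  - assert (Hc : continuous (fun w : R * R => circle r (snd w) + RtoC (fst w) * - z)%C (u, t)).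
    { apply continuous_Cplus; [apply continuous_circle, continuous_snd|].
      apply continuous_Cmult; [apply continuous_RtoC, continuous_fst|apply continuous_const]. }
    apply continuous_Cdiv; [apply continuous_const|now apply continuous_Cmult|].
    now apply Cmult_neq_0; apply Hn.
  - apply continuous_Cdiv; [apply continuous_id| |now apply Hn].
    apply continuous_Cplus; [apply continuous_id|apply continuous_const].
  - exists (fun w => - z * / (w + RtoC u * - z))%C. intro t. specialize (Hn u t ltac:(lra)).
    apply (is_C_derive_eq _ _
      (- z * (- (1 + 0) / ((circle r t + RtoC u * - z) * (circle r t + RtoC u * - z))))%C);
        [now field|].
    apply is_C_derive_scal, (is_C_derive_inv (fun w => w + RtoC u * - z)%C); [|exact Hn].
    apply is_C_derive_plus; [apply is_C_derive_id|apply is_C_derive_const].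
  - apply (is_C_RInt_ext (fun _ => RtoC 1)); [lra| |].
    + intros t _. field. specialize (Hn 0 t ltac:(lra)). intro E. apply Hn. rewrite E. ring.
    + replace (RtoC (2 * PI)) with (scal (2 * PI - 0) (RtoC 1)).
      * exact (is_RInt_const (V := C_R_NormedModule) 0 (2 * PI) (RtoC 1)).
      * rewrite scal_R_Cmult, Rminus_0_r. apply Cmult_1_r.
Qed.

Lemma Cmod_segment_lt (z x : C) (r R0 u : R) : Cmod z < r < R0 -> Cmod x = r ->
  - ((R0 - r) / (2 * r)) < u < 1 + (R0 - r) / (2 * r) -> Cmod (z + RtoC u * (x - z)) < R0.
Proof.
  intros Hr Hx Hu. assert (Hz0 := Cmod_ge_0 z). set (eta := (R0 - r) / (2 * r)) in *.
  assert (He : eta * (2 * r) = R0 - r) by (unfold eta; field; lra).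
  assert (Heta : 0 < eta) by (apply Rdiv_lt_0_compat; lra).
  replace (z + RtoC u * (x - z))%C with (RtoC u * x + RtoC (1 - u) * z)%C
    by (rewrite RtoC_minus; ring).
  eapply Rle_lt_trans; [apply Cmod_triangle|]. rewrite !Cmod_mult, !Cmod_R, Hx.
  destruct (Rle_lt_dec 0 u); [|rewrite Rabs_left, Rabs_pos_eq by lra; nra].
  rewrite (Rabs_pos_eq u) by lra.
  destruct (Rle_lt_dec u 1); [rewrite Rabs_pos_eq by lra|rewrite Rabs_left by lra]; nra.
Qed.

Lemma is_C_derive_segment (z w : C) (u : R) :
  is_C_derive (fun w => z + RtoC u * (w - z))%C w (RtoC u).
Proof.
  apply (is_C_derive_ext (fun w => z - RtoC u * z + RtoC u * w)%C); [intro; ring|].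
  apply is_C_derive_affine.
Qed.

Lemma segment_primitive (f : C -> C) (z : C) (u : R) : exists g, forall w,
  is_C_derive f (z + RtoC u * (w - z))%C (C_derive f (z + RtoC u * (w - z)))%C ->
  is_C_derive g w (C_derive f (z + RtoC u * (w - z)))%C.
Proof.
  destruct (Req_EM_T u 0) as [->|Hu].
  - exists (fun w => 0 + C_derive f z * w)%C. intros w _.
    replace (z + RtoC 0 * (w - z))%C with z by ring. apply is_C_derive_affine.
  - exists (fun w => / RtoC u * f (z + RtoC u * (w - z)))%C. intros w Hf.
    apply (is_C_derive_eq _ _ (/ RtoC u * (C_derive f (z + RtoC u * (w - z)) * RtoC u))%C).
    + field. now apply RtoC_neq_0.
    + apply is_C_derive_scal, (is_C_derive_comp f); [exact Hf|apply is_C_derive_segment].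
Qed.

(* The integral of [f (z + u (c - z)) c / (c - z)] over the circle does not depend on [u], because
   its derivative in [u] is the integral of the derivative of [f (z + u (c - z)) / u]. *)
Lemma Cauchy_formula (R0 : R) (f : C -> C) (z : C) (r : R) :
  holomorphic_on (disc 0 R0) f -> Cmod z < r < R0 ->
  is_C_RInt (fun t => f (circle r t) * (circle r t / (circle r t - z)))%C 0 (2 * PI)
    (RtoC (2 * PI) * f z)%C.
Proof.
  intros Hf Hr. generalize PI_RGT_0 (Cmod_ge_0 z). intros Hpi Hz0.
  set (eta := (R0 - r) / (2 * r)).
  assert (Heta : 0 < eta) by (apply Rdiv_lt_0_compat; lra).
  assert (Hin : forall u t, - eta < u < 1 + eta -> disc 0 R0 (z + RtoC u * (circle r t - z))%C).
  { intros u t Hu. apply disc_0, (Cmod_segment_lt z _ r); auto. apply Cmod_circle. lra. }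
  assert (Hne : forall t, (circle r t - z)%C <> 0) by (intro; now apply circle_minus_neq_0).
  apply (is_C_RInt_ext (fun t => circle r t / (circle r t - z) *
    f (z + RtoC 1 * (circle r t - z))%C)%C); [lra| |].
  { intros t _. rewrite Cmult_comm. do 2 f_equal. ring. }
  apply (circle_RInt_param_const (fun u w => w / (w - z) * f (z + RtoC u * (w - z))%C)%C
    (fun u w => C_derive f (z + RtoC u * (w - z)))%C r eta);
    [exact Heta|intros u t Hu|intros u t Hu|intros u t Hu|intros u Hu|].
  - replace (C_derive f (z + RtoC u * (circle r t - z)) * circle r t)%C with
      (circle r t / (circle r t - z) * C_derive f (z + RtoC u * (circle r t - z)) *
        (circle r t - z))%C
      by (field; apply Hne).
    apply (is_path_derive_comp (fun w => circle r t / (circle r t - z) * f w)%C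
      (fun u => z + RtoC u * (circle r t - z))%C); [|apply is_path_derive_affine].
    apply is_C_derive_scal. now apply (holomorphic_on_derive (disc 0 R0)), Hin.
  - apply (continuous_comp (fun w : R * R => z + RtoC (fst w) * (circle r (snd w) - z))%C).
    + apply continuous_Cplus; [apply continuous_const|].
      apply continuous_Cmult; [apply continuous_RtoC, continuous_fst|].
      apply continuous_Cminus; [apply continuous_circle, continuous_snd|apply continuous_const].
    + apply (holomorphic_on_continuous_derive (disc 0 R0)); auto. apply open_disc.
  - apply continuous_Cmult; [apply continuous_Cauchy_kernel; lra|].
    apply (continuous_comp (fun w => z + RtoC u * (w - z))%C).
    + eapply is_C_derive_continuous. apply is_C_derive_segment.
    + apply (holomorphic_on_continuous (disc 0 R0)); auto.
  - destruct (segment_primitive f z u) as [g Hg]. exists g. intro t. apply Hg.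
    apply (holomorphic_on_derive (disc 0 R0)); auto. apply Hin. lra.
  - apply (is_C_RInt_ext (fun t => f z * (circle r t / (circle r t - z)))%C); [lra| |].
    + intros t _. rewrite Cmult_comm. do 2 f_equal. ring.
    + rewrite Cmult_comm. apply is_C_RInt_scal, Cauchy_kernel_RInt. lra.
Qed.

(** * Complex power series *)

Definition C_psum (a : nat -> C) (z : C) (n : nat) : C :=
  sum_n (G := C_NormedModule) (fun k => a k * z ^ k)%C n.

Lemma C_psum_0 (a : nat -> C) (z : C) : C_psum a z 0 = a 0%nat.
Proof. unfold C_psum. rewrite sum_O. simpl. apply Cmult_1_r. Qed.

Lemma C_psum_S (a : nat -> C) (z : C) (n : nat) :
  C_psum a z (S n) = (C_psum a z n + a (S n) * z ^ S n)%C.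
Proof. apply (sum_Sn (G := C_NormedModule)). Qed.

Lemma pow_n_Cpow (z : C) (n : nat) : pow_n (K := C_AbsRing) z n = (z ^ n)%C.
Proof. induction n as [|n IHn]; simpl; [reflexivity|]. rewrite IHn. reflexivity. Qed.

Lemma is_C_pseries_Cmod (a : nat -> C) (z l : C) : is_C_pseries a z l <->
  forall e, 0 < e -> eventually (fun n => Cmod (C_psum a z n - l) < e).
Proof.
  assert (E : forall n, sum_n (G := C_NormedModule) (fun k => scal (K := C_AbsRing)
    (pow_n (K := C_AbsRing) z k) (a k)) n = C_psum a z n).
  { intro n. apply sum_n_ext. intro k. rewrite pow_n_Cpow. apply Cmult_comm. }
  split.
  - intros H e He. apply (filterlim_ext _ _ E) in H.
    exact (H (fun w => Cmod (w - l) < e) (locally_Cmod_lt l e He)).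
  - intro H. apply (filterlim_ext _ _ (fun n => eq_sym (E n))). intros A HA.
    apply locally_Cmod in HA. destruct HA as [d [Hd HA]].
    exact (filter_imp _ _ (fun n => HA (C_psum a z n)) (H d Hd)).
Qed.

Lemma is_C_pseries_functional (a : nat -> C) (z l m : C) :
  is_C_pseries a z l -> is_C_pseries a z m -> l = m.
Proof. apply filterlim_locally_unique. Qed.

Lemma is_C_pseries_at_0 (a : nat -> C) (l : C) : is_C_pseries a (RtoC 0) l -> l = a 0%nat.
Proof.
  intro Hl. apply (is_C_pseries_functional a 0); [exact Hl|].
  exact (is_pseries_0 (K := C_AbsRing) (V := C_NormedModule) a).
Qed.

Lemma is_C_pseries_ext (a b : nat -> C) (z l : C) : (forall k, a k = b k) ->
  is_C_pseries a z l -> is_C_pseries b z l.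
Proof. exact (is_pseries_ext (K := C_AbsRing) (V := C_NormedModule) a b z l). Qed.

Lemma is_C_pseries_minus (a b : nat -> C) (z l m : C) : is_C_pseries a z l ->
  is_C_pseries b z m -> is_C_pseries (fun k => a k - b k)%C z (l - m)%C.
Proof. exact (is_pseries_minus (K := C_AbsRing) (V := C_NormedModule) a b z l m). Qed.

Lemma is_C_pseries_plus (a b : nat -> C) (z l m : C) : is_C_pseries a z l ->
  is_C_pseries b z m -> is_C_pseries (fun k => a k + b k)%C z (l + m)%C.
Proof. exact (is_pseries_plus (K := C_AbsRing) (V := C_NormedModule) a b z l m). Qed.

Lemma is_C_pseries_scal (k : C) (a : nat -> C) (z l : C) : is_C_pseries a z l ->
  is_C_pseries (fun n => k * a n)%C z (k * l)%C.
Proof.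
  exact (is_pseries_scal (K := C_AbsRing) (V := C_NormedModule) k a z l (Cmult_comm z k)).
Qed.

Lemma is_C_pseries_incr_1 (a : nat -> C) (z l : C) : is_C_pseries a z l ->
  is_C_pseries (fun k => match k with O => RtoC 0 | S k => a k end) z (z * l)%C.
Proof. exact (is_pseries_incr_1 (K := C_AbsRing) (V := C_NormedModule) a z l). Qed.

Lemma is_C_pseries_const (x z : C) :
  is_C_pseries (fun k => match k with O => x | S _ => RtoC 0 end) z x.
Proof.
  apply is_C_pseries_Cmod. intros e He. apply filter_forall. intro n.
  replace (C_psum _ z n) with x; [now rewrite Cminus_diag, Cmod_0|].
  induction n as [|n IHn]; [now rewrite C_psum_0|]. rewrite C_psum_S, <- IHn. ring.
Qed.

Lemma is_C_pseries_cons (x : C) (a : nat -> C) (z l : C) : is_C_pseries a z l ->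
  is_C_pseries (fun k => match k with O => x | S k => a k end) z (x + z * l)%C.
Proof.
  intro Hl. refine (is_C_pseries_ext _ _ _ _ _
    (is_C_pseries_plus _ _ _ _ _ (is_C_pseries_const x z) (is_C_pseries_incr_1 a z l Hl))).
  intros [|k]; ring.
Qed.

Lemma is_C_pseries_decr_1 (a : nat -> C) (z l : C) : z <> 0 -> is_C_pseries a z l ->
  is_C_pseries (fun k => a (S k)) z ((l - a 0%nat) / z)%C.
Proof.
  intros Hz Hl. unfold Cdiv. rewrite Cmult_comm.
  exact (is_pseries_decr_1 (K := C_AbsRing) (V := C_NormedModule) a z (/ z)%C l (Cinv_l z Hz) Hl).
Qed.

Lemma is_C_pseries_terms_bounded (a : nat -> C) (z l : C) : is_C_pseries a z l ->
  exists M, forall k, Cmod (a k * z ^ k) <= M.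
Proof.
  intro Hl.
  destruct (filterlim_bounded (K := C_AbsRing) (V := C_NormedModule) (C_psum a z)) as [M HM].
  { exists l. intros A HA. apply locally_Cmod in HA. destruct HA as [d [Hd HA]].
    exact (filter_imp _ _ (fun n => HA (C_psum a z n)) (proj1 (is_C_pseries_Cmod a z l) Hl d Hd)). }
  change (forall n, Cmod (C_psum a z n) <= M) in HM.
  exists (2 * M). intros [|k].
  - specialize (HM 0%nat). rewrite C_psum_0 in HM.
    replace (a 0%nat * z ^ 0)%C with (a 0%nat) by (simpl; ring).
    generalize (Cmod_ge_0 (a 0%nat)). lra.
  - replace (a (S k) * z ^ S k)%C with (C_psum a z (S k) - C_psum a z k)%C
      by (rewrite C_psum_S; ring).
    eapply Rle_trans; [apply Cmod_minus_le|]. generalize (HM k) (HM (S k)). lra.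
Qed.

Lemma ex_C_pseries_le (a : nat -> C) (b : nat -> R) (z : C) :
  (forall k, Cmod (a k * z ^ k) <= b k) -> ex_series b -> exists l : C, is_C_pseries a z l.
Proof.
  intros Hab Hb.
  apply (ex_series_le (K := C_AbsRing) (V := C_CompleteNormedModule)
    (fun k => scal (K := C_AbsRing) (V := C_NormedModule) (pow_n (K := C_AbsRing) z k) (a k)) b);
    [|exact Hb].
  intro n. rewrite pow_n_Cpow. change (Cmod (z ^ n * a n) <= b n). rewrite Cmult_comm. apply Hab.
Qed.

Definition pseries_on (R0 : R) (a : nat -> C) (f : C -> C) : Prop :=
  forall z, Cmod z < R0 -> is_C_pseries a z (f z).

Lemma pseries_on_ex (R0 : R) (a : nat -> C) :
  (forall z, Cmod z < R0 -> exists l : C, is_C_pseries a z l) -> exists f, pseries_on R0 a f.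
Proof.
  intro H. exists (fun z => epsilon (inhabits (RtoC 0)) (is_C_pseries a z)).
  intros z Hz. apply epsilon_spec. auto.
Qed.

Lemma pseries_on_CV_radius (R0 r : R) (a : nat -> C) (f : C -> C) : pseries_on R0 a f ->
  0 <= r < R0 -> Rbar_lt r (CV_radius (fun k => Cmod (a k))).
Proof.
  intros Hf Hr. set (s := (r + R0) / 2). assert (Hs : r < s < R0) by (unfold s; lra).
  assert (Ms : Cmod (RtoC s) = s) by (apply Cmod_R_pos; lra).
  destruct (is_C_pseries_terms_bounded a (RtoC s) (f (RtoC s))) as [M HM]; [apply Hf; lra|].
  apply Rbar_lt_le_trans with s; [simpl; lra|].
  apply CV_radius_bounded. exists M. intro n. specialize (HM n).
  rewrite Cmod_mult, Cmod_pow, Ms in HM.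
  rewrite Rabs_pos_eq; [exact HM|]. apply Rmult_le_pos; [apply Cmod_ge_0|apply pow_le; lra].
Qed.

Lemma pseries_on_ex_le (R0 : R) (a b : nat -> C) (f : C -> C) : pseries_on R0 a f ->
  (forall k, Cmod (b k) <= Cmod (a k)) -> exists g, pseries_on R0 b g.
Proof.
  intros Hf Hb. apply pseries_on_ex. intros z Hz.
  apply (ex_C_pseries_le _ (fun k => Cmod (a k) * Cmod z ^ k)).
  - intro k. rewrite Cmod_mult, Cmod_pow. apply Rmult_le_compat_r; [|apply Hb].
    apply pow_le, Cmod_ge_0.
  - refine (proj1 (ex_pseries_R _ _) (CV_radius_inside _ _ _)).
    rewrite Rabs_pos_eq by apply Cmod_ge_0.
    apply (pseries_on_CV_radius R0 _ a f); [exact Hf|]. split; [apply Cmod_ge_0|exact Hz].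
Qed.

Lemma pseries_on_at_0 (R0 : R) (a : nat -> C) (f : C -> C) : 0 < R0 -> pseries_on R0 a f ->
  f 0 = a 0%nat.
Proof. intros HR Hf. apply is_C_pseries_at_0, Hf. now rewrite Cmod_0. Qed.

Definition C_PS_derive (a : nat -> C) (k : nat) : C := (RtoC (INR (S k)) * a (S k))%C.

Lemma Cmod_C_PS_derive (a : nat -> C) (k : nat) :
  Cmod (C_PS_derive a k) = PS_derive (fun n => Cmod (a n)) k.
Proof. unfold C_PS_derive, PS_derive. rewrite Cmod_mult, Cmod_R_pos; [easy|apply pos_INR]. Qed.

Lemma pseries_on_derive_ex (R0 : R) (a : nat -> C) (f : C -> C) : pseries_on R0 a f ->
  exists g, pseries_on R0 (C_PS_derive a) g.
Proof.
  intro Hf. apply pseries_on_ex. intros z Hz.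
  apply (ex_C_pseries_le _ (fun k => PS_derive (fun n => Cmod (a n)) k * Cmod z ^ k)).
  - intro k. rewrite Cmod_mult, Cmod_pow, Cmod_C_PS_derive. lra.
  - refine (proj1 (ex_pseries_R _ _) (ex_pseries_derive _ _ _)).
    rewrite Rabs_pos_eq by apply Cmod_ge_0.
    apply (pseries_on_CV_radius R0 _ a f); [exact Hf|]. split; [apply Cmod_ge_0|exact Hz].
Qed.

Lemma Cpow_taylor2 (z w : C) (rho : R) (k : nat) : Cmod z <= rho -> Cmod w <= rho ->
  Cmod (w ^ S k - z ^ S k - RtoC (INR (S k)) * z ^ k * (w - z)) <=
    INR (S k) * INR k * rho ^ pred k * Cmod (w - z) ^ 2.
Proof.
  intros Hz Hw. assert (Hrho : 0 <= rho) by (generalize (Cmod_ge_0 z); lra).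
  induction k as [|k IHk].
  - replace (w ^ 1 - z ^ 1 - RtoC (INR 1) * z ^ 0 * (w - z))%C with (RtoC 0) by (simpl; ring).
    rewrite Cmod_0. simpl. lra.
  - set (D := (w ^ S k - z ^ S k - RtoC (INR (S k)) * z ^ k * (w - z))%C) in *.
    replace (w ^ S (S k) - z ^ S (S k) - RtoC (INR (S (S k))) * z ^ S k * (w - z))%C
      with (w * D + RtoC (INR (S k)) * z ^ k * (w - z) ^ 2)%C.
    2:{ unfold D. rewrite (S_INR (S k)), RtoC_plus, !Cpow_S. simpl. ring. }
    eapply Rle_trans; [apply Cmod_triangle|].
    rewrite !Cmod_mult, !Cmod_pow, Cmod_R_pos by apply pos_INR.
    set (x := Cmod (w - z) ^ 2) in *. assert (Hx : 0 <= x) by apply pow2_ge_0.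
    assert (HD : Cmod w * Cmod D <= rho * (INR (S k) * INR k * rho ^ pred k * x)).
    { apply Rmult_le_compat; auto; apply Cmod_ge_0. }
    assert (Hzk : INR (S k) * Cmod z ^ k * x <= INR (S k) * rho ^ k * x).
    { apply Rmult_le_compat_r; [exact Hx|]. apply Rmult_le_compat_l; [apply pos_INR|].
      apply pow_incr. split; [apply Cmod_ge_0|exact Hz]. }
    replace (rho * (INR (S k) * INR k * rho ^ pred k * x))
      with (INR (S k) * INR k * (rho ^ k * x)) in HD
      by (destruct k; simpl; ring).
    change (pred (S k)) with k. rewrite (S_INR (S k)).
    generalize (pos_INR (S k)) (Rmult_le_pos _ _ (pow_le rho k Hrho) Hx).
    rewrite S_INR in *. intros. nra.
Qed.

Definition taylor2_majorant (a : nat -> C) (rho : R) (k : nat) : R :=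
  INR (S k) * INR k * Cmod (a (S k)) * rho ^ pred k.

Lemma taylor2_majorant_ge_0 (a : nat -> C) (rho : R) (k : nat) : 0 <= rho ->
  0 <= taylor2_majorant a rho k.
Proof.
  intro Hrho. unfold taylor2_majorant.
  repeat apply Rmult_le_pos; try apply pos_INR; [apply Cmod_ge_0|now apply pow_le].
Qed.

Lemma ex_series_taylor2_majorant (R0 rho : R) (a : nat -> C) (f : C -> C) : pseries_on R0 a f ->
  0 <= rho < R0 -> ex_series (taylor2_majorant a rho).
Proof.
  intros Hf Hrho. apply ex_series_incr_1.
  apply (ex_series_ext (fun k => PS_derive (PS_derive (fun n => Cmod (a n))) k * rho ^ k)).
  - intro k. unfold taylor2_majorant, PS_derive. simpl pred. simpl. ring.
  - refine (proj1 (ex_pseries_R _ _) (ex_pseries_derive _ _ _)).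
    rewrite CV_radius_derive, Rabs_pos_eq by lra.
    now apply (pseries_on_CV_radius R0 rho a f).
Qed.

Lemma C_psum_taylor2 (a : nat -> C) (z w : C) (rho : R) (n : nat) : Cmod z <= rho ->
  Cmod w <= rho ->
  Cmod (C_psum a w (S n) - C_psum a z (S n) - C_psum (C_PS_derive a) z n * (w - z)) <=
    sum_n (taylor2_majorant a rho) n * Cmod (w - z) ^ 2.
Proof.
  intros Hz Hw.
  assert (Hterm : forall k, Cmod (a (S k) * w ^ S k - a (S k) * z ^ S k -
    C_PS_derive a k * z ^ k * (w - z)) <= taylor2_majorant a rho k * Cmod (w - z) ^ 2).
  { intro k. replace (a (S k) * w ^ S k - a (S k) * z ^ S k - C_PS_derive a k * z ^ k * (w - z))%C
      with (a (S k) * (w ^ S k - z ^ S k - RtoC (INR (S k)) * z ^ k * (w - z)))%C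
      by (unfold C_PS_derive; ring).
    rewrite Cmod_mult. eapply Rle_trans.
    - apply Rmult_le_compat_l; [apply Cmod_ge_0|]. now apply (Cpow_taylor2 z w rho).
    - unfold taylor2_majorant. lra. }
  induction n as [|n IHn].
  - rewrite sum_O, !C_psum_S, !C_psum_0. eapply Rle_trans; [|apply (Hterm 0%nat)].
    right. f_equal. simpl. ring.
  - rewrite sum_Sn, (C_psum_S a w (S n)), (C_psum_S a z (S n)), (C_psum_S (C_PS_derive a)).
    change plus with Rplus. rewrite Rmult_plus_distr_r.
    eapply Rle_trans; [|apply Rplus_le_compat; [exact IHn|apply (Hterm (S n))]].
    eapply Rle_trans; [|apply Cmod_triangle]. right. f_equal. ring.
Qed.

Lemma pseries_on_taylor2 (R0 rho : R) (a : nat -> C) (f g : C -> C) : pseries_on R0 a f ->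
  pseries_on R0 (C_PS_derive a) g -> rho < R0 -> exists M, forall z w,
    Cmod z <= rho -> Cmod w <= rho -> Cmod (f w - f z - g z * (w - z)) <= M * Cmod (w - z) ^ 2.
Proof.
  intros Hf Hg Hrho. destruct (Rlt_le_dec rho 0) as [Hneg|Hpos].
  { exists 0. intros z w Hz. generalize (Cmod_ge_0 z). lra. }
  destruct (ex_series_taylor2_majorant R0 rho a f Hf) as [M HM]; [lra|].
  exists M. intros z w Hz Hw. set (h := (w - z)%C). apply le_epsilon. intros e He.
  assert (Hh := Cmod_ge_0 h). set (d := e / (2 + Cmod h)).
  assert (Hd : 0 < d) by (apply Rdiv_lt_0_compat; lra).
  destruct (proj1 (is_C_pseries_Cmod a w (f w)) (Hf w ltac:(lra)) d Hd) as [nw Hfw].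
  destruct (proj1 (is_C_pseries_Cmod a z (f z)) (Hf z ltac:(lra)) d Hd) as [nz Hfz].
  destruct (proj1 (is_C_pseries_Cmod _ z (g z)) (Hg z ltac:(lra)) d Hd) as [ng Hgz].
  set (n := (nw + nz + ng)%nat).
  specialize (Hfw (S n) ltac:(lia)). specialize (Hfz (S n) ltac:(lia)).
  specialize (Hgz n ltac:(lia)).
  assert (Hpart := C_psum_taylor2 a z w rho n Hz Hw). fold h in Hpart.
  assert (Hsum : sum_n (taylor2_majorant a rho) n <= M).
  { apply is_lim_seq_incr_compare; [exact HM|]. intro k. rewrite sum_Sn. change plus with Rplus.
    generalize (taylor2_majorant_ge_0 a rho (S k) Hpos). lra. }
  set (x := (C_psum a w (S n) - f w)%C) in *. set (y := (C_psum a z (S n) - f z)%C) in *.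
  set (v := (C_psum (C_PS_derive a) z n - g z)%C) in *.
  set (D := (C_psum a w (S n) - C_psum a z (S n) - C_psum (C_PS_derive a) z n * h)%C) in *.
  replace (f w - f z - g z * h)%C with (D - (x - y - v * h))%C by (unfold D, x, y, v; ring).
  assert (Hrest : Cmod (x - y - v * h) <= e).
  { eapply Rle_trans; [apply Cmod_minus_le|]. rewrite Cmod_mult.
    generalize (Cmod_minus_le x y). intro Hxy.
    replace e with (d + d + d * Cmod h) by (unfold d; field; lra). nra. }
  generalize (Cmod_minus_le D (x - y - v * h)) (pow2_ge_0 (Cmod h)). nra.
Qed.

Lemma is_C_derive_of_sqr (f : C -> C) (z l : C) (M : R) :
  locally z (fun w => Cmod (f w - f z - l * (w - z)) <= M * Cmod (w - z) ^ 2) ->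
  is_C_derive f z l.
Proof.
  intros Hf. apply is_C_derive_Cmod. intros e He.
  assert (Hd : 0 < e / (Rabs M + 1)).
  { apply Rdiv_lt_0_compat; [exact He|]. generalize (Rabs_pos M). lra. }
  generalize (filter_and _ _ Hf (locally_Cmod_lt z _ Hd)). apply filter_imp. intros w [Hw Hlt].
  eapply Rle_trans; [exact Hw|]. set (x := Cmod (w - z)) in *.
  assert (Hx : 0 <= x) by apply Cmod_ge_0.
  apply Rlt_div_r in Hlt; [|generalize (Rabs_pos M); lra].
  generalize (Rle_abs M). simpl. nra.
Qed.

Lemma pseries_on_is_C_derive (R0 : R) (a : nat -> C) (f g : C -> C) : pseries_on R0 a f ->
  pseries_on R0 (C_PS_derive a) g -> forall z, Cmod z < R0 -> is_C_derive f z (g z).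
Proof.
  intros Hf Hg z Hz. set (rho := (Cmod z + R0) / 2).
  destruct (pseries_on_taylor2 R0 rho a f g Hf Hg) as [M HM]; [unfold rho; lra|].
  apply (is_C_derive_of_sqr f z (g z) M).
  assert (Hd : 0 < rho - Cmod z) by (unfold rho; lra).
  generalize (locally_Cmod_lt z _ Hd). apply filter_imp. intros w Hw.
  apply HM; [lra|]. generalize (Cmod_le_plus_minus w z). lra.
Qed.

Lemma pseries_on_holomorphic (R0 : R) (a : nat -> C) (f : C -> C) : pseries_on R0 a f ->
  holomorphic_on (disc 0 R0) f.
Proof.
  intro Hf. destruct (pseries_on_derive_ex _ _ _ Hf) as [g Hg].
  destruct (pseries_on_derive_ex _ _ _ Hg) as [h Hh].
  exists g. intros z Hz. rewrite disc_0 in Hz. split.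
  - now apply (pseries_on_is_C_derive R0 a f g).
  - eapply is_C_derive_continuous. now apply (pseries_on_is_C_derive R0 (C_PS_derive a) g h).
Qed.

Lemma pseries_on_0_coef (R0 : R) (a : nat -> C) (k : nat) : 0 < R0 ->
  pseries_on R0 a (fun _ => RtoC 0) -> a k = 0.
Proof.
  intro HR. revert a. induction k as [|k IHk]; intros a Ha.
  - symmetry. exact (pseries_on_at_0 R0 a _ HR Ha).
  - assert (Hd : C_PS_derive a k = 0).
    { apply IHk. destruct (pseries_on_derive_ex _ _ _ Ha) as [g Hg]. intros z Hz.
      replace (RtoC 0) with (g z); [now apply Hg|].
      apply (is_C_derive_functional (fun _ => RtoC 0) z); [|apply is_C_derive_const].
      now apply (pseries_on_is_C_derive R0 a (fun _ => RtoC 0) g). }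
    apply (Cmult_eq_reg_l (RtoC (INR (S k)))); [apply RtoC_neq_0, not_0_INR; lia|].
    rewrite Cmult_0_r. exact Hd.
Qed.

Lemma pseries_on_coef_unique (R0 : R) (a b : nat -> C) (f : C -> C) : 0 < R0 ->
  pseries_on R0 a f -> pseries_on R0 b f -> forall k, a k = b k.
Proof.
  intros HR Ha Hb k. apply Ceq_minus. apply (pseries_on_0_coef R0 (fun k => a k - b k)%C k HR).
  intros z Hz. rewrite <- (Cminus_diag (f z)). apply is_C_pseries_minus; auto.
Qed.

(** * Taylor expansion of holomorphic functions *)

Lemma eventually_geom_lt (A q e : R) : 0 <= q < 1 -> 0 < e ->
  eventually (fun n => A * q ^ S n < e).
Proof.
  intros Hq He.
  assert (Hlim : is_lim_seq (fun n => A * q ^ S n) (A * 0)).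
  { apply (is_lim_seq_scal_l _ A 0). apply (is_lim_seq_incr_1 (fun n => q ^ n)), is_lim_seq_geom.
    now rewrite Rabs_pos_eq. }
  rewrite Rmult_0_r in Hlim. apply is_lim_seq_spec in Hlim.
  generalize (Hlim (mkposreal e He)). apply filter_imp. simpl. intros n Hn.
  apply Rabs_def2 in Hn. lra.
Qed.

Definition circle_coef (f : C -> C) (r : R) (k : nat) : C :=
  (/ RtoC (2 * PI) * C_RInt (fun t => f (circle r t) * / circle r t ^ k)%C 0 (2 * PI))%C.

Lemma RtoC_2PI_neq_0 : RtoC (2 * PI) <> 0.
Proof. apply RtoC_neq_0. generalize PI_RGT_0. lra. Qed.

Lemma circle_coef_RInt (f : C -> C) (r : R) (k : nat) : 0 < r ->
  (forall t, continuous f (circle r t)) ->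
  is_C_RInt (fun t => f (circle r t) * / circle r t ^ k)%C 0 (2 * PI)
    (RtoC (2 * PI) * circle_coef f r k)%C.
Proof.
  intros Hr Hf. destruct (ex_circle_RInt (fun w => f w * / w ^ k)%C r) as [l Hl].
  - intro t. apply continuous_Cdiv; [apply Hf|apply continuous_Cpow, continuous_id|].
    now apply Cpow_nz, circle_neq_0.
  - unfold circle_coef. rewrite (is_C_RInt_unique _ _ _ _ Hl).
    replace (RtoC (2 * PI) * (/ RtoC (2 * PI) * l))%C with l; [exact Hl|].
    field. apply RtoC_2PI_neq_0.
Qed.

(* [c / (c - z) = (z/c)^0 + ... + (z/c)^n + c / (c - z) (z/c)^(n+1)] under the integral sign. *)
Lemma circle_RInt_remainder (f : C -> C) (z : C) (r : R) (m : C) (n : nat) : Cmod z < r ->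
  (forall t, continuous f (circle r t)) ->
  is_C_RInt (fun t => f (circle r t) * (circle r t / (circle r t - z)))%C 0 (2 * PI) m ->
  is_C_RInt (fun t => f (circle r t) * (circle r t / (circle r t - z)) * (z / circle r t) ^ S n)%C
    0 (2 * PI) (m - RtoC (2 * PI) * C_psum (circle_coef f r) z n)%C.
Proof.
  intros Hz Hf Hm. assert (Hr : 0 < r) by (generalize (Cmod_ge_0 z); lra).
  generalize PI_RGT_0. intro Hpi.
  assert (Hstep : forall k e,
    is_C_RInt (fun t => f (circle r t) * (circle r t / (circle r t - z)) * (z / circle r t) ^ k)%C
      0 (2 * PI) e ->
    is_C_RInt (fun t => f (circle r t) * (circle r t / (circle r t - z)) * (z / circle r t) ^ S k)%C
      0 (2 * PI) (e - z ^ k * (RtoC (2 * PI) * circle_coef f r k))%C).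
  { intros k e He.
    apply (is_C_RInt_ext (fun t => f (circle r t) * (circle r t / (circle r t - z)) *
      (z / circle r t) ^ k - z ^ k * (f (circle r t) * / circle r t ^ k))%C); [lra| |].
    - intros t _. rewrite Cpow_S. unfold Cdiv.
      rewrite (Cpow_mult_l z), Cpow_inv by now apply circle_neq_0.
      field. repeat split.
      + now apply Cpow_nz, circle_neq_0.
      + now apply circle_neq_0.
      + now apply circle_minus_neq_0.
    - apply is_C_RInt_minus; [exact He|]. now apply is_C_RInt_scal, circle_coef_RInt. }
  induction n as [|n IHn].
  - rewrite C_psum_0, <- (Cmult_1_l (RtoC (2 * PI) * circle_coef f r 0)). apply (Hstep 0%nat).
    apply (is_C_RInt_ext (fun t => f (circle r t) * (circle r t / (circle r t - z)))%C);
      [lra| |exact Hm].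
    intros t _. simpl. ring.
  - rewrite C_psum_S.
    replace (m - RtoC (2 * PI) * (C_psum (circle_coef f r) z n + circle_coef f r (S n) * z ^ S n))%C
      with (m - RtoC (2 * PI) * C_psum (circle_coef f r) z n -
        z ^ S n * (RtoC (2 * PI) * circle_coef f r (S n)))%C by ring.
    now apply Hstep.
Qed.

Lemma Cmod_Cauchy_kernel_le (z : C) (r t : R) : Cmod z < r ->
  Cmod (circle r t / (circle r t - z)) <= r / (r - Cmod z).
Proof.
  intro Hz. assert (Hz0 := Cmod_ge_0 z).
  rewrite Cmod_div, Cmod_circle by (try apply circle_minus_neq_0; lra).
  apply Rmult_le_compat_l; [lra|]. apply Rinv_le_contravar; [lra|now apply circle_minus_ge].
Qed.

Lemma circle_coef_psum_close (f : C -> C) (z : C) (r R0 B : R) (n : nat) : Cmod z < r < R0 ->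
  holomorphic_on (disc 0 R0) f -> (forall w, Cmod w = r -> Cmod (f w) <= B) ->
  Cmod (C_psum (circle_coef f r) z n - f z) <= B * (r / (r - Cmod z)) * (Cmod z / r) ^ S n.
Proof.
  intros Hr Hf HB. assert (Hz0 := Cmod_ge_0 z). generalize PI_RGT_0. intro Hpi.
  assert (HC := circle_RInt_remainder f z r _ n (proj1 Hr)
    (fun t => holomorphic_on_continuous _ f _ Hf (proj2 (disc_0 R0 (circle r t))
      ltac:(rewrite Cmod_circle; lra))) (Cauchy_formula R0 f z r Hf Hr)).
  apply (Cmod_is_C_RInt_le _ _ _ _ (B * (r / (r - Cmod z)) * (Cmod z / r) ^ S n)) in HC; [|lra|].
  - rewrite Cmod_minus_sym.
    replace (RtoC (2 * PI) * f z - RtoC (2 * PI) * C_psum (circle_coef f r) z n)%C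
      with (RtoC (2 * PI) * (f z - C_psum (circle_coef f r) z n))%C in HC by ring.
    rewrite Cmod_mult, Cmod_R_pos, Rminus_0_r in HC by lra.
    apply Rmult_le_reg_l with (2 * PI); lra.
  - intros t _. rewrite !Cmod_mult, Cmod_pow.
    rewrite (Cmod_div z), (Cmod_circle r) by (try apply circle_neq_0; lra).
    apply Rmult_le_compat_r.
    + apply pow_le, Rdiv_le_0_compat; lra.
    + apply Rmult_le_compat; try apply Cmod_ge_0.
      * apply HB, Cmod_circle. lra.
      * now apply Cmod_Cauchy_kernel_le.
Qed.

Lemma holomorphic_pseries_lt (R0 r : R) (f : C -> C) : holomorphic_on (disc 0 R0) f ->
  0 < r < R0 -> pseries_on r (circle_coef f r) f.
Proof.
  intros Hf Hr z Hz. assert (Hz0 := Cmod_ge_0 z).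
  destruct (bounded_on_closed_disc 0 r f) as [B [_ HB]].
  { intros w Hw. apply (holomorphic_on_continuous _ _ _ Hf). unfold disc. lra. }
  apply is_C_pseries_Cmod. intros e He.
  assert (Hq : 0 <= Cmod z / r < 1).
  { split; [apply Rdiv_le_0_compat; lra|]. apply Rlt_div_l; lra. }
  generalize (eventually_geom_lt (B * (r / (r - Cmod z))) (Cmod z / r) e Hq He).
  apply filter_imp. intros n Hn. eapply Rle_lt_trans; [|exact Hn].
  apply (circle_coef_psum_close f z r R0); [lra|exact Hf|].
  intros w Hw. apply HB. rewrite Cminus_0_r. lra.
Qed.

Lemma holomorphic_pseries (R0 : R) (f : C -> C) : 0 < R0 -> holomorphic_on (disc 0 R0) f ->
  exists a, pseries_on R0 a f.
Proof.
  intros HR Hf. assert (Ha := holomorphic_pseries_lt R0 (R0 / 2) f Hf ltac:(lra)).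
  exists (circle_coef f (R0 / 2)). intros z Hz. set (r := Rmax (R0 / 2) ((Cmod z + R0) / 2)).
  assert (Hr : R0 / 2 <= r /\ Cmod z < r /\ r < R0).
  { assert (Hhalf : R0 / 2 <= r) by apply Rmax_l.
    assert (Hmid : (Cmod z + R0) / 2 <= r) by apply Rmax_r.
    assert (HrR : r < R0) by (apply Rmax_lub_lt; lra). lra. }
  assert (Hb := holomorphic_pseries_lt R0 r f Hf ltac:(lra)).
  apply (is_C_pseries_ext (circle_coef f r)); [|apply Hb; lra]. intro k.
  apply (pseries_on_coef_unique (R0 / 2) _ _ f); [lra| |exact Ha].
  intros w Hw. apply Hb. lra.
Qed.

Lemma analytic_at_holomorphic (f : C -> C) (z : C) :
  analytic_at f z <-> exists r, 0 < r /\ holomorphic_on (disc z r) f.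
Proof.
  split.
  - intros [a [r [Hr Ha]]]. exists r. split; [exact Hr|]. apply holomorphic_on_shift.
    apply (pseries_on_holomorphic r a). intros h Hh.
    specialize (Ha (z + h)%C). replace (z + h - z)%C with h in Ha by ring. exact (Ha Hh).
  - intros [r [Hr Hf]]. apply holomorphic_on_shift in Hf.
    destruct (holomorphic_pseries r _ Hr Hf) as [a Ha].
    exists a, r. split; [exact Hr|]. intros w Hw. specialize (Ha (w - z)%C Hw).
    cbv beta in Ha. replace (z + (w - z))%C with w in Ha by ring. exact Ha.
Qed.

Lemma analytic_on_holomorphic (A : C -> Prop) (f : C -> C) : open A ->
  analytic_on A f <-> holomorphic_on A f.
Proof.
  intro HA. split; intro Hf.
  - apply holomorphic_on_local. intros z Hz. now apply analytic_at_holomorphic, Hf.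
  - intros z Hz. apply analytic_at_holomorphic.
    destruct (proj1 (open_Cmod A) HA z Hz) as [d [Hd HAd]].
    exists d. split; [exact Hd|]. now apply (holomorphic_on_subset A).
Qed.

Lemma holomorphic_on_C_derive (A : C -> Prop) (f : C -> C) : open A -> holomorphic_on A f ->
  holomorphic_on A (C_derive f).
Proof.
  intros HA Hf. apply holomorphic_on_local. intros z Hz.
  destruct (proj1 (open_Cmod A) HA z Hz) as [d [Hd HAd]]. exists d. split; [exact Hd|].
  apply (holomorphic_on_subset A (disc z d) f HAd) in Hf.
  destruct (holomorphic_pseries d _ Hd (proj1 (holomorphic_on_shift _ _ _) Hf)) as [a Ha].
  destruct (pseries_on_derive_ex _ _ _ Ha) as [g Hg].
  apply holomorphic_on_shift.
  apply (holomorphic_on_ext _ g);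
    [apply open_disc| |now apply (pseries_on_holomorphic _ (C_PS_derive a))].
  intros h Hh. apply (is_C_derive_functional (fun h => f (z + h)%C) h).
  - apply (pseries_on_is_C_derive d a _ g Ha Hg). now apply disc_0.
  - apply is_C_derive_shift, (holomorphic_on_derive (disc z d)); [exact Hf|now apply disc_shift].
Qed.

Lemma pseries_on_factor (R0 : R) (a : nat -> C) (f : C -> C) : 0 < R0 -> pseries_on R0 a f ->
  exists g, pseries_on R0 (fun k => a (S k)) g /\
    forall z, Cmod z < R0 -> f z = (a 0%nat + z * g z)%C.
Proof.
  intros HR Hf. exists (fun z => if Ceq_dec z 0 then a 1%nat else ((f z - a 0%nat) / z)%C).
  split; intros z Hz; destruct (Ceq_dec z 0) as [->|Hn].
  - exact (is_pseries_0 (K := C_AbsRing) (V := C_NormedModule) (fun k => a (S k))).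
  - apply is_C_pseries_decr_1; auto.
  - rewrite (pseries_on_at_0 R0 a f HR Hf). ring.
  - now field.
Qed.

Lemma holomorphic_factor (R0 : R) (f : C -> C) : 0 < R0 -> holomorphic_on (disc 0 R0) f ->
  exists g, holomorphic_on (disc 0 R0) g /\ forall z, Cmod z < R0 -> f z = (f 0 + z * g z)%C.
Proof.
  intros HR Hf. destruct (holomorphic_pseries _ _ HR Hf) as [a Ha].
  destruct (pseries_on_factor _ _ _ HR Ha) as [g [Hg E]]. exists g. split.
  - now apply (pseries_on_holomorphic R0 (fun k => a (S k))).
  - now rewrite (pseries_on_at_0 R0 a f HR Ha).
Qed.

Lemma is_C_derive_factor_0 (R0 : R) (f g : C -> C) : 0 < R0 -> holomorphic_on (disc 0 R0) g ->
  (forall z, Cmod z < R0 -> f z = (f 0 + z * g z)%C) -> is_C_derive f (RtoC 0) (g 0).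
Proof.
  intros HR Hg E. assert (D0 := disc_center 0 R0 HR).
  apply (is_C_derive_ext_loc (fun z => f 0 + z * g z)%C).
  - generalize (locally_Cmod_lt (RtoC 0) R0 HR). apply filter_imp. intros z Hz.
    symmetry. apply E. now apply disc_0.
  - apply (is_C_derive_eq _ _ (0 + (1 * g 0 + 0 * C_derive g 0))%C); [ring|].
    apply is_C_derive_plus; [apply is_C_derive_const|].
    apply is_C_derive_mult; [apply is_C_derive_id|now apply (holomorphic_on_derive (disc 0 R0))].
Qed.

Lemma C_derive2_at_0 (R0 : R) (f g : C -> C) (l : C) : 0 < R0 -> holomorphic_on (disc 0 R0) g ->
  (forall z, Cmod z < R0 -> f z = (f 0 + z * (l + z * g z))%C) ->
  C_derive f 0 = l /\ C_derive (C_derive f) 0 = (2 * g 0)%C.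
Proof.
  intros HR Hg Ef. set (h := fun z => (2 * g z + z * C_derive g z)%C).
  assert (Dg : forall z, Cmod z < R0 -> is_C_derive g z (C_derive g z)).
  { intros z Hz. apply (holomorphic_on_derive (disc 0 R0)); [exact Hg|now apply disc_0]. }
  assert (Df : forall z, Cmod z < R0 -> C_derive f z = (l + z * h z)%C).
  { intros z Hz. apply is_C_derive_unique.
    apply (is_C_derive_ext_loc (fun z => f 0 + z * (l + z * g z))%C).
    { apply (filter_imp (disc 0 R0)); [|now apply open_disc, disc_0].
      intros w Hw. symmetry. apply Ef. now rewrite <- disc_0. }
    apply (is_C_derive_eq _ _
      (0 + (1 * (l + z * g z) + z * (0 + (1 * g z + z * C_derive g z))))%C); [unfold h; ring|].
    apply is_C_derive_plus; [apply is_C_derive_const|].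
    apply (is_C_derive_mult (fun z => z) (fun z => l + z * g z)%C); [apply is_C_derive_id|].
    apply is_C_derive_plus; [apply is_C_derive_const|].
    apply (is_C_derive_mult (fun z => z) g); [apply is_C_derive_id|now apply Dg]. }
  assert (Dl : C_derive f 0 = l) by (rewrite Df by (rewrite Cmod_0; exact HR); ring).
  split; [exact Dl|]. replace (2 * g 0)%C with (h 0) by (unfold h; ring).
  apply is_C_derive_unique, (is_C_derive_factor_0 R0 _ h HR).
  - apply holomorphic_on_plus; [now apply holomorphic_on_scal|].
    apply holomorphic_on_mult; [apply holomorphic_on_id|].
    now apply holomorphic_on_C_derive; [apply open_disc|].
  - intros z Hz. now rewrite Dl, Df.
Qed.

(** * The maximum principle and Schwarz's lemma *)

Lemma Cauchy_estimate (R0 : R) (f : C -> C) (z : C) (r M : R) :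
  holomorphic_on (disc 0 R0) f -> Cmod z < r < R0 ->
  (forall w, Cmod w = r -> Cmod (f w) <= M) -> Cmod (f z) <= r / (r - Cmod z) * M.
Proof.
  intros Hf Hr HM. generalize PI_RGT_0 (Cmod_ge_0 z). intros Hpi Hz0.
  assert (H := Cauchy_formula R0 f z r Hf Hr).
  apply (Cmod_is_C_RInt_le _ _ _ _ (r / (r - Cmod z) * M)) in H; [|lra|].
  - rewrite Cmod_mult, Cmod_R_pos, Rminus_0_r in H by lra.
    apply Rmult_le_reg_l with (2 * PI); lra.
  - intros t _. rewrite Cmod_mult, Rmult_comm.
    apply Rmult_le_compat; try apply Cmod_ge_0.
    + now apply Cmod_Cauchy_kernel_le.
    + apply HM, Cmod_circle. lra.
Qed.

(* Apply [Cauchy_estimate] to the powers of [f] and take roots. *)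
Lemma maximum_modulus (R0 : R) (f : C -> C) (z : C) (r M : R) :
  holomorphic_on (disc 0 R0) f -> Cmod z < r < R0 ->
  (forall w, Cmod w = r -> Cmod (f w) <= M) -> Cmod (f z) <= M.
Proof.
  intros Hf Hr HM. assert (Hz0 := Cmod_ge_0 z).
  assert (HM0 : 0 <= M).
  { eapply Rle_trans; [apply Cmod_ge_0|apply (HM (RtoC r))]. apply Cmod_R_pos. lra. }
  apply Rnot_lt_le. set (F := Cmod (f z)). intro Hlt.
  set (A := r / (r - Cmod z)).
  assert (Hpow : forall k, F ^ k <= A * M ^ k).
  { intro k. unfold F. rewrite <- Cmod_pow.
    apply (Cauchy_estimate R0 (fun z => f z ^ k)%C); [now apply holomorphic_on_pow|exact Hr|].
    intros w Hw. rewrite Cmod_pow. apply pow_incr. split; [apply Cmod_ge_0|now apply HM]. }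
  assert (Hq : 0 <= M / F < 1).
  { split; [apply Rdiv_le_0_compat; lra|]. apply Rlt_div_l; lra. }
  destruct (filter_ex _ (eventually_geom_lt A (M / F) 1 Hq Rlt_0_1)) as [n Hn].
  specialize (Hpow (S n)). assert (HF : 0 < F ^ S n) by (apply pow_lt; lra).
  replace (A * (M / F) ^ S n) with (A * M ^ S n / F ^ S n) in Hn.
  - apply Rlt_div_l in Hn; [lra|exact HF].
  - unfold Rdiv. rewrite Rpow_mult_distr, pow_inv. ring.
Qed.

Lemma ex_zero_of_small_center (R0 : R) (f : C -> C) (r m : R) :
  holomorphic_on (disc 0 R0) f -> 0 < r < R0 -> (forall w, Cmod w = r -> m <= Cmod (f w)) ->
  Cmod (f 0) < m -> exists z, Cmod z < R0 /\ f z = 0.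
Proof.
  intros Hf Hr Hm H0. apply NNPP. intro Hno.
  assert (Hn : forall z, Cmod z < R0 -> f z <> 0).
  { intros z Hz E. apply Hno. now exists z. }
  assert (Hf0 : 0 < Cmod (f 0)) by (apply Cmod_gt_0, Hn; rewrite Cmod_0; lra).
  assert (Hmax : Cmod (1 / f 0) <= / m).
  { apply (maximum_modulus R0 (fun z => 1 / f z)%C 0 r).
    - apply holomorphic_on_div; [apply holomorphic_on_const|exact Hf|].
      intros z Hz. apply Hn. now apply disc_0.
    - rewrite Cmod_0. lra.
    - intros w Hw. rewrite Cmod_div, Cmod_1, Rdiv_1_l by (apply Hn; lra).
      apply Rinv_le_contravar; [lra|now apply Hm]. }
  rewrite Cmod_div, Cmod_1, Rdiv_1_l in Hmax by now apply Cmod_gt_0.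
  assert (/ m < / Cmod (f 0)); [|lra].
  apply Rinv_lt_contravar; [apply Rmult_lt_0_compat; lra|exact H0].
Qed.

Lemma Rmult_le_limit_l (x B r0 R0 : R) : r0 < R0 -> (forall r, r0 < r < R0 -> x * r <= B) ->
  x * R0 <= B.
Proof.
  intros Hr Hlim. apply le_epsilon. intros e He.
  set (d := Rmin ((R0 - r0) / 2) (e / (Rabs x + 1))).
  assert (Hx := Rabs_pos x).
  assert (Hdr : d <= (R0 - r0) / 2) by apply Rmin_l.
  assert (Hde : d <= e / (Rabs x + 1)) by apply Rmin_r.
  assert (Hd : 0 < d) by (apply Rmin_pos; [|apply Rdiv_lt_0_compat]; lra).
  specialize (Hlim (R0 - d) ltac:(lra)). apply Rle_div_r in Hde; [|lra].
  generalize (Rle_abs x). nra.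
Qed.

Lemma Cmod_factor_le (R0 : R) (g : C -> C) (B : R) : holomorphic_on (disc 0 R0) g ->
  (forall z, Cmod z < R0 -> Cmod (z * g z) <= B) ->
  forall z, Cmod z < R0 -> Cmod (g z) * R0 <= B.
Proof.
  intros Hg HB z Hz. apply (Rmult_le_limit_l _ _ (Cmod z)); [exact Hz|]. intros r Hr.
  assert (Hr0 : 0 < r) by (generalize (Cmod_ge_0 z); lra).
  apply Rle_div_r; [exact Hr0|]. apply (maximum_modulus R0 g z r); auto.
  intros w Hw. apply Rle_div_r; [exact Hr0|].
  rewrite Rmult_comm, <- Hw, <- Cmod_mult. apply HB. lra.
Qed.

Lemma holomorphic_on_disc_0_1 (f : C -> C) :
  holomorphic_on (disc 0 1) f <-> holomorphic_on disk f.
Proof. split; apply holomorphic_on_subset; intro z; apply disc_0_1. Qed.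

Lemma holomorphic_factor2 (f : C -> C) : holomorphic_on disk f ->
  exists f1 f2, holomorphic_on disk f1 /\ holomorphic_on disk f2 /\
    forall z, disk z -> f z = (f 0 + z * f1 z)%C /\ f1 z = (f1 0 + z * f2 z)%C.
Proof.
  intro Hf. apply holomorphic_on_disc_0_1 in Hf.
  destruct (holomorphic_factor 1 f Rlt_0_1 Hf) as [f1 [Hf1 E1]].
  destruct (holomorphic_factor 1 f1 Rlt_0_1 Hf1) as [f2 [Hf2 E2]].
  exists f1, f2. split; [now apply holomorphic_on_disc_0_1|].
  split; [now apply holomorphic_on_disc_0_1|]. intros z Hz. split; [now apply E1|now apply E2].
Qed.

Lemma Schwarz_lemma (f : C -> C) (B : R) : holomorphic_on disk f -> f 0 = 0 ->
  (forall z, disk z -> Cmod (f z) <= B) ->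
  exists g, holomorphic_on disk g /\ (forall z, disk z -> f z = (z * g z)%C) /\
    forall z, disk z -> Cmod (g z) <= B.
Proof.
  intros Hf H0 HB. apply holomorphic_on_disc_0_1 in Hf.
  destruct (holomorphic_factor 1 f Rlt_0_1 Hf) as [g [Hg E]].
  assert (E' : forall z, disk z -> f z = (z * g z)%C).
  { intros z Hz. rewrite E, H0 by exact Hz. ring. }
  exists g. split; [now apply holomorphic_on_disc_0_1|]. split; [exact E'|].
  intros z Hz. rewrite <- (Rmult_1_r (Cmod (g z))). apply Cmod_factor_le; auto.
  intros w Hw. rewrite <- E' by exact Hw. now apply HB.
Qed.

Lemma holomorphic_difference_quotient (c : C) (r : R) (f : C -> C) (B : R) : 0 < r ->
  holomorphic_on (disc c r) f -> (forall z, disc c r z -> Cmod (f z) <= B) ->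
  exists g, holomorphic_on (disc 0 r) g /\ g 0 = C_derive f c /\
    (forall h, Cmod h < r -> f (c + h)%C = (f c + h * g h)%C) /\
    forall h, Cmod h < r -> Cmod (g h) <= 2 * B / r.
Proof.
  intros Hr Hf HB. assert (Hfc := proj1 (holomorphic_on_shift c r f) Hf).
  destruct (holomorphic_factor r _ Hr Hfc) as [g [Hg E]].
  assert (D := is_C_derive_factor_0 r _ g Hr Hg E). cbv beta in E. rewrite Cplus_0_r in E.
  exists g. split; [exact Hg|]. split; [|split; [exact E|]].
  - apply (is_C_derive_functional (fun h => f (c + h)%C) 0); [exact D|]. apply is_C_derive_shift.
    rewrite Cplus_0_r. apply (holomorphic_on_derive (disc c r)); [exact Hf|now apply disc_center].
  - intros h Hh. apply Rle_div_r; [exact Hr|]. revert h Hh. apply Cmod_factor_le; [exact Hg|].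
    intros h Hh. replace (h * g h)%C with (f (c + h) - f c)%C by (rewrite E by exact Hh; ring).
    eapply Rle_trans; [apply Cmod_minus_le|].
    assert (Bch : Cmod (f (c + h)%C) <= B) by (apply HB, disc_shift, disc_0, Hh).
    assert (Bc : Cmod (f c) <= B) by (apply HB; now apply disc_center). lra.
Qed.

Lemma holomorphic_lipschitz (c : C) (r : R) (f : C -> C) (B : R) (w : C) :
  holomorphic_on (disc c r) f -> (forall z, disc c r z -> Cmod (f z) <= B) -> disc c r w ->
  Cmod (f w - f c) <= 2 * B / r * Cmod (w - c).
Proof.
  intros Hf HB Hw. assert (Hr : 0 < r) by (unfold disc in Hw; generalize (Cmod_ge_0 (w - c)); lra).
  destruct (holomorphic_difference_quotient c r f B Hr Hf HB) as [g [_ [_ [E Hg]]]].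
  replace w with (c + (w - c))%C at 1 by ring. rewrite E by exact Hw.
  replace (f c + (w - c) * g (w - c) - f c)%C with (g (w - c) * (w - c))%C by ring.
  rewrite Cmod_mult. apply Rmult_le_compat_r; [apply Cmod_ge_0|now apply Hg].
Qed.

Lemma holomorphic_taylor2 (c : C) (r : R) (f : C -> C) (B : R) (w : C) :
  holomorphic_on (disc c r) f -> (forall z, disc c r z -> Cmod (f z) <= B) -> disc c r w ->
  Cmod (f w - f c - C_derive f c * (w - c)) <= 4 * B / (r * r) * Cmod (w - c) ^ 2.
Proof.
  intros Hf HB Hw. assert (Hr : 0 < r) by (unfold disc in Hw; generalize (Cmod_ge_0 (w - c)); lra).
  destruct (holomorphic_difference_quotient c r f B Hr Hf HB) as [g [Hg [Eg0 [E Hgb]]]].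
  rewrite <- Eg0. set (h := (w - c)%C). assert (Hh : Cmod h < r) by exact Hw.
  replace w with (c + h)%C by (unfold h; ring). rewrite E by exact Hh.
  replace (f c + h * g h - f c - g 0 * h)%C with (h * (g h - g 0))%C by ring. rewrite Cmod_mult.
  replace (4 * B / (r * r) * Cmod h ^ 2) with (Cmod h * (2 * (2 * B / r) / r * Cmod h))
    by (field; lra).
  apply Rmult_le_compat_l; [apply Cmod_ge_0|]. rewrite <- (Cminus_0_r h) at 2.
  apply holomorphic_lipschitz; [exact Hg| |now apply disc_0].
  intros k Hk. now apply Hgb, disc_0.
Qed.

(** * Automorphisms of the disk *)

Lemma one_plus_neq_0 (x : C) : Cmod x < 1 -> (1 + x)%C <> 0.
Proof.
  intros Hx E. replace x with (- (1))%C in Hx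
    by (replace x with (1 + x - 1)%C by ring; rewrite E; ring).
  rewrite Cmod_m1 in Hx. lra.
Qed.

Lemma sigma_denom_neq_0 (a z : C) : Cmod a < 1 -> Cmod z <= 1 -> (1 + Cconj a * z)%C <> 0.
Proof. intros Ha Hz. apply one_plus_neq_0, Cmod_mult_lt_1; [now rewrite Cmod_conj|exact Hz]. Qed.

Lemma one_minus_Cmod_sqr_pos (a : C) : Cmod a < 1 -> 0 < 1 - Cmod a ^ 2.
Proof. generalize (Cmod_ge_0 a). nra. Qed.

Lemma one_minus_Cmult_Cconj (a : C) : (1 - a * Cconj a)%C = RtoC (1 - Cmod a ^ 2).
Proof. now rewrite Cmult_Cconj, RtoC_minus. Qed.

Lemma one_minus_Cmult_Cconj_neq_0 (a : C) : Cmod a < 1 -> (1 - a * Cconj a)%C <> 0.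
Proof.
  intro Ha. rewrite one_minus_Cmult_Cconj. apply RtoC_neq_0.
  generalize (one_minus_Cmod_sqr_pos a Ha). lra.
Qed.

Lemma one_minus_Cmod_sigma_sqr (a z : C) : Cmod a < 1 -> Cmod z <= 1 ->
  1 - Cmod (sigma a z) ^ 2 = (1 - Cmod a ^ 2) * (1 - Cmod z ^ 2) / Cmod (1 + Cconj a * z) ^ 2.
Proof.
  intros Ha Hz. assert (Hd := sigma_denom_neq_0 a z Ha Hz). unfold sigma.
  rewrite Cmod_div by exact Hd.
  replace ((1 - Cmod a ^ 2) * (1 - Cmod z ^ 2)) with (Cmod (1 + Cconj a * z) ^ 2 - Cmod (z + a) ^ 2)
    by (rewrite !Cmod2_alt; destruct a, z; simpl; ring).
  apply Cmod_gt_0 in Hd. field. lra.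
Qed.

Lemma Cmod_sigma_lt_1 (a z : C) : Cmod a < 1 -> Cmod z < 1 -> Cmod (sigma a z) < 1.
Proof.
  intros Ha Hz. assert (E := one_minus_Cmod_sigma_sqr a z Ha (Rlt_le _ _ Hz)).
  assert (Hd := sigma_denom_neq_0 a z Ha (Rlt_le _ _ Hz)). apply Cmod_gt_0 in Hd.
  assert (0 < 1 - Cmod (sigma a z) ^ 2).
  { rewrite E. apply Rdiv_lt_0_compat; [|now apply pow_lt].
    now apply Rmult_lt_0_compat; apply one_minus_Cmod_sqr_pos. }
  generalize (Cmod_ge_0 (sigma a z)). nra.
Qed.

Lemma sigma_opp_sigma (a z : C) : Cmod a < 1 -> Cmod z <= 1 -> sigma (- a) (sigma a z) = z.
Proof.
  intros Ha Hz. unfold sigma. rewrite Copp_conj. field.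
  split; [now apply sigma_denom_neq_0|].
  replace (1 + Cconj a * z + - Cconj a * (z + a))%C with (1 - a * Cconj a)%C by ring.
  now apply one_minus_Cmult_Cconj_neq_0.
Qed.

Lemma sigma_sigma_opp (a z : C) : Cmod a < 1 -> Cmod z <= 1 -> sigma a (sigma (- a) z) = z.
Proof.
  intros Ha Hz. replace (sigma a) with (sigma (- - a)) by (f_equal; ring).
  apply sigma_opp_sigma; [now rewrite Cmod_opp|exact Hz].
Qed.

Lemma sigma_at_0 (a : C) : sigma a 0 = a.
Proof. unfold sigma. field. Qed.

Lemma sigma_opp_self (a : C) : sigma (- a) a = 0.
Proof. unfold sigma. replace (a + - a)%C with (RtoC 0) by ring. apply Cmult_0_l. Qed.

Lemma sigma_minus (a u v : C) : Cmod a < 1 -> Cmod u <= 1 -> Cmod v <= 1 ->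
  (sigma a u - sigma a v)%C =
    ((1 - a * Cconj a) * (u - v) / ((1 + Cconj a * u) * (1 + Cconj a * v)))%C.
Proof.
  intros Ha Hu Hv. assert (Hdu := sigma_denom_neq_0 a u Ha Hu).
  assert (Hdv := sigma_denom_neq_0 a v Ha Hv). unfold sigma. field. auto.
Qed.

(* On [Cmod z <= s] the deficit [1 - |sigma a z|^2] is at least [(1 - |a|^2) (1 - s^2) / 4]. *)
Lemma Cmod_sigma_le_uniform (a : C) (s : R) : Cmod a < 1 -> 0 <= s <= 1 ->
  exists rho, 0 <= rho <= 1 /\ (s < 1 -> rho < 1) /\
    forall z, Cmod z <= s -> Cmod (sigma a z) <= rho.
Proof.
  intros Ha Hs. assert (Hap := one_minus_Cmod_sqr_pos a Ha). assert (Ha0 := Cmod_ge_0 a).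
  set (k := (1 - Cmod a ^ 2) * (1 - s ^ 2) / 4).
  assert (Hs2 : 0 <= 1 - s ^ 2 <= 1) by nra. assert (Ha2 : 1 - Cmod a ^ 2 <= 1) by nra.
  assert (Hk : 0 <= k <= 1 / 4) by (unfold k; split; nra).
  exists (sqrt (1 - k)). split; [|split].
  - split; [apply sqrt_pos|]. rewrite <- sqrt_1 at 2. apply sqrt_le_1; lra.
  - intro Hs1. rewrite <- sqrt_1 at 2. apply sqrt_lt_1; try lra.
    assert (0 < k); [|lra]. unfold k. assert (0 < 1 - s ^ 2) by nra. nra.
  - intros z Hz. assert (Hz1 : Cmod z <= 1) by lra. assert (Hz0 := Cmod_ge_0 z).
    assert (Hd := sigma_denom_neq_0 a z Ha Hz1). apply Cmod_gt_0 in Hd.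
    assert (Hd2 : Cmod (1 + Cconj a * z) <= 2).
    { eapply Rle_trans; [apply Cmod_triangle|]. rewrite Cmod_1, Cmod_mult, Cmod_conj. nra. }
    assert (Hdef : k <= 1 - Cmod (sigma a z) ^ 2).
    { rewrite one_minus_Cmod_sigma_sqr by assumption. apply (Rle_div_r k); [now apply pow_lt|].
      apply Rle_trans with (k * 2 ^ 2).
      - apply Rmult_le_compat_l; [lra|]. apply pow_incr. lra.
      - unfold k. assert (1 - s ^ 2 <= 1 - Cmod z ^ 2) by nra. nra. }
    rewrite <- (sqrt_pow2 (Cmod (sigma a z))) by apply Cmod_ge_0.
    apply sqrt_le_1; [apply pow2_ge_0|lra|lra].
Qed.

Lemma Cmod_sigma_le_1 (a z : C) : Cmod a < 1 -> Cmod z <= 1 -> Cmod (sigma a z) <= 1.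
Proof.
  intros Ha Hz. destruct (Cmod_sigma_le_uniform a 1 Ha) as [rho [Hrho [_ H]]]; [lra|].
  specialize (H z Hz). lra.
Qed.

Definition dsigma (a z : C) : C :=
  ((1 - a * Cconj a) / ((1 + Cconj a * z) * (1 + Cconj a * z)))%C.

Lemma is_C_derive_sigma (a z : C) : (1 + Cconj a * z)%C <> 0 ->
  is_C_derive (sigma a) z (dsigma a z).
Proof.
  intro Hd. apply (is_C_derive_eq _ _ (((1 + 0) * (1 + Cconj a * z) - (z + a) * Cconj a) /
    ((1 + Cconj a * z) * (1 + Cconj a * z)))%C); [unfold dsigma; now field|].
  apply (is_C_derive_div (fun z => z + a)%C (fun z => 1 + Cconj a * z)%C);
    [|apply is_C_derive_affine|exact Hd].
  apply is_C_derive_plus; [apply is_C_derive_id|apply is_C_derive_const].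
Qed.

Lemma dsigma_neq_0 (a z : C) : Cmod a < 1 -> Cmod z <= 1 -> dsigma a z <> 0.
Proof.
  intros Ha Hz. apply Cmult_neq_0; [now apply one_minus_Cmult_Cconj_neq_0|].
  assert (Hd := sigma_denom_neq_0 a z Ha Hz). intro E. apply C1_nz.
  rewrite <- (Cinv_r _ (Cmult_neq_0 _ _ Hd Hd)), E. apply Cmult_0_r.
Qed.

Lemma dsigma_at_0 (a : C) : dsigma a 0 = RtoC (1 - Cmod a ^ 2).
Proof. rewrite <- one_minus_Cmult_Cconj. unfold dsigma. field. Qed.

Lemma Cmod_dsigma (a u : C) : Cmod a < 1 -> Cmod u <= 1 ->
  Cmod (dsigma a u) = (1 - Cmod a ^ 2) / Cmod (1 + Cconj a * u) ^ 2.
Proof.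
  intros Ha Hu. assert (Hd := sigma_denom_neq_0 a u Ha Hu).
  assert (Pa := one_minus_Cmod_sqr_pos a Ha). unfold dsigma.
  rewrite one_minus_Cmult_Cconj, Cmod_div, Cmod_R_pos, Cmod_mult by
    (try lra; now apply Cmult_neq_0).
  now replace (Cmod (1 + Cconj a * u) ^ 2) with (Cmod (1 + Cconj a * u) * Cmod (1 + Cconj a * u))
    by ring.
Qed.

Lemma Cconj_sigma_mult_dsigma (a u : C) : Cmod a < 1 -> Cmod u <= 1 ->
  (Cconj (sigma a u) * dsigma a u)%C = (RtoC (Cmod (dsigma a u)) *
    (Cconj u + RtoC (1 - Cmod u ^ 2) * (Cconj a / (1 + Cconj a * u))))%C.
Proof.
  intros Ha Hu. assert (Hd := sigma_denom_neq_0 a u Ha Hu). rewrite Cmod_dsigma by assumption.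
  unfold sigma, dsigma. set (d := (1 + Cconj a * u)%C) in *.
  assert (Cd := Cconj_neq_0 d Hd). assert (Pd := proj1 (Cmod_gt_0 d) Hd).
  rewrite RtoC_div by (apply pow_nonzero; lra).
  rewrite <- (Cmult_Cconj d), <- !one_minus_Cmult_Cconj.
  unfold Cdiv at 1. rewrite Cmult_conj, Cinv_conj, Cplus_conj by exact Hd.
  replace (Cconj u + Cconj a)%C with (Cconj u * d + Cconj a * (1 - u * Cconj u))%C
    by (unfold d; ring).
  field. auto.
Qed.

Definition dlog_dsigma (a z : C) : C := (- (2 * Cconj a / (1 + Cconj a * z)))%C.

Lemma is_C_derive_dsigma (a z : C) : (1 + Cconj a * z)%C <> 0 ->
  is_C_derive (dsigma a) z (dsigma a z * dlog_dsigma a z)%C.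
Proof.
  intro Hd. apply (is_C_derive_eq _ _ ((0 * ((1 + Cconj a * z) * (1 + Cconj a * z)) -
    (1 - a * Cconj a) * (Cconj a * (1 + Cconj a * z) + (1 + Cconj a * z) * Cconj a)) /
    ((1 + Cconj a * z) * (1 + Cconj a * z) * ((1 + Cconj a * z) * (1 + Cconj a * z))))%C).
  - unfold dsigma, dlog_dsigma. field. exact Hd.
  - apply (is_C_derive_div (fun _ => (1 - a * Cconj a)%C)
      (fun z => (1 + Cconj a * z) * (1 + Cconj a * z))%C).
    + apply is_C_derive_const.
    + apply (is_C_derive_mult (fun z => 1 + Cconj a * z)%C (fun z => 1 + Cconj a * z)%C);
        apply is_C_derive_affine.
    + now apply Cmult_neq_0.
Qed.

Lemma holomorphic_on_sigma_comp (A : C -> Prop) (a : C) (f : C -> C) : holomorphic_on A f ->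
  Cmod a < 1 -> (forall z, A z -> Cmod (f z) <= 1) -> holomorphic_on A (fun z => sigma a (f z)).
Proof.
  intros Hf Ha HB. apply holomorphic_on_div.
  - apply holomorphic_on_plus; [exact Hf|apply holomorphic_on_const].
  - apply holomorphic_on_plus; [apply holomorphic_on_const|now apply holomorphic_on_scal].
  - intros z Hz. apply sigma_denom_neq_0; auto.
Qed.

Lemma holomorphic_on_dsigma_comp (A : C -> Prop) (a : C) (f : C -> C) : holomorphic_on A f ->
  Cmod a < 1 -> (forall z, A z -> Cmod (f z) <= 1) -> holomorphic_on A (fun z => dsigma a (f z)).
Proof.
  intros Hf Ha HB. assert (Hd : holomorphic_on A (fun z => 1 + Cconj a * f z)%C).
  { apply holomorphic_on_plus; [apply holomorphic_on_const|now apply holomorphic_on_scal]. }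
  apply holomorphic_on_div; [apply holomorphic_on_const|now apply holomorphic_on_mult|].
  intros z Hz. apply Cmult_neq_0; apply sigma_denom_neq_0; auto.
Qed.

Lemma Schwarz_Pick (f : C -> C) (z : C) : holomorphic_on disk f ->
  (forall w, disk w -> Cmod (f w) <= 1) -> Cmod (f 0) < 1 -> disk z ->
  Cmod (sigma (- f 0) (f z)) <= Cmod z.
Proof.
  intros Hf HB Ha Hz. assert (Hna : Cmod (- f 0) < 1) by now rewrite Cmod_opp.
  destruct (Schwarz_lemma (fun w => sigma (- f 0) (f w)) 1) as [g [_ [E Hg]]].
  - now apply holomorphic_on_sigma_comp.
  - apply sigma_opp_self.
  - intros w Hw. apply Cmod_sigma_le_1; auto.
  - cbv beta in E. rewrite E, Cmod_mult by exact Hz.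
    specialize (Hg z Hz). generalize (Cmod_ge_0 z). nra.
Qed.

Lemma Cmod_lt_1_of_center (f : C -> C) (z : C) : holomorphic_on disk f ->
  (forall w, disk w -> Cmod (f w) <= 1) -> Cmod (f 0) < 1 -> disk z -> Cmod (f z) < 1.
Proof.
  intros Hf HB Ha Hz. assert (HP := Schwarz_Pick f z Hf HB Ha Hz). unfold disk in Hz.
  rewrite <- (sigma_sigma_opp (f 0) (f z)) by auto. apply Cmod_sigma_lt_1; [exact Ha|lra].
Qed.

Lemma Schwarz_Pick_scaled (f : C -> C) (z : C) (t : R) : holomorphic_on disk f ->
  (forall w, disk w -> Cmod (f w) <= 1) -> Cmod (f 0) = 1 -> disk z -> 0 < t < 1 ->
  Cmod (f z - f 0) * t <= Cmod z * (Cmod (f z - f 0) + (1 - t ^ 2)).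
Proof.
  intros Hf HB Ha Hz Ht. assert (Mt : Cmod (RtoC t) = t) by (apply Cmod_R_pos; lra).
  assert (HBt : forall w, disk w -> Cmod (RtoC t * f w) <= 1).
  { intros w Hw. rewrite Cmod_mult, Mt. specialize (HB w Hw). generalize (Cmod_ge_0 (f w)). nra. }
  assert (Hat : Cmod (RtoC t * f 0) < 1) by (rewrite Cmod_mult, Mt, Ha; lra).
  assert (HP := Schwarz_Pick (fun z => RtoC t * f z)%C z (holomorphic_on_scal _ _ _ Hf) HBt Hat Hz).
  cbv beta in HP. unfold sigma in HP.
  assert (Hd : (1 + Cconj (- (RtoC t * f 0)) * (RtoC t * f z))%C <> 0).
  { apply sigma_denom_neq_0; [now rewrite Cmod_opp|auto]. }
  rewrite Cmod_div in HP by exact Hd. apply Rle_div_l in HP; [|now apply Cmod_gt_0].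
  replace (RtoC t * f z + - (RtoC t * f 0))%C with ((f z - f 0) * RtoC t)%C in HP by ring.
  rewrite Cmod_mult, Mt in HP. eapply Rle_trans; [exact HP|].
  apply Rmult_le_compat_l; [apply Cmod_ge_0|].
  replace (1 + Cconj (- (RtoC t * f 0)) * (RtoC t * f z))%C with
    (Cconj (f 0) * (f 0 - f z) + RtoC (1 - t ^ 2) * (Cconj (f 0) * f z))%C.
  - eapply Rle_trans; [apply Cmod_triangle|].
    rewrite !Cmod_mult, Cmod_conj, Ha, (Cmod_minus_sym (f 0)), Cmod_R_pos by nra.
    specialize (HB z Hz). assert (0 <= 1 - t ^ 2) by nra. nra.
  - assert (E : (f 0 * Cconj (f 0))%C = 1) by (rewrite Cmult_Cconj, Ha; f_equal; ring).
    replace (Cconj (- (RtoC t * f 0))) with (- (RtoC t * Cconj (f 0)))%C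
      by (apply injective_projections; simpl; ring).
    transitivity (f 0 * Cconj (f 0) - RtoC t * RtoC t * (Cconj (f 0) * f z))%C; [|rewrite E; ring].
    replace (1 - t ^ 2) with (1 - t * t) by ring. rewrite RtoC_minus, RtoC_mult. ring.
Qed.

Lemma maximum_modulus_const (f : C -> C) (z : C) : holomorphic_on disk f ->
  (forall w, disk w -> Cmod (f w) <= 1) -> Cmod (f 0) = 1 -> disk z -> f z = f 0.
Proof.
  intros Hf HB Ha Hz. assert (Hz0 := Cmod_ge_0 z). set (X := Cmod (f z - f 0)).
  assert (HX : (X + 2 * Cmod z) * 1 <= Cmod z * (X + 2)).
  { apply (Rmult_le_limit_l _ _ 0); [lra|]. intros t Ht.
    generalize (Schwarz_Pick_scaled f z t Hf HB Ha Hz Ht)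
      (Rmult_le_pos _ _ Hz0 (pow2_ge_0 (1 - t))). fold X. lra. }
  apply Ceq_minus, Cmod_eq_0. fold X. unfold disk in Hz. generalize (Cmod_ge_0 (f z - f 0)).
  fold X. nra.
Qed.

(* Apply [maximum_modulus_const] to the Cayley transform of [p]. *)
Lemma maximum_Re_const (p : C -> C) (z : C) : holomorphic_on disk p ->
  (forall w, disk w -> Re (p w) <= 0) -> Re (p 0) = 0 -> disk z -> p z = p 0.
Proof.
  intros Hp Hle H0 Hz.
  assert (Hd : forall w, disk w -> (1 - p w)%C <> 0).
  { intros w Hw E. apply (f_equal Re) in E. autorewrite with re_im in E. specialize (Hle w Hw).
    lra. }
  assert (Hsqr : forall w, Cmod (1 - w) ^ 2 - Cmod (1 + w) ^ 2 = - 4 * Re w).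
  { intro w. rewrite !Cmod2_alt. autorewrite with re_im. ring. }
  set (phi := fun w => ((1 + p w) / (1 - p w))%C).
  assert (Hphi : phi z = phi 0).
  { apply maximum_modulus_const; [| | |exact Hz].
    - apply holomorphic_on_div; [| |exact Hd].
      + apply holomorphic_on_plus; [apply holomorphic_on_const|exact Hp].
      + apply holomorphic_on_minus; [apply holomorphic_on_const|exact Hp].
    - intros w Hw. unfold phi. rewrite Cmod_div by now apply Hd.
      apply Rle_div_l; [now apply Cmod_gt_0, Hd|]. specialize (Hsqr (p w)). specialize (Hle w Hw).
      generalize (Cmod_ge_0 (1 - p w)). nra.
    - unfold phi. assert (Hd0 := Hd 0 disk_0). rewrite Cmod_div by exact Hd0.
      apply Cmod_gt_0 in Hd0. specialize (Hsqr (p 0)). rewrite H0 in Hsqr.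
      replace (Cmod (1 + p 0)) with (Cmod (1 - p 0)); [field; lra|].
      generalize (Cmod_ge_0 (1 + p 0)). nra. }
  assert (Hinv : forall w, disk w -> p w = ((phi w - 1) / (phi w + 1))%C).
  { intros w Hw. unfold phi. field. split; [now apply Hd|].
    replace (1 + p w + (1 - p w))%C with (RtoC 2) by ring.
    apply RtoC_neq_0. lra. }
  rewrite (Hinv z Hz), (Hinv 0 disk_0). now rewrite Hphi.
Qed.

Lemma continuous_le_of_punctured (phi : C -> R) (M : R) : continuous phi (RtoC 0) ->
  (forall z, disk z -> z <> 0 -> phi z <= M) -> phi 0 <= M.
Proof.
  intros Hphi Hle. apply Rnot_lt_le. intro Hlt.
  assert (Hloc := filter_and _ _ (continuous_gt phi (RtoC 0) M Hphi Hlt)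
    (locally_Cmod_lt (RtoC 0) 1 Rlt_0_1)).
  apply locally_Cmod in Hloc. destruct Hloc as [d [Hd Hball]].
  set (t := RtoC (d / 2)). assert (Mt : Cmod t = d / 2) by (apply Cmod_R_pos; lra).
  destruct (Hball t) as [Hgt Htd]; [rewrite Cminus_0_r; lra|].
  rewrite Cminus_0_r in Htd. assert (Ht : phi t <= M); [|lra].
  apply Hle; [exact Htd|]. apply Cmod_gt_0. lra.
Qed.

Lemma continuous_punctured_eq (f g : C -> C) : continuous f (RtoC 0) -> continuous g (RtoC 0) ->
  (forall z, disk z -> z <> 0 -> f z = g z) -> f 0 = g 0.
Proof.
  intros Hf Hg E. apply Ceq_minus, Cmod_eq_0, Rle_antisym; [|apply Cmod_ge_0].
  apply (continuous_le_of_punctured (fun z => Cmod (f z - g z))).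
  - now apply continuous_Cmod, continuous_Cminus.
  - intros z Hz Hn. rewrite E, Cminus_diag, Cmod_0 by auto. lra.
Qed.

Lemma Re_neg_at_0 (p : C -> C) : holomorphic_on disk p ->
  (forall z, disk z -> z <> 0 -> Re (p z) < 0) -> Re (p 0) < 0.
Proof.
  intros Hp Hneg.
  assert (Hp0 : Re (p 0) <= 0).
  { apply (continuous_le_of_punctured (fun z => Re (p z))).
    - apply continuous_Re, (holomorphic_on_continuous disk); [exact Hp|apply disk_0].
    - intros z Hz Hn. left. now apply Hneg. }
  destruct Hp0 as [|Hp0]; [assumption|]. exfalso.
  assert (Hle : forall z, disk z -> Re (p z) <= 0).
  { intros z Hz. destruct (Ceq_dec z 0) as [->|Hn]; [lra|]. left. now apply Hneg. }
  assert (Mh : Cmod (RtoC (1 / 2)) = 1 / 2) by (apply Cmod_R_pos; lra).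
  assert (Hh : disk (RtoC (1 / 2))) by (unfold disk; lra).
  assert (Hlt := Hneg _ Hh ltac:(apply RtoC_neq_0; lra)).
  rewrite (maximum_Re_const p _ Hp Hle Hp0 Hh) in Hlt. lra.
Qed.

(** * First-order behaviour along a ray *)

Lemma is_derive_at_right_gt (phi : R -> R) (d : R) : is_derive phi 0 d -> 0 < d ->
  at_right 0 (fun t => phi 0 < phi t).
Proof.
  intros Hphi Hd. apply is_derive_Reals in Hphi. destruct (Hphi d Hd) as [delta H].
  exists delta. intros t Ht Ht0. change (Rabs (t - 0) < delta) in Ht. rewrite Rminus_0_r in Ht.
  specialize (H t ltac:(lra) Ht). rewrite Rplus_0_l in H. apply Rabs_def2 in H.
  assert (Hq : 0 < (phi t - phi 0) / t) by lra.
  apply (Rmult_lt_compat_r t _ _ Ht0) in Hq. unfold Rdiv in Hq.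
  rewrite Rmult_assoc, Rinv_l in Hq by lra. lra.
Qed.

Lemma at_right_0_lt (d : R) : 0 < d -> at_right 0 (fun t => 0 < t < d).
Proof.
  intro Hd. exists (mkposreal d Hd). intros t Ht Hpos. split; [exact Hpos|].
  apply (Rle_lt_trans _ (Rabs (t - 0))); [rewrite Rminus_0_r; apply Rle_abs|exact Ht].
Qed.

Lemma at_right_ray (a v : C) (A : C -> Prop) : locally a A ->
  at_right 0 (fun t => A (a + RtoC t * v)%C).
Proof.
  intro HA. apply (filter_le_within (fun t => 0 < t)).
  assert (Hc : continuous (fun t : R => a + RtoC t * v)%C 0).
  { apply continuous_Cplus; [apply continuous_const|].
    apply continuous_Cmult; [apply continuous_RtoC, continuous_id|apply continuous_const]. }
  apply (Hc A). now replace (a + RtoC 0 * v)%C with a by ring.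
Qed.

Lemma is_path_derive_direction (f : C -> C) (a l v : C) : is_C_derive f a l ->
  is_path_derive (fun t => f (a + RtoC t * v)%C) 0 (l * v)%C.
Proof.
  intro Hf. apply (is_path_derive_comp f (fun t => a + RtoC t * v)%C);
    [|apply is_path_derive_affine].
  now replace (a + RtoC 0 * v)%C with a by ring.
Qed.

Lemma at_right_Re_gt (f : C -> C) (a l v : C) : is_C_derive f a l -> 0 < Re (l * v) ->
  at_right 0 (fun t => Re (f a) < Re (f (a + RtoC t * v)%C)).
Proof.
  intros Hf Hpos. assert (Hp := is_path_derive_Re _ _ _ (is_path_derive_direction f a l v Hf)).
  generalize (is_derive_at_right_gt _ _ Hp Hpos). apply filter_imp. intro t.
  now replace (a + RtoC 0 * v)%C with a by ring.
Qed.

Lemma at_right_Cmod_minus_lt (f : C -> C) (a l w v : C) : is_C_derive f a l ->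
  0 < Re (Cconj (w - f a) * (l * v)) ->
  at_right 0 (fun t => Cmod (f (a + RtoC t * v)%C - w) < Cmod (f a - w)).
Proof.
  intros Hf Hpos. assert (Hp := is_path_derive_direction f a l v Hf).
  assert (Ea : (a + RtoC 0 * v)%C = a) by ring.
  set (x := fun t => Re (f (a + RtoC t * v)%C)). set (y := fun t => Im (f (a + RtoC t * v)%C)).
  assert (Hx : is_derive x 0 (Re (l * v))) by exact (is_path_derive_Re _ _ _ Hp).
  assert (Hy : is_derive y 0 (Im (l * v))) by exact (is_path_derive_Im _ _ _ Hp).
  set (phi := fun t => - ((x t - Re w) ^ 2 + (y t - Im w) ^ 2)).
  assert (Hphi : is_derive phi 0 (2 * Re (Cconj (w - f a) * (l * v)))).
  { unfold phi. auto_derive; [now repeat split; [exists (Re (l * v))|exists (Im (l * v))]|].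
    change (Derive (fun s : R => x s) 0) with (Derive x 0).
    change (Derive (fun s : R => y s) 0) with (Derive y 0).
    rewrite (is_derive_unique x 0 _ Hx), (is_derive_unique y 0 _ Hy). unfold x, y. rewrite Ea.
    autorewrite with re_im. simpl. ring. }
  assert (Hmod : forall t, phi t = - Cmod (f (a + RtoC t * v)%C - w) ^ 2).
  { intro t. unfold phi, x, y. rewrite Cmod2_alt. now autorewrite with re_im. }
  generalize (is_derive_at_right_gt phi _ Hphi ltac:(lra)). apply filter_imp. intros t.
  rewrite !Hmod, Ea. generalize (Cmod_ge_0 (f (a + RtoC t * v)%C - w)) (Cmod_ge_0 (f a - w)). nra.
Qed.

Lemma local_min_Cmod_C_derive_0 (f : C -> C) (e l w : C) : is_C_derive f e l ->
  locally e (fun x => Cmod (f e - w) <= Cmod (f x - w)) -> f e <> w -> l = 0.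
Proof.
  intros Hf Hmin Hne. apply NNPP. intro Hl. set (v := ((w - f e) / l)%C).
  assert (Hcloser : at_right 0 (fun t => Cmod (f (e + RtoC t * v)%C - w) < Cmod (f e - w))).
  { apply (at_right_Cmod_minus_lt f e l); [exact Hf|].
    replace (Cconj (w - f e) * (l * v))%C with ((w - f e) * Cconj (w - f e))%C
      by (unfold v; field; exact Hl).
    rewrite Cmult_Cconj, re_RtoC. apply pow_lt, Cmod_gt_0, Cminus_eq_contra. congruence. }
  destruct (filter_ex _ (filter_and _ _ Hcloser (at_right_ray e v _ Hmin))) as [t [Hlt Hge]]. lra.
Qed.

Lemma at_right_Cmod_inward (a k : C) : a <> 0 -> 0 < Re k ->
  at_right 0 (fun t => Cmod (a + RtoC t * - (a * k)) < Cmod a).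
Proof.
  intros Ha Hk.
  assert (H : at_right 0 (fun t => Cmod (a + RtoC t * - (a * k) - 0) < Cmod (a - 0))).
  { apply (at_right_Cmod_minus_lt (fun z => z) a (RtoC 1) 0 (- (a * k))); [apply is_C_derive_id|].
    replace (Cconj (0 - a) * (1 * - (a * k)))%C with (a * Cconj a * k)%C
      by (apply injective_projections; simpl; ring).
    rewrite Cmult_Cconj, re_scal_l. apply Rmult_lt_0_compat; [|exact Hk].
    now apply pow_lt, Cmod_gt_0. }
  revert H. apply filter_imp. intro t. now rewrite !Cminus_0_r.
Qed.

Lemma real_nonneg_of_right_half_plane (q : C) : (forall k, 0 < Re k -> 0 <= Re (q * k)) ->
  q = RtoC (Re q) /\ 0 <= Re q.
Proof.
  intro H. assert (Hs : forall s, 0 <= Re q - Im q * s).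
  { intro s. specialize (H (1, s)). rewrite re_mult in H. simpl in H. lra. }
  split; [|specialize (Hs 0); lra].
  apply injective_projections; [reflexivity|]. change (Im q = 0).
  destruct (Req_dec (Im q) 0) as [|Hn]; [assumption|]. exfalso.
  specialize (Hs ((Re q + 1) / Im q)).
  replace (Im q * ((Re q + 1) / Im q)) with (Re q + 1) in Hs by (field; exact Hn). lra.
Qed.

(** * Jack's lemma *)

Lemma Jack_lemma (p : C -> C) (z l : C) : is_C_derive p z l -> z <> 0 ->
  (forall w, Cmod w < Cmod z -> Re (p w) <= Re (p z)) ->
    (z * l)%C = RtoC (Re (z * l)) /\ 0 <= Re (z * l).
Proof.
  intros Hp Hz Hmax. apply real_nonneg_of_right_half_plane. intros k Hk.
  apply Rnot_lt_le. intro Hneg.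
  assert (Hinc : at_right 0 (fun t => Re (p z) < Re (p (z + RtoC t * - (z * k))%C))).
  { apply (at_right_Re_gt p z l); [exact Hp|].
    replace (l * - (z * k))%C with (- (z * l * k))%C by ring. rewrite re_opp. lra. }
  destruct (filter_ex _ (filter_and _ _ Hinc (at_right_Cmod_inward z k Hz Hk)))
    as [t [Hlarger Hinward]].
  specialize (Hmax _ Hinward). lra.
Qed.

Lemma ex_first_zero_Re (p : C -> C) (z1 : C) : holomorphic_on disk p -> Re (p 0) < 0 ->
  disk z1 -> 0 <= Re (p z1) ->
  exists z, disk z /\ z <> 0 /\ Re (p z) = 0 /\ forall w, Cmod w < Cmod z -> Re (p w) < 0.
Proof.
  intros Hp H0 Hz1 Hge. unfold disk in Hz1.
  assert (HRe : forall z, disk z -> continuous (fun w => Re (p w)) z).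
  { intros z Hz. now apply continuous_Re, (holomorphic_on_continuous disk). }
  set (K := fun z => Cmod z <= Cmod z1 /\ 0 <= Re (p z)).
  assert (HK : closed K).
  { intros z Hz. apply NNPP. intro Hn. apply Hz.
    destruct (Rle_lt_dec (Cmod z) (Cmod z1)) as [Hle|Hlt].
    - assert (Hneg : Re (p z) < 0) by (apply Rnot_le_lt; intro; now apply Hn).
      generalize (continuous_lt _ z 0 (HRe z ltac:(unfold disk; lra)) Hneg).
      apply filter_imp. intros w Hw [_ Hw']. lra.
    - generalize (continuous_gt Cmod z (Cmod z1) (continuous_Cmod _ z (continuous_id z)) Hlt).
      apply filter_imp. intros w Hw [Hw' _]. lra. }
  destruct (compact_argmin K (Cmod z1) Cmod HK) as [z [[Hz Hpz] Hmin]].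
  - now intros z [Hz _].
  - exists z1. split; [lra|exact Hge].
  - intros z _. apply continuous_Cmod, continuous_id.
  - assert (Dz : disk z) by (unfold disk; lra).
    assert (Hz0 : z <> RtoC 0) by (intro E; rewrite E in Hpz; lra).
    assert (Hin : forall w, Cmod w < Cmod z -> Re (p w) < 0).
    { intros w Hw. apply Rnot_le_lt. intro Hpw.
      assert (Kw : K w) by (split; [lra|exact Hpw]). specialize (Hmin w Kw). lra. }
    exists z. repeat split; auto. apply Rle_antisym; [|exact Hpz]. apply Rnot_lt_le. intro Hgt.
    assert (Hray := at_right_ray z (- (z * 1)) _ (continuous_gt _ z 0 (HRe z Dz) Hgt)).
    assert (Hinw := at_right_Cmod_inward z 1 Hz0 Rlt_0_1).
    destruct (filter_ex _ (filter_and _ _ Hray Hinw)) as [t [Hpos Hcloser]].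
    specialize (Hin _ Hcloser). lra.
Qed.

Lemma Re_neg_of_no_contact (p : C -> C) : holomorphic_on disk p -> Re (p 0) < 0 ->
  (forall z k, disk z -> z <> 0 -> Re (p z) = 0 -> (z * C_derive p z)%C = RtoC k -> k < 0) ->
  forall z, disk z -> Re (p z) < 0.
Proof.
  intros Hp Hp0 Hno z1 Hz1. apply Rnot_le_lt. intro Hge.
  destruct (ex_first_zero_Re p z1 Hp Hp0 Hz1 Hge) as [z [Dz [Hz [E Hin]]]].
  destruct (Jack_lemma p z (C_derive p z)) as [Ek Hk].
  - now apply (holomorphic_on_derive disk).
  - exact Hz.
  - intros w Hw. specialize (Hin w Hw). lra.
  - specialize (Hno z _ Dz Hz E Ek). lra.
Qed.

(** * Univalent functions *)

Lemma const_of_C_derive_0 (R0 : R) (f : C -> C) (z : C) :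
  (forall w, Cmod w < R0 -> is_C_derive f w (RtoC 0)) -> Cmod z < R0 -> f z = f 0.
Proof.
  intros Hf Hz.
  assert (E : f (RtoC 0 * z)%C = f (RtoC 1 * z)%C).
  { apply (eq_is_derive (V := C_R_NormedModule) (fun t => f (RtoC t * z)%C)); [|lra].
    intros t Ht. assert (Hd : is_C_derive f (RtoC t * z)%C (RtoC 0)).
    { apply Hf. rewrite Cmod_mult, Cmod_R_pos by lra. generalize (Cmod_ge_0 z). nra. }
    generalize (is_path_derive_ray f z 0 t Hd). now rewrite Cmult_0_l. }
  now rewrite Cmult_0_l, Cmult_1_l in E.
Qed.

Lemma ex_zero_order (R0 : R) (f : C -> C) : 0 < R0 -> holomorphic_on (disc 0 R0) f ->
  (exists z, Cmod z < R0 /\ f z <> 0) -> exists p g, holomorphic_on (disc 0 R0) g /\ g 0 <> 0 /\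
    forall z, Cmod z < R0 -> f z = (z ^ p * g z)%C.
Proof.
  intros HR Hf [z1 [Hz1 Hn1]]. destruct (holomorphic_pseries _ _ HR Hf) as [a Ha].
  assert (Hex : exists p, a p <> 0).
  { apply NNPP. intro Hno. apply Hn1. apply (is_C_pseries_functional a z1); [now apply Ha|].
    assert (H := is_C_pseries_scal 0 a z1 _ (Ha z1 Hz1)). rewrite Cmult_0_l in H.
    apply (is_C_pseries_ext (fun k => 0 * a k)%C); [|exact H]. intro k. rewrite Cmult_0_l.
    apply NNPP. intro Hk. apply Hno. exists k. congruence. }
  destruct Hex as [p Hp]. clear z1 Hz1 Hn1 Hf. revert a f Ha Hp.
  induction p as [|p IHp]; intros a f Ha Hp.
  - exists 0%nat, f. split; [now apply (pseries_on_holomorphic R0 a)|].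
    split; [now rewrite (pseries_on_at_0 R0 a f HR Ha)|]. intros z _. simpl. ring.
  - destruct (Ceq_dec (a 0%nat) 0) as [Ea0|Ea0].
    + destruct (pseries_on_factor R0 a f HR Ha) as [f1 [Hf1 E1]].
      destruct (IHp _ f1 Hf1 Hp) as [q [g [Hg [Hg0 E]]]].
      exists (S q), g. split; [exact Hg|]. split; [exact Hg0|]. intros z Hz.
      rewrite E1, Ea0, E by exact Hz. simpl. ring.
    + exists 0%nat, f. split; [now apply (pseries_on_holomorphic R0 a)|].
      split; [now rewrite (pseries_on_at_0 R0 a f HR Ha)|]. intros z _. simpl. ring.
Qed.

Lemma ex_circle_Cmod_ge (R0 r : R) (f : C -> C) : 0 < r <= R0 -> holomorphic_on (disc 0 R0) f ->
  (exists z, Cmod z < R0 /\ f z <> 0) ->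
  exists s m, 0 < s < r /\ 0 < m /\ forall z, Cmod z = s -> m <= Cmod (f z).
Proof.
  intros Hr Hf Hn. destruct (ex_zero_order R0 f ltac:(lra) Hf Hn) as [p [g [Hg [Hg0 E]]]].
  apply Cmod_gt_0 in Hg0. assert (Hgc : continuous (fun z => Cmod (g z)) (RtoC 0)).
  { apply continuous_Cmod, (holomorphic_on_continuous _ _ _ Hg), disc_center. lra. }
  assert (Hloc := continuous_gt _ (RtoC 0) (Cmod (g 0) / 2) Hgc ltac:(lra)).
  apply locally_Cmod in Hloc. destruct Hloc as [d [Hd Hlow]].
  assert (Hs : 0 < Rmin d r / 2) by (generalize (Rmin_pos d r Hd (proj1 Hr)); lra).
  set (s := Rmin d r / 2) in *.
  assert (Hsd : s < d) by (unfold s in *; generalize (Rmin_l d r); lra).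
  assert (Hsr : s < r) by (unfold s in *; generalize (Rmin_r d r); lra).
  exists s, (s ^ p * (Cmod (g 0) / 2)). split; [lra|]. split.
  - apply Rmult_lt_0_compat; [now apply pow_lt|lra].
  - intros z Hz. rewrite E, Cmod_mult, Cmod_pow, Hz by lra.
    apply Rmult_le_compat_l; [apply pow_le; lra|]. left. apply Hlow. now rewrite Cminus_0_r, Hz.
Qed.

Definition symmetric_quotient (f : C -> C) (h : R) (z : C) : C :=
  ((f (z + RtoC h) - f (z - RtoC h)) / RtoC (2 * h))%C.

Lemma symmetric_quotient_holomorphic (f : C -> C) (r R0 h : R) : 0 < h -> r + h <= R0 ->
  holomorphic_on (disc 0 R0) f -> holomorphic_on (disc 0 r) (symmetric_quotient f h).
Proof.
  intros Hh Hr Hf. assert (Mh : Cmod (RtoC h) = h) by (apply Cmod_R_pos; lra).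
  apply holomorphic_on_mult; [|apply holomorphic_on_const].
  apply holomorphic_on_minus; (apply (holomorphic_on_comp _ (disc 0 R0) f); [exact Hf| |]).
  - apply holomorphic_on_plus; [apply holomorphic_on_id|apply holomorphic_on_const].
  - intros z Hz. rewrite disc_0 in *. generalize (Cmod_triangle z (RtoC h)). lra.
  - apply holomorphic_on_minus; [apply holomorphic_on_id|apply holomorphic_on_const].
  - intros z Hz. rewrite disc_0 in *. generalize (Cmod_minus_le z (RtoC h)). lra.
Qed.

Lemma symmetric_quotient_neq_0 (f : C -> C) (R0 h : R) (z : C) : 0 < h -> Cmod z + h < R0 ->
  injective_on (disc 0 R0) f -> symmetric_quotient f h z <> 0.
Proof.
  intros Hh Hz Hinj E. assert (Mh : Cmod (RtoC h) = h) by (apply Cmod_R_pos; lra).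
  assert (Hn : RtoC (2 * h) <> 0) by (apply RtoC_neq_0; lra).
  assert (Ez : (z + RtoC h)%C = (z - RtoC h)%C).
  { apply Hinj.
    - apply disc_0. generalize (Cmod_triangle z (RtoC h)). lra.
    - apply disc_0. generalize (Cmod_minus_le z (RtoC h)). lra.
    - apply Ceq_minus, (Cmult_eq_reg_l (/ RtoC (2 * h))).
      + intro Einv. apply C1_nz. rewrite <- (Cinv_r _ Hn), Einv. apply Cmult_0_r.
      + rewrite Cmult_0_r, Cmult_comm. exact E. }
  apply Hn. replace (RtoC (2 * h)) with (z + RtoC h - (z - RtoC h))%C by (rewrite RtoC_mult; ring).
  rewrite Ez. apply Cminus_diag.
Qed.

Lemma symmetric_quotient_close (s : R) (f : C -> C) (B : R) (z : C) (h : R) :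
  holomorphic_on (disc 0 (2 * s)) f -> (forall w, Cmod w < 2 * s -> Cmod (f w) <= B) ->
  Cmod z <= s -> 0 < h < s ->
  Cmod (symmetric_quotient f h z - C_derive f z) <= 4 * B / (s * s) * h.
Proof.
  intros Hf HB Hz Hh.
  assert (Hsub : forall w, disc z s w -> disc 0 (2 * s) w).
  { intros w Hw. apply disc_0. unfold disc in Hw. generalize (Cmod_le_plus_minus w z). lra. }
  assert (HT : forall k, Cmod k = h ->
    Cmod (f (z + k)%C - f z - C_derive f z * k) <= 4 * B / (s * s) * h ^ 2).
  { intros k Hk. assert (HT := holomorphic_taylor2 z s f B (z + k)%C).
    replace (z + k - z)%C with k in HT by ring. rewrite Hk in HT. apply HT.
    - now apply (holomorphic_on_subset (disc 0 (2 * s))).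
    - intros w Hw. now apply HB, disc_0, Hsub.
    - apply disc_shift, disc_0. lra. }
  assert (Mh : Cmod (RtoC h) = h) by (apply Cmod_R_pos; lra).
  assert (Hplus := HT _ Mh). assert (Hminus := HT (- RtoC h)%C). rewrite Cmod_opp in Hminus.
  specialize (Hminus Mh).
  assert (Hn : RtoC h <> 0) by (apply RtoC_neq_0; lra).
  assert (Hn2 : RtoC (2 * h) <> 0) by (apply RtoC_neq_0; lra).
  set (x := (f (z + RtoC h) - f z - C_derive f z * RtoC h)%C) in *.
  set (y := (f (z + - RtoC h) - f z - C_derive f z * - RtoC h)%C) in *.
  replace (symmetric_quotient f h z - C_derive f z)%C with ((x - y) / RtoC (2 * h))%C.
  - rewrite Cmod_div, Cmod_R_pos by (auto; lra). apply Rle_div_l; [lra|].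
    eapply Rle_trans; [apply Cmod_minus_le|]. nra.
  - unfold symmetric_quotient, x, y. change (z - RtoC h)%C with (z + - RtoC h)%C. rewrite RtoC_mult.
    field. exact Hn.
Qed.

Lemma injective_ex_C_derive_neq_0 (R0 : R) (f : C -> C) : 0 < R0 ->
  holomorphic_on (disc 0 R0) f -> injective_on (disc 0 R0) f ->
  exists z, Cmod z < R0 /\ C_derive f z <> 0.
Proof.
  intros HR Hf Hinj. apply NNPP. intro Hno.
  assert (Mr : Cmod (RtoC (R0 / 2)) = R0 / 2) by (apply Cmod_R_pos; lra).
  apply (RtoC_neq_0 (R0 / 2)); [lra|].
  apply Hinj; [apply disc_0; lra|now apply disc_center|].
  apply (const_of_C_derive_0 R0); [|lra]. intros w Hw.
  replace (RtoC 0) with (C_derive f w).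
  - apply (holomorphic_on_derive (disc 0 R0)); [exact Hf|now apply disc_0].
  - apply NNPP. intro Hn. apply Hno. now exists w.
Qed.

(* If [f'(0) = 0], the minimum principle gives a zero of a symmetric difference quotient near the
   origin, against injectivity. *)
Lemma C_derive_neq_0_of_injective_at_0 (R0 : R) (f : C -> C) : 0 < R0 ->
  holomorphic_on (disc 0 R0) f -> injective_on (disc 0 R0) f -> C_derive f 0 <> 0.
Proof.
  intros HR Hf Hinj Edf0.
  destruct (ex_circle_Cmod_ge R0 (R0 / 3) (C_derive f)) as [s [m [Hs [Hm Hlow]]]]; [lra| | |].
  { now apply holomorphic_on_C_derive; [apply open_disc|]. }
  { now apply injective_ex_C_derive_neq_0. }
  destruct (bounded_on_closed_disc 0 (2 * s) f) as [B [HB Bf]].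
  { intros z Hz. apply (holomorphic_on_continuous _ _ _ Hf). unfold disc. lra. }
  assert (HK : 0 < 4 * B / (s * s)) by (apply Rdiv_lt_0_compat; nra).
  set (h := Rmin (s / 2) (m / 4 / (4 * B / (s * s)))).
  assert (Hh0 : 0 < h) by (apply Rmin_pos; [lra|]; apply Rdiv_lt_0_compat; lra).
  assert (Hhs : h <= s / 2) by apply Rmin_l.
  assert (Hhm : h * (4 * B / (s * s)) <= m / 4) by (apply Rle_div_r; [exact HK|apply Rmin_r]).
  assert (Hclose : forall z, Cmod z <= s ->
    Cmod (symmetric_quotient f h z - C_derive f z) <= m / 4).
  { intros z Hz. eapply Rle_trans; [apply (symmetric_quotient_close s f B); auto; [| |lra]|lra].
    - apply (holomorphic_on_subset (disc 0 R0)); [|exact Hf]. unfold disc. intros w Hw. lra.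
    - intros w Hw. apply Bf. rewrite Cminus_0_r. lra. }
  destruct (ex_zero_of_small_center (2 * s) (symmetric_quotient f h) s (3 / 4 * m)) as [z [Hz E]].
  - apply (symmetric_quotient_holomorphic f (2 * s) R0); auto. lra.
  - lra.
  - intros w Hw. specialize (Hlow w Hw). specialize (Hclose w ltac:(lra)).
    generalize (Cmod_le_plus_minus (C_derive f w) (symmetric_quotient f h w)).
    rewrite (Cmod_minus_sym (C_derive f w)). lra.
  - specialize (Hclose 0). rewrite Cmod_0, Edf0, Cminus_0_r in Hclose.
    specialize (Hclose ltac:(lra)). lra.
  - revert E. apply (symmetric_quotient_neq_0 f R0); auto. lra.
Qed.

Lemma C_derive_neq_0_of_injective (A : C -> Prop) (f : C -> C) (z : C) : open A ->
  holomorphic_on A f -> injective_on A f -> A z -> C_derive f z <> 0.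
Proof.
  intros HA Hf Hinj Hz. destruct (proj1 (open_Cmod A) HA z Hz) as [d [Hd HAd]].
  apply (holomorphic_on_subset A (disc z d) f HAd) in Hf.
  assert (Dz := holomorphic_on_derive _ _ _ Hf (disc_center z d Hd)).
  rewrite <- (Cplus_0_r z) in Dz at 1. apply is_C_derive_shift in Dz.
  rewrite <- (is_C_derive_unique _ _ _ Dz).
  apply (C_derive_neq_0_of_injective_at_0 d);
    [exact Hd|exact (proj1 (holomorphic_on_shift z d f) Hf)|].
  intros x y Hx Hy E. apply Hinj in E; [|now apply HAd, disc_shift..].
  apply (f_equal (fun w => w - z)%C) in E.
  now replace x with (z + x - z)%C by ring; replace y with (z + y - z)%C by ring.
Qed.

Lemma open_mapping (A : C -> Prop) (f : C -> C) (a : C) (s : R) : open A -> holomorphic_on A f ->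
  injective_on A f -> 0 < s -> (forall z, Cmod (z - a) <= s -> A z) ->
  locally (f a) (fun w => exists z, Cmod (z - a) < s /\ f z = w).
Proof.
  intros HA Hf Hinj Hs Hsub.
  assert (Hc : forall z w, A z -> continuous (fun z => f z - w)%C z).
  { intros z w Hz. apply continuous_Cminus; [|apply continuous_const].
    now apply (holomorphic_on_continuous A). }
  assert (Maa : Cmod (a - a) = 0) by now rewrite Cminus_diag, Cmod_0.
  destruct (Cmod_argmin_circle a s (fun z => f z - f a)%C) as [z1 [Hz1 Hmin]]; [lra| |].
  { intros z Hz. apply Hc, Hsub. lra. }
  assert (Hp : 0 < Cmod (f z1 - f a)).
  { apply Cmod_gt_0, Cminus_eq_contra. intro E.
    apply Hinj in E; [rewrite E in Hz1; lra|apply Hsub; lra..]. }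
  apply locally_Cmod. exists (Cmod (f z1 - f a) / 2). split; [lra|]. intros w Hw.
  destruct (Cmod_argmin_closed_disc a s (fun z => f z - w)%C) as [z [Hz Hzm]]; [lra|auto|].
  assert (Hlt : Cmod (z - a) < s).
  { destruct Hz as [|E]; [assumption|]. exfalso. specialize (Hmin z E).
    specialize (Hzm a ltac:(lra)).
    rewrite (Cmod_minus_sym (f a)) in Hzm. generalize (Cmod_minus_triangle (f z) w (f a)). lra. }
  exists z. split; [exact Hlt|]. apply NNPP. intro Hne.
  apply (C_derive_neq_0_of_injective A f z); auto.
  apply (local_min_Cmod_C_derive_0 f z _ w); [apply (holomorphic_on_derive A); auto| |exact Hne].
  apply (filter_imp (disc a s)); [intros x Hx; apply Hzm; now left|now apply open_disc].
Qed.

Definition univalent (q : C -> C) : Prop := holomorphic_on disk q /\ injective_on disk q.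

Lemma univalent_C_derive_neq_0 (q : C -> C) (z : C) : univalent q -> disk z -> C_derive q z <> 0.
Proof. intros [Hq Hinj]. now apply C_derive_neq_0_of_injective; [apply open_disk| |]. Qed.

Lemma disk_inv_spec (q : C -> C) (w : C) : image q disk w ->
  disk (disk_inv q w) /\ q (disk_inv q w) = w.
Proof. exact (epsilon_spec (inhabits (RtoC 0)) (fun z => disk z /\ q z = w)). Qed.

Lemma disk_inv_image (q : C -> C) (z : C) : injective_on disk q -> disk z -> disk_inv q (q z) = z.
Proof.
  intros Hinj Hz. destruct (disk_inv_spec q (q z)) as [Hd E]; [now exists z|]. now apply Hinj.
Qed.

Lemma univalent_locally (q : C -> C) (a : C) (A : C -> Prop) : univalent q -> disk a ->
  locally a A -> locally (q a) (fun w => image q disk w /\ A (disk_inv q w)).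
Proof.
  intros [Hq Hinj] Ha HA. apply locally_Cmod in HA. destruct HA as [d [Hd HAd]].
  set (s := Rmin (d / 2) ((1 - Cmod a) / 2)). unfold disk in Ha.
  assert (Hs : 0 < s) by (apply Rmin_pos; lra).
  assert (Hsd : s <= d / 2) by apply Rmin_l. assert (Hsa : s <= (1 - Cmod a) / 2) by apply Rmin_r.
  assert (Hsub : forall z, Cmod (z - a) <= s -> disk z).
  { intros z Hz. unfold disk. generalize (Cmod_le_plus_minus z a). lra. }
  generalize (open_mapping disk q a s open_disk Hq Hinj Hs Hsub). apply filter_imp.
  intros w [z [Hz <-]]. assert (Dz : disk z) by (apply Hsub; lra).
  split; [now exists z|]. rewrite disk_inv_image by assumption. apply HAd. lra.
Qed.

Lemma univalent_open_image (q : C -> C) : univalent q -> open (image q disk).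
Proof.
  intros Hq w [a [Ha <-]].
  generalize (univalent_locally q a (fun _ => True) Hq Ha (filter_forall _ (fun _ => I))).
  now apply filter_imp.
Qed.

Lemma disk_inv_continuous (q : C -> C) (a : C) : univalent q -> disk a ->
  continuous (disk_inv q) (q a).
Proof.
  intros Hq Ha A HA. rewrite disk_inv_image in HA by (try apply Hq; exact Ha).
  refine (filter_imp _ _ _ (univalent_locally q a A Hq Ha HA)). now intros w [_ Hw].
Qed.

Lemma disk_inv_is_C_derive (q : C -> C) (a : C) : univalent q -> disk a ->
  is_C_derive (disk_inv q) (q a) (/ C_derive q a)%C.
Proof.
  intros Hq Ha. set (l := C_derive q a).
  assert (Hl : l <> 0) by now apply univalent_C_derive_neq_0. assert (Ml := proj1 (Cmod_gt_0 l) Hl).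
  assert (Hqa : is_C_derive q a l) by (apply (holomorphic_on_derive disk); [apply Hq|exact Ha]).
  apply is_C_derive_Cmod. intros e He. rewrite disk_inv_image by (try apply Hq; exact Ha).
  set (d := Rmin (Cmod l / 2) (e * (Cmod l * Cmod l) / 2)).
  assert (Hd : 0 < d) by (apply Rmin_pos; [lra|]; repeat apply Rmult_lt_0_compat; lra).
  assert (Hd1 : d <= Cmod l / 2) by apply Rmin_l.
  assert (Hd2 : d <= e * (Cmod l * Cmod l) / 2) by apply Rmin_r.
  generalize (univalent_locally q a _ Hq Ha (proj1 (is_C_derive_Cmod q a l) Hqa d Hd)).
  apply filter_imp. intros w [Hw Hb]. rewrite (proj2 (disk_inv_spec q w Hw)) in Hb.
  set (x := (disk_inv q w - a)%C) in *. set (y := (w - q a)%C) in *.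
  assert (Hxy : Cmod x * Cmod l <= 2 * Cmod y).
  { generalize (Cmod_le_plus_minus (l * x) y). rewrite Cmod_minus_sym, Cmod_mult.
    generalize (Cmod_ge_0 x). nra. }
  replace (x - / l * y)%C with (- (y - l * x) / l)%C by (field; exact Hl).
  rewrite Cmod_div, Cmod_opp by exact Hl. apply Rle_div_l; [exact Ml|].
  eapply Rle_trans; [exact Hb|]. generalize (Cmod_ge_0 x) (Cmod_ge_0 y). intros Hx Hy.
  apply Rle_trans with (e * (Cmod l * Cmod l) / 2 * Cmod x); [now apply Rmult_le_compat_r|].
  apply Rle_trans with (e * Cmod l / 2 * (Cmod x * Cmod l)); [lra|].
  apply Rle_trans with (e * Cmod l / 2 * (2 * Cmod y)); [|lra].
  apply Rmult_le_compat_l; [|exact Hxy]. repeat apply Rmult_le_pos; lra.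
Qed.

Lemma disk_inv_holomorphic (q : C -> C) : univalent q ->
  holomorphic_on (image q disk) (disk_inv q).
Proof.
  intro Hq. exists (fun w => 1 / C_derive q (disk_inv q w))%C. intros w [a [Ha <-]].
  assert (Ea : disk_inv q (q a) = a) by (apply disk_inv_image; [apply Hq|exact Ha]).
  assert (Hn := univalent_C_derive_neq_0 q a Hq Ha). split.
  - rewrite Ea. apply (is_C_derive_eq _ _ (/ C_derive q a)%C); [now field|].
    now apply disk_inv_is_C_derive.
  - apply continuous_Cdiv; [apply continuous_const| |now rewrite Ea].
    apply (continuous_comp (disk_inv q) (C_derive q)); [now apply disk_inv_continuous|].
    rewrite Ea. apply (holomorphic_on_continuous_derive disk); [apply open_disk|apply Hq|exact Ha].
Qed.

(** * Convex maps *)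

Definition convex_map (q : C -> C) : Prop := univalent q /\ convex_set (image q disk).

Lemma subordination (q k : C -> C) : univalent q -> holomorphic_on disk k ->
  (forall z, disk z -> image q disk (k z)) -> k 0 = q 0 ->
  exists g, holomorphic_on disk g /\ (forall z, disk z -> Cmod (g z) <= 1) /\
    (forall z, disk z -> disk (z * g z)%C /\ q (z * g z)%C = k z) /\
    C_derive k 0 = (C_derive q 0 * g 0)%C.
Proof.
  intros Hq Hk Him Ek0. set (phi := fun z => disk_inv q (k z)).
  assert (Hphi : holomorphic_on disk phi).
  { now apply (holomorphic_on_comp disk (image q disk) (disk_inv q) k);
      [apply disk_inv_holomorphic| |]. }
  assert (Ephi0 : phi 0 = 0)
    by (unfold phi; rewrite Ek0; apply disk_inv_image; [apply Hq|apply disk_0]).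
  destruct (Schwarz_lemma phi 1 Hphi Ephi0) as [g [Hg [E Bg]]].
  { intros z Hz. left. now apply disk_inv_spec, Him. }
  exists g. split; [exact Hg|]. split; [exact Bg|].
  assert (Hspec : forall z, disk z -> disk (z * g z)%C /\ q (z * g z)%C = k z).
  { intros z Hz. rewrite <- E by exact Hz. now apply disk_inv_spec, Him. }
  split; [exact Hspec|]. apply is_C_derive_unique.
  apply (is_C_derive_ext_loc (fun z => q (phi z))).
  { apply (filter_imp disk); [|apply open_disk, disk_0].
    intros z Hz. unfold phi. now apply disk_inv_spec, Him. }
  apply (is_C_derive_comp q phi).
  - rewrite Ephi0. apply (holomorphic_on_derive disk); [apply Hq|apply disk_0].
  - apply (is_C_derive_factor_0 1 phi g); [lra|now apply holomorphic_on_disc_0_1|].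
    intros z Hz. rewrite Ephi0, E by exact Hz. ring.
Qed.

(* Study's theorem rests on subordinating [(1 - t) q (lam z) + t q z] to [q]. *)
Lemma convex_map_subordination (q : C -> C) (lam : C) (t : R) : convex_map q -> Cmod lam <= 1 ->
  0 <= t <= 1 -> exists g, holomorphic_on disk g /\ (forall z, disk z -> Cmod (g z) <= 1) /\
    g 0 = (RtoC (1 - t) * lam + RtoC t)%C /\ forall z, disk z ->
      q (z * g z)%C = (RtoC (1 - t) * q (lam * z)%C + RtoC t * q z)%C.
Proof.
  intros [Hq Hcv] Hlam Ht.
  set (k := fun z => (RtoC (1 - t) * q (lam * z)%C + RtoC t * q z)%C).
  destruct (subordination q k Hq) as [g [Hg [Bg [Eg Dg]]]].
  - apply holomorphic_on_plus; apply holomorphic_on_scal; [|apply Hq].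
    apply (holomorphic_on_comp disk disk q (fun z => lam * z)%C); [apply Hq| |].
    + apply holomorphic_on_scal, holomorphic_on_id.
    + intros z. now apply disk_Cmult.
  - intros z Hz. apply Hcv; [exists (lam * z)%C|exists z|exact Ht]; split; auto.
    now apply disk_Cmult.
  - unfold k. rewrite Cmult_0_r, <- Cmult_plus_distr_r, RtoC_convex_weights. apply Cmult_1_l.
  - exists g. split; [exact Hg|]. split; [exact Bg|]. split; [|intros z Hz; now apply Eg].
    assert (Hq0 := univalent_C_derive_neq_0 q 0 Hq disk_0).
    assert (Dq : is_C_derive q (RtoC 0) (C_derive q 0))
      by (apply (holomorphic_on_derive disk); [apply Hq|apply disk_0]).
    apply (Cmult_eq_reg_l (C_derive q 0)); [exact Hq0|]. rewrite <- Dg.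
    apply is_C_derive_unique.
    apply (is_C_derive_eq _ _
      (RtoC (1 - t) * (C_derive q 0 * (lam * 1)) + RtoC t * C_derive q 0)%C); [ring|].
    apply is_C_derive_plus; apply is_C_derive_scal; [|exact Dq].
    apply (is_C_derive_comp q (fun z => lam * z)%C); [now rewrite Cmult_0_r|].
    apply is_C_derive_scal, is_C_derive_id.
Qed.

Lemma Study_theorem (q : C -> C) (r : R) : convex_map q -> r < 1 ->
  convex_set (image q (fun z => Cmod z <= r)).
Proof.
  intros Hq Hr.
  assert (Hle : forall z w t, Cmod z <= Cmod w <= r -> 0 <= t <= 1 ->
    image q (fun z => Cmod z <= r) (RtoC (1 - t) * q z + RtoC t * q w)%C).
  { intros z w t Hzw Ht. destruct (Ceq_dec w 0) as [->|Hw].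
    - rewrite Cmod_0 in Hzw. assert (Ez : z = 0)
        by (apply Cmod_eq_0; generalize (Cmod_ge_0 z); lra).
      exists (RtoC 0). rewrite Ez, Cmod_0, <- Cmult_plus_distr_r, RtoC_convex_weights.
      split; [lra|]. symmetry. apply Cmult_1_l.
    - assert (Pw := proj1 (Cmod_gt_0 w) Hw).
      destruct (convex_map_subordination q (z / w) t Hq) as [g [_ [Bg [_ Eg]]]]; [|exact Ht|].
      { rewrite Cmod_div by exact Hw. apply Rle_div_l; lra. }
      assert (Dw : disk w) by (unfold disk; lra). exists (w * g w)%C. split.
      + rewrite Cmod_mult. specialize (Bg w Dw). nra.
      + rewrite Eg by exact Dw. now replace (z / w * w)%C with z by (field; exact Hw). }
  intros x y t [z [Hz <-]] [w [Hw <-]] Ht. destruct (Rle_lt_dec (Cmod z) (Cmod w)) as [H|H].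
  - now apply Hle.
  - rewrite Cplus_comm. replace t with (1 - (1 - t)) at 1 by ring. apply Hle; lra.
Qed.

Lemma Cmod_convex_combination_1_lt (x : C) (t : R) : Cmod x <= 1 -> x <> 1 -> 0 < t < 1 ->
  Cmod (RtoC (1 - t) * x + RtoC t) < 1.
Proof.
  intros Hx Hn Ht. apply Cmod_lt_of_sqr; [lra|]. autorewrite with re_im.
  assert (Hx2 : Re x ^ 2 + Im x ^ 2 <= 1).
  { rewrite <- Cmod2_alt. generalize (Cmod_ge_0 x). nra. }
  assert (Hre : Re x < 1).
  { apply Rnot_le_lt. intro Hre. apply Hn.
    apply injective_projections; simpl; unfold Re, Im in *; nra. }
  assert (Hgap : 0 < t * (1 - t) * (1 - Re x)) by (repeat apply Rmult_lt_0_compat; lra).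
  assert (Hsqr : 0 <= (1 - t) ^ 2 * (1 - (Re x ^ 2 + Im x ^ 2)))
    by (apply Rmult_le_pos; [apply pow2_ge_0|lra]).
  nra.
Qed.

Lemma Study_theorem_strict (q : C -> C) (z w : C) (t : R) : convex_map q -> disk w ->
  Cmod z <= Cmod w -> z <> w -> 0 < t < 1 ->
  exists v, Cmod v < Cmod w /\ q v = (RtoC (1 - t) * q z + RtoC t * q w)%C.
Proof.
  intros Hq Hw Hzw Hne Ht.
  assert (Hn : w <> 0).
  { intros ->. apply Hne, Cmod_eq_0. rewrite Cmod_0 in Hzw. generalize (Cmod_ge_0 z). lra. }
  assert (Pw := proj1 (Cmod_gt_0 w) Hn).
  assert (Ez : (z / w * w)%C = z) by (field; exact Hn).
  assert (Hlam : Cmod (z / w) <= 1) by (rewrite Cmod_div by exact Hn; apply Rle_div_l; lra).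
  destruct (convex_map_subordination q (z / w) t Hq Hlam ltac:(lra)) as [g [Hg [Bg [Eg0 Eg]]]].
  exists (w * g w)%C. rewrite (Eg w Hw), Ez. split; [|reflexivity].
  rewrite Cmod_mult. assert (Cmod (g w) < 1); [|nra].
  apply Cmod_lt_1_of_center; auto. rewrite Eg0.
  apply Cmod_convex_combination_1_lt; auto. intro E. apply Hne.
  rewrite <- Ez, E. apply Cmult_1_l.
Qed.

Lemma convex_map_scal (q : C -> C) (k : C) : convex_map q -> k <> 0 -> Cmod k <= 1 ->
  convex_map (fun z => q (k * z)%C).
Proof.
  intros Hq Hn Hk. assert (Pk := proj1 (Cmod_gt_0 k) Hn). split; [split|].
  - apply (holomorphic_on_comp disk disk q (fun z => k * z)%C); [apply Hq| |].
    + apply holomorphic_on_scal, holomorphic_on_id.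
    + intros z. now apply disk_Cmult.
  - intros z w Hz Hw E. apply (proj2 (proj1 Hq)) in E; [|now apply disk_Cmult..].
    now apply Cmult_eq_reg_l in E.
  - intros x y t [z [Hz Ez]] [w [Hw Ew]] Ht. unfold disk in *.
    set (r := Rmax (Cmod (k * z)) (Cmod (k * w))).
    assert (Hr : r < Cmod k) by (apply Rmax_lub_lt; rewrite Cmod_mult; nra).
    destruct (Study_theorem q r Hq ltac:(lra) x y t) as [v [Hv Ev]]; [..|exact Ht|].
    + exists (k * z)%C. split; [apply Rmax_l|exact Ez].
    + exists (k * w)%C. split; [apply Rmax_r|exact Ew].
    + exists (v / k)%C. split.
      * unfold disk. rewrite Cmod_div by exact Hn. apply Rlt_div_l; lra.
      * rewrite <- Ev. f_equal. field. exact Hn.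
Qed.

Lemma convex_map_sigma (q : C -> C) (a : C) : convex_map q -> Cmod a < 1 ->
  convex_map (fun z => q (sigma a z)).
Proof.
  intros [[Hq Hinj] Hcv] Ha.
  assert (Hd : forall z, disk z -> disk (sigma a z)) by (intros z Hz; now apply Cmod_sigma_lt_1).
  assert (Him : forall w, image (fun z => q (sigma a z)) disk w <-> image q disk w).
  { intro w. split; intros [z [Hz E]].
    - exists (sigma a z). auto.
    - exists (sigma (- a) z). split; [apply Cmod_sigma_lt_1; [now rewrite Cmod_opp|exact Hz]|].
      rewrite sigma_sigma_opp; [exact E|exact Ha|now left]. }
  split; [split|].
  - apply (holomorphic_on_comp disk disk q (sigma a)); auto.
    apply (holomorphic_on_sigma_comp disk a (fun z => z)); auto; [apply holomorphic_on_id|now left].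
  - intros z w Hz Hw E. apply Hinj in E; auto.
    rewrite <- (sigma_opp_sigma a z), <- (sigma_opp_sigma a w) by (auto; now left). now rewrite E.
  - intros x y t Hx Hy Ht. apply Him. apply Hcv; auto; now apply Him.
Qed.

Lemma convex_map_support_le (q : C -> C) (e w : C) : convex_map q -> disk e -> e <> 0 ->
  Cmod w <= Cmod e -> Re ((q w - q e) / (e * C_derive q e)) <= 0.
Proof.
  intros Hq He Hn Hw. apply Rnot_lt_le. intro Hpos. assert (Hinj := proj2 (proj1 Hq)).
  assert (Hd := univalent_C_derive_neq_0 q e (proj1 Hq) He). set (d := (q w - q e)%C) in *.
  assert (Hinc : at_right 0 (fun t =>
    Re (/ e * disk_inv q (q e)) < Re (/ e * disk_inv q (q e + RtoC t * d)%C))).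
  { apply (at_right_Re_gt (fun z => / e * disk_inv q z)%C (q e) (/ e * / C_derive q e)%C).
    - apply is_C_derive_scal, disk_inv_is_C_derive; [apply Hq|exact He].
    - now replace (/ e * / C_derive q e * d)%C with (d / (e * C_derive q e))%C by (field; auto). }
  destruct (filter_ex _ (filter_and _ _ Hinc (at_right_0_lt 1 Rlt_0_1))) as [t [Hlt Ht]].
  assert (Hseg : (q e + RtoC t * d)%C = (RtoC (1 - t) * q e + RtoC t * q w)%C)
    by (unfold d; rewrite RtoC_minus; ring).
  destruct (Study_theorem q (Cmod e) Hq He (q e) (q w) t) as [v [Hv Ev]];
    [exists e; split; [lra|auto]|now exists w|lra|].
  assert (Dv : disk v) by (unfold disk in *; lra).
  rewrite Hseg, <- Ev, !disk_inv_image, Cinv_l, re_RtoC in Hlt by auto.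
  assert (Pe := proj1 (Cmod_gt_0 e) Hn). generalize (Re_le_Cmod (/ e * v)).
  rewrite Cmult_comm. change (v * / e)%C with (v / e)%C. rewrite Cmod_div by exact Hn.
  rewrite Cmult_comm in Hlt. change (v * / e)%C with (v / e)%C in Hlt. intro Hre.
  assert (Cmod v / Cmod e <= 1) by (apply Rle_div_l; lra). lra.
Qed.

Lemma convex_map_support_lt (q : C -> C) (e w : C) : convex_map q -> disk e -> e <> 0 ->
  Cmod w <= Cmod e -> w <> e -> Re ((q w - q e) / (e * C_derive q e)) < 0.
Proof.
  intros Hq He Hn Hw Hne. apply Rnot_le_lt. intro Hge.
  assert (Hd := univalent_C_derive_neq_0 q e (proj1 Hq) He).
  set (k := (e * C_derive q e)%C) in *. assert (Hk : k <> 0) by now apply Cmult_neq_0.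
  destruct (Study_theorem_strict q w e (1 / 2) Hq He Hw Hne) as [v [Hv Ev]]; [lra|].
  assert (Dv : disk v) by (unfold disk in *; lra).
  assert (Hdv := univalent_C_derive_neq_0 q v (proj1 Hq) Dv).
  assert (Rv : 0 <= Re ((q v - q e) / k)).
  { replace ((q v - q e) / k)%C with (RtoC (1 / 2) * ((q w - q e) / k))%C.
    - rewrite re_scal_l. lra.
    - rewrite Ev, RtoC_minus, RtoC_half. field. exact Hk. }
  assert (Hinc : at_right 0 (fun t =>
    Re ((q v - q e) / k) < Re ((q (v + RtoC t * (k / C_derive q v))%C - q e) / k))).
  { apply (at_right_Re_gt (fun z => (q z - q e) / k)%C v
      ((C_derive q v - 0) * / k + (q v - q e) * 0)%C).
    - apply (is_C_derive_mult (fun z => q z - q e)%C (fun _ => / k)%C); [|apply is_C_derive_const].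
      apply is_C_derive_minus; [|apply is_C_derive_const].
      apply (holomorphic_on_derive disk); [apply Hq|exact Dv].
    - replace (_ * (k / C_derive q v))%C with (RtoC 1) by (field; auto). rewrite re_RtoC. lra. }
  assert (Hdisc : locally v (fun z => Cmod z < Cmod e)).
  { apply continuous_lt; [apply continuous_Cmod, continuous_id|exact Hv]. }
  destruct (filter_ex _ (filter_and _ _ Hinc (at_right_ray v (k / C_derive q v) _ Hdisc)))
    as [t [Hlarger Hinside]].
  generalize (convex_map_support_le q e _ Hq He Hn (Rlt_le _ _ Hinside)). fold k. lra.
Qed.

(* The even function [(q z + q (- z)) / 2] is subordinate to [q] and agrees with [q 0] to second
   order, so two applications of Schwarz's lemma write it as [q (z * (z * g z))]. *)
Lemma convex_map_even_part (q : C -> C) : convex_map q ->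
  exists g, holomorphic_on disk g /\ (forall z, disk z -> Cmod (g z) <= 1) /\
    forall z, disk z -> disk (z * (z * g z))%C /\
      q (z * (z * g z))%C = ((q z + q (- z)%C) / 2)%C.
Proof.
  intros [Hq Hcv]. set (k := fun z => ((q z + q (- z)%C) * / 2)%C).
  assert (Dq : is_C_derive q (RtoC 0) (C_derive q 0))
    by (apply (holomorphic_on_derive disk); [apply Hq|apply disk_0]).
  destruct (subordination q k Hq) as [h [Hh [Bh [Eh Dh]]]].
  - apply holomorphic_on_mult; [|apply holomorphic_on_const].
    apply holomorphic_on_plus; [apply Hq|].
    apply (holomorphic_on_comp disk disk q (fun z => - z)%C); [apply Hq| |exact disk_Copp].
    apply holomorphic_on_opp, holomorphic_on_id.
  - intros z Hz. replace (k z) with (RtoC (1 - 1 / 2) * q z + RtoC (1 / 2) * q (- z))%C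
      by (unfold k; rewrite RtoC_minus, RtoC_half; field).
    apply Hcv; [exists z|exists (- z)%C|lra]; split; auto. now apply disk_Copp.
  - unfold k. rewrite Copp_0. field.
  - assert (Dk0 : C_derive k 0 = 0).
    { apply is_C_derive_unique.
      apply (is_C_derive_eq _ _
        ((C_derive q 0 + C_derive q 0 * - (1)) * / 2 + (q 0 + q (- 0)%C) * 0)%C); [ring|].
      apply (is_C_derive_mult (fun z => q z + q (- z))%C (fun _ => / 2)%C);
        [|apply is_C_derive_const].
      apply is_C_derive_plus; [exact Dq|].
      apply (is_C_derive_comp q (fun z => - z)%C); [now rewrite Copp_0|].
      apply is_C_derive_opp, is_C_derive_id. }
    assert (Eh0 : h 0 = 0).
    { apply (Cmult_eq_reg_l (C_derive q 0)); [now apply univalent_C_derive_neq_0; [|apply disk_0]|].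
      rewrite <- Dh, Dk0. ring. }
    destruct (Schwarz_lemma h 1 Hh Eh0 Bh) as [g [Hg [Eg Bg]]].
    exists g. split; [exact Hg|]. split; [exact Bg|]. intros z Hz.
    rewrite <- Eg by exact Hz. exact (Eh z Hz).
Qed.

Lemma convex_map_C_derive2_le (q : C -> C) : convex_map q ->
  Cmod (C_derive (C_derive q) 0) <= 2 * Cmod (C_derive q 0).
Proof.
  intro Hq. destruct (convex_map_even_part q Hq) as [g [Hg [Bg Eg]]].
  destruct (holomorphic_factor2 q (proj1 (proj1 Hq))) as [f1 [f2 [Hf1 [Hf2 E]]]].
  destruct (C_derive2_at_0 1 q f2 (f1 0) Rlt_0_1) as [Edq Eddq].
  { now apply holomorphic_on_disc_0_1. }
  { intros z Hz. rewrite <- (proj2 (E z Hz)). now apply E. }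
  rewrite Edq, Eddq, Cmod_mult, (Cmod_R_pos 2) by lra. apply Rmult_le_compat_l; [lra|].
  assert (Hcont : forall f, holomorphic_on disk f -> continuous f (RtoC 0)).
  { intros f Hf. apply (holomorphic_on_continuous disk); [exact Hf|apply disk_0]. }
  assert (Eg0 : (g 0 * f1 (0 * (0 * g 0)))%C = ((f2 0 + f2 (- 0)) * / 2)%C).
  { apply (continuous_punctured_eq (fun z => g z * f1 (z * (z * g z)))%C
      (fun z => (f2 z + f2 (- z)) * / 2)%C).
    - apply continuous_Cmult; [now apply Hcont|].
      apply (continuous_comp (fun z => z * (z * g z))%C f1); [|rewrite Cmult_0_l; now apply Hcont].
      apply (continuous_Cmult (fun z => z)); [apply continuous_id|].
      apply (continuous_Cmult (fun z => z)); [apply continuous_id|now apply Hcont].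
    - apply continuous_Cmult; [|apply continuous_const]. apply continuous_Cplus; [now apply Hcont|].
      apply (continuous_comp (fun z => - z)%C f2); [|rewrite Copp_0; now apply Hcont].
      apply Hcont, holomorphic_on_opp, holomorphic_on_id.
    - intros z Hz Hn. destruct (Eg z Hz) as [Hd Ez]. apply (Cmult_eq_reg_l (z * z)%C).
      { now apply Cmult_neq_0. }
      rewrite (proj1 (E _ Hd)), (proj1 (E z Hz)), (proj2 (E z Hz)),
        (proj1 (E _ (disk_Copp z Hz))), (proj2 (E _ (disk_Copp z Hz))) in Ez.
      apply (f_equal (fun w => w - q 0)%C) in Ez.
      transitivity (q 0 + z * (z * g z) * f1 (z * (z * g z)) - q 0)%C; [ring|]. rewrite Ez. field. }
  rewrite Cmult_0_l, Copp_0 in Eg0. replace (f2 0) with (g 0 * f1 0)%C by (rewrite Eg0; field).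
  rewrite Cmod_mult. generalize (Bg 0 disk_0) (Cmod_ge_0 (f1 0)). nra.
Qed.

Lemma convex_map_pre_Schwarzian_le (q : C -> C) (u : C) : convex_map q -> disk u ->
  Cmod (RtoC (1 - Cmod u ^ 2) * (C_derive (C_derive q) u / C_derive q u) - 2 * Cconj u) <= 2.
Proof.
  intros Hq Hu. assert (Hn := univalent_C_derive_neq_0 q u (proj1 Hq) Hu).
  assert (Hbound := convex_map_C_derive2_le _ (convex_map_sigma q u Hq Hu)).
  assert (Hden : forall z, disk z -> (1 + Cconj u * z)%C <> 0).
  { intros z Hz. apply sigma_denom_neq_0; [exact Hu|now left]. }
  assert (Eqs : forall z, disk z ->
    C_derive (fun z => q (sigma u z)) z = (C_derive q (sigma u z) * dsigma u z)%C).
  { intros z Hz. apply is_C_derive_unique, (is_C_derive_comp q (sigma u)).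
    - apply (holomorphic_on_derive disk); [apply Hq|now apply Cmod_sigma_lt_1].
    - now apply is_C_derive_sigma, Hden. }
  set (rho := RtoC (1 - Cmod u ^ 2)) in *.
  assert (Eqs2 : C_derive (C_derive (fun z => q (sigma u z))) 0 =
    (C_derive (C_derive q) u * rho * rho + C_derive q u * (rho * - (2 * Cconj u)))%C).
  { apply is_C_derive_unique.
    apply (is_C_derive_ext_loc (fun z => C_derive q (sigma u z) * dsigma u z)%C).
    { apply (filter_imp disk); [|apply open_disk, disk_0]. intros z Hz. now rewrite Eqs. }
    apply (is_C_derive_eq _ _ (C_derive (C_derive q) u * dsigma u 0 * dsigma u 0 +
      C_derive q (sigma u 0) * (dsigma u 0 * dlog_dsigma u 0))%C).
    { rewrite sigma_at_0, dsigma_at_0. unfold dlog_dsigma. fold rho. field. }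
    apply (is_C_derive_mult (fun z => C_derive q (sigma u z)));
      [|apply is_C_derive_dsigma, Hden, disk_0].
    apply (is_C_derive_comp (C_derive q) (sigma u)); [|apply is_C_derive_sigma, Hden, disk_0].
    rewrite sigma_at_0. apply (holomorphic_on_derive disk); [|exact Hu].
    apply holomorphic_on_C_derive; [apply open_disk|apply Hq]. }
  assert (Hrho : rho <> 0) by (apply RtoC_neq_0; generalize (one_minus_Cmod_sqr_pos u Hu); lra).
  rewrite Eqs2, Eqs, sigma_at_0, dsigma_at_0 in Hbound by apply disk_0. fold rho in Hbound.
  assert (Hk : (C_derive q u * rho)%C <> 0) by now apply Cmult_neq_0.
  apply Rmult_le_reg_r with (Cmod (C_derive q u * rho)); [now apply Cmod_gt_0|].
  rewrite <- Cmod_mult.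
  now replace ((rho * (C_derive (C_derive q) u / C_derive q u) - 2 * Cconj u) *
      (C_derive q u * rho))%C
    with (C_derive (C_derive q) u * rho * rho + C_derive q u * (rho * - (2 * Cconj u)))%C
    by (field; exact Hn).
Qed.

(** * Chains of Moebius maps *)

(* [omega n] is the chain of length [n + 1]; the empty chain makes inductions start trivially. *)
Fixpoint schur_chain (k : nat) (gamma : nat -> C) (x z : C) : C :=
  match k with
  | O => x
  | S k => sigma (gamma 0%nat) (z * schur_chain k (fun i => gamma (S i)) x z)%C
  end.

Fixpoint chain_slope (k : nat) (gamma : nat -> C) (x z : C) : C :=
  match k with
  | O => RtoC 1
  | S k => (dsigma (gamma 0%nat) (z * schur_chain k (fun i => gamma (S i)) x z) *
            chain_slope k (fun i => gamma (S i)) x z)%C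
  end.

Definition disk_below (k : nat) (gamma : nat -> C) : Prop :=
  forall i, (i < k)%nat -> disk (gamma i).

Definition chain_domain (x z : C) : Prop := disk z /\ disk (z * x)%C.

Lemma omega_schur_chain (n : nat) (gamma : nat -> C) (x z : C) :
  omega n gamma x z = schur_chain (S n) gamma x z.
Proof.
  revert gamma. induction n as [|n IHn]; intro gamma; simpl.
  - now rewrite Cmult_comm.
  - now rewrite IHn.
Qed.

Lemma disk_below_0 (k : nat) (gamma : nat -> C) : disk_below (S k) gamma -> disk (gamma 0%nat).
Proof. intro H. apply H. lia. Qed.

Lemma disk_below_S (k : nat) (gamma : nat -> C) :
  disk_below (S k) gamma -> disk_below k (fun i => gamma (S i)).
Proof. intros H i Hi. apply H. lia. Qed.

Lemma chain_domain_of_disk (x z : C) : Cmod x <= 1 -> disk z -> chain_domain x z.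
Proof. intros Hx Hz. split; [exact Hz|]. now apply Cmod_mult_lt_1. Qed.

Lemma disk_Cmult_schur_chain (k : nat) (gamma : nat -> C) (x z : C) : disk_below k gamma ->
  chain_domain x z -> disk (z * schur_chain k gamma x z)%C.
Proof.
  revert gamma. induction k as [|k IHk]; intros gamma Hg Hz; [apply Hz|].
  apply Cmod_mult_lt_1; [apply Hz|]. left.
  apply Cmod_sigma_lt_1; [now apply (disk_below_0 k)|]. now apply IHk, Hz; apply disk_below_S.
Qed.

Lemma disk_schur_chain_S (k : nat) (gamma : nat -> C) (x z : C) : disk_below (S k) gamma ->
  chain_domain x z -> disk (schur_chain (S k) gamma x z).
Proof.
  intros Hg Hz. apply Cmod_sigma_lt_1; [now apply (disk_below_0 k)|].
  apply disk_Cmult_schur_chain; [now apply disk_below_S|exact Hz].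
Qed.

Lemma Cmod_Cmult_schur_chain_le (k : nat) (gamma : nat -> C) (x z : C) : disk_below k gamma ->
  chain_domain x z -> Cmod (z * schur_chain k gamma x z) <= Rmax 1 (Cmod x) * Cmod z.
Proof.
  intros Hg Hz. rewrite Cmod_mult, Rmult_comm. apply Rmult_le_compat_r; [apply Cmod_ge_0|].
  destruct k as [|k]; [apply Rmax_r|]. apply Rle_trans with 1; [|apply Rmax_l].
  left. now apply disk_schur_chain_S.
Qed.

Lemma schur_chain_at_0 (k : nat) (gamma : nat -> C) (x : C) :
  schur_chain (S k) gamma x 0 = gamma 0%nat.
Proof. simpl. rewrite Cmult_0_l. apply sigma_at_0. Qed.

Lemma Cmod_schur_chain_le_1 (k : nat) (gamma : nat -> C) (x z : C) : disk_below k gamma ->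
  Cmod x <= 1 -> disk z -> Cmod (schur_chain k gamma x z) <= 1.
Proof.
  intros Hg Hx Hz. destruct k as [|k]; [exact Hx|]. left.
  now apply disk_schur_chain_S, chain_domain_of_disk.
Qed.

Lemma is_C_derive_schur_chain (k : nat) (gamma : nat -> C) (x z : C) : disk_below k gamma ->
  chain_domain x z ->
  is_C_derive (fun y => schur_chain k gamma y z) x (z ^ k * chain_slope k gamma x z)%C.
Proof.
  revert gamma. induction k as [|k IHk]; intros gamma Hg Hz.
  - apply (is_C_derive_eq _ _ (RtoC 1)); [simpl; ring|]. apply is_C_derive_id.
  - assert (Hg' := disk_below_S k gamma Hg).
    set (u := (z * schur_chain k (fun i => gamma (S i)) x z)%C).
    apply (is_C_derive_eq _ _ (dsigma (gamma 0%nat) u *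
      (z * (z ^ k * chain_slope k (fun i => gamma (S i)) x z)))%C).
    { rewrite Cpow_S. simpl chain_slope. fold u. ring. }
    apply (is_C_derive_comp (sigma (gamma 0%nat))).
    + apply is_C_derive_sigma, sigma_denom_neq_0; [now apply (disk_below_0 k)|].
      left. now apply disk_Cmult_schur_chain.
    + apply is_C_derive_scal. now apply IHk.
Qed.

Lemma holomorphic_on_schur_chain (A : C -> Prop) (k : nat) (gamma : nat -> C) (w : C -> C) :
  holomorphic_on A w -> disk_below k gamma -> (forall z, A z -> chain_domain (w z) z) ->
  holomorphic_on A (fun z => schur_chain k gamma (w z) z).
Proof.
  intros Hw Hg HA. revert gamma Hg. induction k as [|k IHk]; intros gamma Hg; [exact Hw|].
  apply (holomorphic_on_sigma_comp A (gamma 0%nat)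
    (fun z => z * schur_chain k (fun i => gamma (S i)) (w z) z)%C).
  - apply holomorphic_on_mult; [apply holomorphic_on_id|]. now apply IHk, disk_below_S.
  - now apply (disk_below_0 k).
  - intros z Hz. left. apply disk_Cmult_schur_chain; [now apply disk_below_S|now apply HA].
Qed.

Lemma holomorphic_on_chain_slope (k : nat) (gamma : nat -> C) (x : C) : disk_below k gamma ->
  holomorphic_on (chain_domain x) (chain_slope k gamma x).
Proof.
  revert gamma. induction k as [|k IHk]; intros gamma Hg; [apply holomorphic_on_const|].
  assert (Hg' := disk_below_S k gamma Hg). apply holomorphic_on_mult; [|now apply IHk].
  apply (holomorphic_on_dsigma_comp _ (gamma 0%nat)
    (fun z => z * schur_chain k (fun i => gamma (S i)) x z)%C).
  - apply holomorphic_on_mult; [apply holomorphic_on_id|].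
    apply (holomorphic_on_schur_chain _ k _ (fun _ => x)); auto. apply holomorphic_on_const.
  - now apply (disk_below_0 k).
  - intros z Hz. left. now apply disk_Cmult_schur_chain.
Qed.

Lemma chain_slope_neq_0 (k : nat) (gamma : nat -> C) (x z : C) : disk_below k gamma ->
  chain_domain x z -> chain_slope k gamma x z <> 0.
Proof.
  revert gamma. induction k as [|k IHk]; intros gamma Hg Hz; [exact C1_nz|].
  assert (Hg' := disk_below_S k gamma Hg). apply Cmult_neq_0; [|now apply IHk].
  apply dsigma_neq_0; [now apply (disk_below_0 k)|]. left. now apply disk_Cmult_schur_chain.
Qed.

Lemma continuous_chain_slope (k : nat) (gamma : nat -> C) (x z : C) : disk_below k gamma ->
  chain_domain x z -> continuous (fun y => chain_slope k gamma y z) x.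
Proof.
  revert gamma. induction k as [|k IHk]; intros gamma Hg Hz; [apply continuous_const|].
  assert (Hg' := disk_below_S k gamma Hg). apply continuous_Cmult; [|now apply IHk].
  apply (continuous_comp (fun y => z * schur_chain k (fun i => gamma (S i)) y z)%C
    (dsigma (gamma 0%nat))).
  - apply continuous_Cmult; [apply continuous_const|].
    eapply is_C_derive_continuous. now apply is_C_derive_schur_chain.
  - eapply is_C_derive_continuous. apply is_C_derive_dsigma, sigma_denom_neq_0.
    + now apply (disk_below_0 k).
    + left. now apply disk_Cmult_schur_chain.
Qed.

Lemma schur_chain_minus (A : C -> Prop) (k : nat) (gamma : nat -> C) (v w : C -> C) :
  disk_below k gamma -> holomorphic_on A v -> holomorphic_on A w ->
  (forall z, A z -> disk z /\ Cmod (v z) <= 1 /\ Cmod (w z) <= 1) ->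
  exists h, holomorphic_on A h /\ forall z, A z ->
    (schur_chain k gamma (v z) z - schur_chain k gamma (w z) z)%C = (z ^ k * h z)%C.
Proof.
  intros Hg Hv Hw HA. revert gamma Hg. induction k as [|k IHk]; intros gamma Hg.
  - exists (fun z => v z - w z)%C. split; [now apply holomorphic_on_minus|].
    intros z _. simpl. ring.
  - assert (Hg' := disk_below_S k gamma Hg). assert (Ha := disk_below_0 k gamma Hg).
    destruct (IHk _ Hg') as [h [Hh E]]. set (a := gamma 0%nat) in *.
    set (u := fun w z => (z * schur_chain k (fun i => gamma (S i)) (w z) z)%C).
    assert (Hu : forall y, holomorphic_on A y -> (forall z, A z -> chain_domain (y z) z) ->
      holomorphic_on A (fun z => 1 + Cconj a * u y z)%C /\
      forall z, A z -> Cmod (u y z) <= 1 /\ (1 + Cconj a * u y z)%C <> 0).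
    { intros y Hy HAy. split.
      - apply holomorphic_on_plus; [apply holomorphic_on_const|]. apply holomorphic_on_scal.
        apply holomorphic_on_mult; [apply holomorphic_on_id|]. now apply holomorphic_on_schur_chain.
      - intros z Hz. assert (Cmod (u y z) <= 1)
          by (left; apply disk_Cmult_schur_chain; [exact Hg'|now apply HAy]).
        split; [assumption|now apply sigma_denom_neq_0]. }
    destruct (Hu v Hv) as [Hdv Hv1].
    { intros z Hz. now apply chain_domain_of_disk; apply HA. }
    destruct (Hu w Hw) as [Hdw Hw1].
    { intros z Hz. now apply chain_domain_of_disk; apply HA. }
    exists (fun z => (1 - a * Cconj a) * h z / ((1 + Cconj a * u v z) * (1 + Cconj a * u w z)))%C.
    split.
    + apply holomorphic_on_div; [now apply holomorphic_on_scal|now apply holomorphic_on_mult|].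
      intros z Hz. apply Cmult_neq_0; [now apply Hv1|now apply Hw1].
    + intros z Hz. destruct (Hv1 z Hz) as [Bv Nv]. destruct (Hw1 z Hz) as [Bw Nw].
      change (schur_chain (S k) gamma (v z) z) with (sigma a (u v z)).
      change (schur_chain (S k) gamma (w z) z) with (sigma a (u w z)).
      rewrite sigma_minus by assumption.
      assert (Eu : (u v z - u w z)%C = (z * (z ^ k * h z))%C)
        by (rewrite <- E by exact Hz; unfold u; ring).
      rewrite Eu, Cpow_S. field. auto.
Qed.

(* Precomposition with [sigma a] and with [v |-> z v] preserves convexity, so the whole chain
   collapses into one convex map. *)
Lemma convex_map_schur_chain (k : nat) (P : C -> C) (gamma : nat -> C) (z : C) : convex_map P ->
  disk_below (S k) gamma -> z <> 0 -> disk z ->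
  exists q, convex_map q /\ forall x, P (schur_chain (S k) gamma x z) = q (z * x)%C.
Proof.
  revert P gamma. induction k as [|k IHk]; intros P gamma HP Hg Hn Hz;
    assert (HPs := convex_map_sigma P (gamma 0%nat) HP (disk_below_0 _ _ Hg)).
  - now exists (fun v => P (sigma (gamma 0%nat) v)).
  - destruct (IHk (fun v => P (sigma (gamma 0%nat) (z * v)%C)) (fun i => gamma (S i)))
      as [q [Hq E]]; auto.
    + apply (convex_map_scal (fun v => P (sigma (gamma 0%nat) v))); auto. now left.
    + now apply disk_below_S.
    + exists q. split; [exact Hq|]. intro x. now rewrite <- E.
Qed.

(** * The convexity margin *)

Definition log_derive (f : C -> C) (z : C) : C := (z * C_derive f z / f z)%C.

Lemma log_derive_mult (f g : C -> C) (z l m : C) : is_C_derive f z l -> is_C_derive g z m ->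
  f z <> 0 -> g z <> 0 ->
  log_derive (fun w => f w * g w)%C z = (log_derive f z + log_derive g z)%C.
Proof.
  intros Hf Hg Nf Ng. unfold log_derive.
  assert (E : C_derive (fun w => f w * g w)%C z = (l * g z + f z * m)%C)
    by now apply is_C_derive_unique, is_C_derive_mult.
  rewrite E, (is_C_derive_unique _ _ _ Hf), (is_C_derive_unique _ _ _ Hg). field. auto.
Qed.

(* With [Y = z w'(z)] and [X = Re (z d/dz log (dw/deps))], this says that
   [Re (z d/dz log (q'(w) dw/deps)) > 0] for every convex map [q]. *)
Definition convexity_margin (w : C) (X : R) (Y : C) : Prop :=
  2 * (Cmod Y - Re (Cconj w * Y)) < X * (1 - Cmod w ^ 2).

Lemma convexity_margin_id (u : C) : disk u -> convexity_margin u 1 u.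
Proof.
  unfold disk, convexity_margin. intro Hu. rewrite Cmult_comm, Cmult_Cconj, re_RtoC. nra.
Qed.

Lemma convexity_margin_sigma (a u : C) (X : R) (Y : C) : Cmod a < 1 -> disk u ->
  convexity_margin u X Y ->
  convexity_margin (sigma a u) (X + Re (dlog_dsigma a u * Y)) (dsigma a u * Y)%C.
Proof.
  intros Ha Hu H. unfold convexity_margin in *. assert (Hu1 : Cmod u <= 1) by now left.
  assert (Hd := sigma_denom_neq_0 a u Ha Hu1).
  assert (Pk := proj1 (Cmod_gt_0 _) (dsigma_neq_0 a u Ha Hu1)).
  set (y := Re (Cconj a / (1 + Cconj a * u) * Y)). set (k := Cmod (dsigma a u)).
  assert (Edeficit : 1 - Cmod (sigma a u) ^ 2 = k * (1 - Cmod u ^ 2)).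
  { rewrite one_minus_Cmod_sigma_sqr by assumption. unfold k. rewrite Cmod_dsigma by assumption.
    field. apply Cmod_gt_0 in Hd. lra. }
  assert (Econj : Re (Cconj (sigma a u) * (dsigma a u * Y)) =
    k * (Re (Cconj u * Y) + (1 - Cmod u ^ 2) * y)).
  { rewrite Cmult_assoc, Cconj_sigma_mult_dsigma by assumption. fold k. unfold y.
    rewrite <- !re_scal_l, <- re_plus, <- re_scal_l. f_equal. ring. }
  assert (Edlog : Re (dlog_dsigma a u * Y) = - (2 * y)).
  { unfold y. rewrite <- re_scal_l, <- re_opp. f_equal. unfold dlog_dsigma. field. exact Hd. }
  rewrite Edeficit, Econj, Edlog, Cmod_mult. fold k. clearbody y.
  apply (Rmult_lt_compat_l k) in H; [|exact Pk]. lra.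
Qed.

Lemma convexity_margin_mult (z v : C) (X : R) (Y : C) : disk z -> disk v ->
  convexity_margin v X Y -> convexity_margin (z * v)%C (1 + X) (z * (v + Y))%C.
Proof.
  unfold disk, convexity_margin. intros Hz Hv H.
  assert (E : Re (Cconj (z * v) * (z * (v + Y))) = Cmod z ^ 2 * (Cmod v ^ 2 + Re (Cconj v * Y))).
  { rewrite !Cmod2_alt. autorewrite with re_im. ring. }
  assert (Hsum : Cmod (v + Y) <= Cmod v + Cmod Y) by apply Cmod_triangle.
  assert (Hy : Re (Cconj v * Y) <= Cmod v * Cmod Y).
  { eapply Rle_trans; [apply Re_le_Cmod|]. rewrite Cmod_mult, Cmod_conj. lra. }
  rewrite E, !Cmod_mult. generalize (Cmod_ge_0 z) (Cmod_ge_0 v) (Cmod_ge_0 Y). intros Hr0 Hb0 Hx0.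
  set (r := Cmod z) in *. set (b := Cmod v) in *. set (x := Cmod Y) in *.
  set (y := Re (Cconj v * Y)) in *. set (s := Cmod (v + Y)) in *. clearbody r b x y s.
  assert (Hrb : 0 <= r * b < 1) by nra.
  assert (Hdiff : (r * x - r ^ 2 * y) * (1 - b ^ 2) <= (x - y) * (1 - (r * b) ^ 2)).
  { assert (Hyx : y * (1 + r) <= b * x * (1 + r)) by (apply Rmult_le_compat_r; lra).
    assert (Hxrb : 0 <= x * ((1 - b) * (1 - r * b))) by (repeat apply Rmult_le_pos; lra).
    assert (Hcomb : 0 <= (1 - r) * (x * (1 + r * b ^ 2) - y * (1 + r)))
      by (apply Rmult_le_pos; nra).
    lra. }
  assert (HX : 2 * (r * x - r ^ 2 * y) <= X * (1 - (r * b) ^ 2)).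
  { apply Rmult_le_reg_r with (1 - b ^ 2); [nra|].
    apply Rle_trans with (2 * (x - y) * (1 - (r * b) ^ 2)); [lra|].
    replace (X * (1 - (r * b) ^ 2) * (1 - b ^ 2)) with (X * (1 - b ^ 2) * (1 - (r * b) ^ 2))
      by ring.
    apply Rmult_le_compat_r; [nra|lra]. }
  nra.
Qed.

Lemma convexity_margin_sigma_comp (a : C) (u E : C -> C) (X : R) (z du dE : C) : Cmod a < 1 ->
  is_C_derive u z du -> is_C_derive E z dE -> disk (u z) -> E z <> 0 ->
  convexity_margin (u z) (X + Re (log_derive E z)) (z * C_derive u z)%C ->
  convexity_margin (sigma a (u z)) (X + Re (log_derive (fun w => dsigma a (u w) * E w)%C z))
    (z * C_derive (fun w => sigma a (u w)) z)%C.
Proof.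
  intros Ha Du DE Hu NE H. assert (Hu1 : Cmod (u z) <= 1) by now left.
  assert (Hd := sigma_denom_neq_0 a (u z) Ha Hu1). assert (Ns := dsigma_neq_0 a (u z) Ha Hu1).
  assert (Ds : is_C_derive (fun w => dsigma a (u w)) z
      (dsigma a (u z) * dlog_dsigma a (u z) * du)%C)
    by now apply (is_C_derive_comp (dsigma a) u); [apply is_C_derive_dsigma|].
  assert (Es : log_derive (fun w => dsigma a (u w)) z = (dlog_dsigma a (u z) * (z * du))%C).
  { unfold log_derive. rewrite (is_C_derive_unique (fun w => dsigma a (u w)) z _ Ds).
    field. exact Ns. }
  assert (Dsu : C_derive (fun w => sigma a (u w)) z = (dsigma a (u z) * du)%C)
    by now apply is_C_derive_unique, (is_C_derive_comp (sigma a) u); [apply is_C_derive_sigma|].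
  rewrite (is_C_derive_unique _ _ _ Du) in H.
  rewrite (log_derive_mult (fun w => dsigma a (u w)) E z _ _ Ds DE Ns NE), Es, Dsu.
  replace (z * (dsigma a (u z) * du))%C with (dsigma a (u z) * (z * du))%C by ring.
  replace (X + Re (dlog_dsigma a (u z) * (z * du) + log_derive E z)) with
    (X + Re (log_derive E z) + Re (dlog_dsigma a (u z) * (z * du))) by (rewrite re_plus; ring).
  now apply convexity_margin_sigma.
Qed.

Lemma schur_chain_convexity_margin (k : nat) (gamma : nat -> C) (x z : C) :
  disk_below (S k) gamma -> chain_domain x z ->
  convexity_margin (schur_chain (S k) gamma x z)
    (INR (S k) + Re (log_derive (chain_slope (S k) gamma x) z))
    (z * C_derive (schur_chain (S k) gamma x) z)%C.
Proof.
  revert gamma. induction k as [|k IHk]; intros gamma Hg Hz;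
    assert (Hg' := disk_below_S _ _ Hg); set (g := fun i => gamma (S i)) in *.
  - assert (Du : is_C_derive (fun w : C => w * x)%C z (1 * x + z * 0)%C)
      by (apply (is_C_derive_mult (fun w => w) (fun _ => x));
          [apply is_C_derive_id|apply is_C_derive_const]).
    apply (convexity_margin_sigma_comp (gamma 0%nat) (fun w => w * x)%C (chain_slope 0 g x) _ z _ _
      (disk_below_0 _ _ Hg) Du (is_C_derive_const _ z)); [apply Hz|apply C1_nz|].
    assert (E : log_derive (chain_slope 0 g x) z = 0).
    { unfold log_derive.
      rewrite (is_C_derive_unique (chain_slope 0 g x) z _ (is_C_derive_const _ z)).
      simpl. field. }
    rewrite E, (is_C_derive_unique _ _ _ Du), re_RtoC, Rplus_0_r.
    replace (z * (1 * x + z * 0))%C with (z * x)%C by ring. apply convexity_margin_id, Hz.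
  - specialize (IHk _ Hg' Hz). fold g in IHk.
    assert (Hc : holomorphic_on (chain_domain x) (schur_chain (S k) g x))
      by (apply (holomorphic_on_schur_chain _ _ _ (fun _ => x)); auto; apply holomorphic_on_const).
    assert (Dc := holomorphic_on_derive _ _ _ Hc Hz).
    assert (Ds := holomorphic_on_derive _ _ _ (holomorphic_on_chain_slope (S k) g x Hg') Hz).
    assert (Du : is_C_derive (fun w : C => w * schur_chain (S k) g x w)%C z
      (1 * schur_chain (S k) g x z + z * C_derive (schur_chain (S k) g x) z)%C)
      by (apply (is_C_derive_mult (fun w => w)); [apply is_C_derive_id|exact Dc]).
    apply (convexity_margin_sigma_comp (gamma 0%nat) (fun w => w * schur_chain (S k) g x w)%C
      (chain_slope (S k) g x) _ z _ _ (disk_below_0 _ _ Hg) Du Ds).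
    + now apply disk_Cmult_schur_chain.
    + now apply chain_slope_neq_0.
    + apply is_C_derive_unique in Du.
      rewrite Du, S_INR, (Rplus_comm _ 1), Rplus_assoc, Cmult_1_l.
      apply convexity_margin_mult; [apply Hz|now apply disk_schur_chain_S|exact IHk].
Qed.

Lemma convexity_margin_convex_map (q : C -> C) (w : C) (X : R) (Y : C) : convex_map q -> disk w ->
  convexity_margin w X Y -> 0 < X + Re (C_derive (C_derive q) w / C_derive q w * Y).
Proof.
  unfold convexity_margin. intros Hq Hw Hmargin.
  assert (Hbound := convex_map_pre_Schwarzian_le q w Hq Hw).
  assert (Pr := one_minus_Cmod_sqr_pos w Hw). set (rho := 1 - Cmod w ^ 2) in *.
  set (T := (C_derive (C_derive q) w / C_derive q w)%C) in *.
  set (tau := (RtoC rho * T - 2 * Cconj w)%C) in *.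
  assert (E : rho * Re (T * Y) = 2 * Re (Cconj w * Y) + Re (tau * Y)).
  { rewrite <- !re_scal_l, <- re_plus. f_equal. unfold tau. ring. }
  assert (B : - Re (tau * Y) <= 2 * Cmod Y).
  { rewrite <- re_opp. eapply Rle_trans; [apply Re_le_Cmod|]. rewrite Cmod_opp, Cmod_mult.
    apply Rmult_le_compat_r; [apply Cmod_ge_0|exact Hbound]. }
  apply Rmult_lt_reg_l with rho; [exact Pr|]. rewrite Rmult_0_r, Rmult_plus_distr_l, E. lra.
Qed.

(** * Integrals depending on a complex parameter *)

Section ParameterIntegral.

Variables (F : R -> C -> C) (a b : R) (c : C) (r B : R).
Hypotheses (Hab : a < b)
  (HF : forall t, a < t < b -> holomorphic_on (disc c r) (F t))
  (HB : forall t z, a < t < b -> disc c r z -> Cmod (F t z) <= B)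
  (HI : forall z, disc c r z -> exists l : C, is_C_RInt (fun t => F t z) a b l)
  (HdI : forall z, disc c r z -> exists l : C, is_C_RInt (fun t => C_derive (F t) z) a b l).

Lemma RInt_param_taylor2 (z w : C) (s : R) : (forall x, disc z s x -> disc c r x) ->
  disc z s w ->
  Cmod (C_RInt (fun t => F t w) a b - C_RInt (fun t => F t z) a b -
    C_RInt (fun t => C_derive (F t) z) a b * (w - z)) <=
  (b - a) * (4 * B / (s * s)) * Cmod (w - z) ^ 2.
Proof.
  intros Hsub Hw.
  assert (Hz : disc c r z).
  { apply Hsub, disc_center. unfold disc in Hw. generalize (Cmod_ge_0 (w - z)). lra. }
  rewrite Rmult_assoc. apply Cmod_is_C_RInt_le with
    (f := fun t => (F t w - F t z - (w - z) * C_derive (F t) z)%C); [exact Hab| |].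
  - intros t Ht. rewrite (Cmult_comm (w - z)). apply (holomorphic_taylor2 z s); auto.
    now apply (holomorphic_on_subset (disc c r)), HF.
  - rewrite (Cmult_comm _ (w - z)). apply is_C_RInt_minus;
      [apply is_C_RInt_minus|apply is_C_RInt_scal];
      apply is_C_RInt_C_RInt; auto.
Qed.

Lemma is_C_derive_RInt_param (z : C) : disc c r z ->
  is_C_derive (fun w => C_RInt (fun t => F t w) a b) z (C_RInt (fun t => C_derive (F t) z) a b).
Proof.
  intro Hz. destruct (proj1 (open_Cmod _) (open_disc c r) z Hz) as [s [Hs Hsub]].
  apply (is_C_derive_of_sqr _ _ _ ((b - a) * (4 * B / (s * s)))).
  apply (filter_imp (disc z s)); [|now apply open_disc, disc_center].
  intros w Hw. apply RInt_param_taylor2; [exact Hsub|exact Hw].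
Qed.

(* Adding the second-order estimates at [z] and at [w] shows that the derivative is Lipschitz. *)
Lemma continuous_RInt_param_derive (z : C) : disc c r z ->
  continuous (fun w => C_RInt (fun t => C_derive (F t) w) a b) z.
Proof.
  intro Hz. destruct (proj1 (open_Cmod _) (open_disc c r) z Hz) as [s [Hs Hsub]].
  apply (continuous_of_lipschitz _ _ (2 * ((b - a) * (4 * B / (s / 2 * (s / 2)))))).
  apply (filter_imp (disc z (s / 2))); [|apply open_disc, disc_center; lra]. intros w Hw.
  assert (Hzw := RInt_param_taylor2 z w (s / 2)). assert (Hwz := RInt_param_taylor2 w z (s / 2)).
  destruct (Ceq_dec w z) as [->|Hne]; [rewrite !Cminus_diag, Cmod_0; lra|].
  assert (Hp := proj1 (Cmod_gt_0 _) (Cminus_eq_contra _ _ Hne)).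
  apply Rmult_le_reg_r with (Cmod (w - z)); [exact Hp|]. rewrite <- Cmod_mult.
  set (Iw := C_RInt (fun t => F t w) a b) in *. set (Iz := C_RInt (fun t => F t z) a b) in *.
  set (dw := C_RInt (fun t => C_derive (F t) w) a b) in *.
  set (dz := C_RInt (fun t => C_derive (F t) z) a b) in *.
  replace ((dw - dz) * (w - z))%C with
    ((Iw - Iz - dz * (w - z)) + (Iz - Iw - dw * (z - w)))%C by ring.
  eapply Rle_trans; [apply Cmod_triangle|]. rewrite (Cmod_minus_sym z w) in Hwz.
  assert (Hsz : forall x, disc z (s / 2) x -> disc c r x).
  { intros x Hx. apply Hsub. unfold disc in *. lra. }
  assert (Hsw : forall x, disc w (s / 2) x -> disc c r x).
  { intros x Hx. apply Hsub. unfold disc in *. generalize (Cmod_minus_triangle x w z). lra. }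
  specialize (Hzw Hsz Hw). specialize (Hwz Hsw). unfold disc in Hwz, Hw.
  rewrite Cmod_minus_sym in Hwz. specialize (Hwz Hw). simpl in *. lra.
Qed.

Lemma holomorphic_RInt_param :
  holomorphic_on (disc c r) (fun w => C_RInt (fun t => F t w) a b).
Proof.
  exists (fun w => C_RInt (fun t => C_derive (F t) w) a b). intros z Hz.
  split; [now apply is_C_derive_RInt_param|now apply continuous_RInt_param_derive].
Qed.

End ParameterIntegral.

Lemma Cmod_segment_le (u v : C) (t rho : R) : Cmod u <= rho -> Cmod v <= rho -> 0 <= t <= 1 ->
  Cmod (v + RtoC t * (u - v)) <= rho.
Proof.
  intros Hu Hv Ht. replace (v + RtoC t * (u - v))%C with (RtoC (1 - t) * v + RtoC t * u)%C
    by (rewrite RtoC_minus; ring).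
  eapply Rle_trans; [apply Cmod_triangle|]. rewrite !Cmod_mult, !Cmod_R_pos by lra. nra.
Qed.

Lemma continuous_segment (f : C -> C) (u v : C) (t : R) : continuous f (v + RtoC t * (u - v))%C ->
  continuous (fun s => f (v + RtoC s * (u - v))%C) t.
Proof.
  intro Hf. apply (continuous_comp (fun s => v + RtoC s * (u - v))%C f); [|exact Hf].
  apply continuous_Cplus; [apply continuous_const|].
  apply continuous_Cmult; [apply continuous_RtoC, continuous_id|apply continuous_const].
Qed.

Lemma segment_mean_derive (f : C -> C) (u v : C) : holomorphic_on disk f -> disk u -> disk v ->
  (f u - f v)%C = ((u - v) * C_RInt (fun t => C_derive f (v + RtoC t * (u - v))%C) 0 1)%C.
Proof.
  intros Hf Hu Hv.
  assert (Hseg : forall t, 0 <= t <= 1 -> disk (v + RtoC t * (u - v))%C).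
  { intros t Ht. apply (Rle_lt_trans _ (Rmax (Cmod u) (Cmod v))); [|now apply Rmax_lub_lt].
    apply Cmod_segment_le; [apply Rmax_l|apply Rmax_r|exact Ht]. }
  assert (Hc : forall t, 0 <= t <= 1 ->
    continuous (fun s => C_derive f (v + RtoC s * (u - v))%C) t).
  { intros t Ht. apply continuous_segment, (holomorphic_on_continuous_derive disk); auto.
    apply open_disk. }
  assert (HI := is_C_RInt_C_RInt _ _ _ (ex_C_RInt_continuous _ 0 1 Rle_0_1 Hc)).
  apply (is_C_RInt_scal (u - v)) in HI.
  assert (HD : is_C_RInt (fun t => (u - v) * C_derive f (v + RtoC t * (u - v)))%C 0 1
    (f (v + RtoC 1 * (u - v))%C - f (v + RtoC 0 * (u - v))%C)%C).
  { apply (is_C_RInt_derive (fun t => f (v + RtoC t * (u - v))%C)); [lra| |].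
    - intros t Ht. rewrite Cmult_comm. apply (is_path_derive_comp f).
      + apply (holomorphic_on_derive disk); auto.
      + apply is_path_derive_affine.
    - intros t Ht. apply continuous_Cmult; [apply continuous_const|auto]. }
  transitivity (f (v + RtoC 1 * (u - v)) - f (v + RtoC 0 * (u - v)))%C.
  - f_equal; f_equal; ring.
  - exact (is_C_RInt_functional _ _ _ _ _ HD HI).
Qed.

Lemma segment_mean_holomorphic (f u v : C -> C) (c : C) (r rho : R) : rho < 1 ->
  holomorphic_on disk f -> holomorphic_on (disc c r) u -> holomorphic_on (disc c r) v ->
  (forall z, disc c r z -> Cmod (u z) <= rho /\ Cmod (v z) <= rho) ->
  holomorphic_on (disc c r) (fun z => C_RInt (fun t => f (v z + RtoC t * (u z - v z))%C) 0 1).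
Proof.
  intros Hrho Hf Hu Hv Hb.
  destruct (bounded_on_closed_disc 0 rho f) as [B [_ HB]].
  { intros w Hw. apply (holomorphic_on_continuous disk); [exact Hf|].
    rewrite Cminus_0_r in Hw. unfold disk. lra. }
  assert (Hs : forall t z, 0 <= t <= 1 -> disc c r z -> Cmod (v z + RtoC t * (u z - v z)) <= rho).
  { intros t z Ht Hz. now apply Cmod_segment_le; [apply Hb|apply Hb|]. }
  assert (Hsd : forall t z, 0 <= t <= 1 -> disc c r z -> disk (v z + RtoC t * (u z - v z))%C).
  { intros t z Ht Hz. apply (Rle_lt_trans _ rho); [now apply Hs|exact Hrho]. }
  apply (holomorphic_RInt_param (fun t z => f (v z + RtoC t * (u z - v z))%C) 0 1 c r B); [lra|..].
  - intros t Ht. apply (holomorphic_on_comp _ disk f); [exact Hf| |intros z; apply Hsd; lra].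
    apply holomorphic_on_plus; [exact Hv|]. now apply holomorphic_on_scal, holomorphic_on_minus.
  - intros t z Ht Hz. apply HB. rewrite Cminus_0_r. apply Hs; [lra|exact Hz].
  - intros z Hz. apply ex_C_RInt_continuous; [lra|]. intros t Ht. apply continuous_segment.
    apply (holomorphic_on_continuous disk); auto.
  - intros z Hz.
    assert (Du := holomorphic_on_derive _ _ _ Hu Hz).
    assert (Dv := holomorphic_on_derive _ _ _ Hv Hz).
    set (du := C_derive u z) in *. set (dv := C_derive v z) in *.
    destruct (ex_C_RInt_continuous (fun t => C_derive f (v z + RtoC t * (u z - v z)) *
      (dv + RtoC t * (du - dv)))%C 0 1) as [l Hl]; [lra| |].
    + intros t Ht.
      apply continuous_Cmult; [|apply (continuous_segment (fun w => w)), continuous_id].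
      apply continuous_segment, (holomorphic_on_continuous_derive disk); auto. apply open_disk.
    + exists l. revert Hl. apply is_C_RInt_ext; [lra|]. intros t Ht. symmetry.
      apply is_C_derive_unique, (is_C_derive_comp f (fun z => v z + RtoC t * (u z - v z))%C).
      * apply (holomorphic_on_derive disk); [exact Hf|]. apply Hsd; [lra|exact Hz].
      * apply is_C_derive_plus; [exact Dv|]. now apply is_C_derive_scal, is_C_derive_minus.
Qed.

Lemma holomorphic_comp_minus_factor (A : C -> Prop) (f u v : C -> C) : open A ->
  holomorphic_on disk f -> holomorphic_on A u -> holomorphic_on A v ->
  (forall z, A z -> disk (u z) /\ disk (v z)) ->
  exists q, holomorphic_on A q /\
    forall z, A z -> (f (u z) - f (v z))%C = ((u z - v z) * q z)%C.
Proof.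
  intros HA Hf Hu Hv HAd.
  exists (fun z => C_RInt (fun t => C_derive f (v z + RtoC t * (u z - v z))%C) 0 1).
  split; [|intros z Hz; now apply segment_mean_derive; [|apply HAd..]].
  apply holomorphic_on_local. intros z Hz. destruct (HAd z Hz) as [Du Dv].
  assert (Hmax : Rmax (Cmod (u z)) (Cmod (v z)) < 1) by now apply Rmax_lub_lt.
  assert (Hcont : forall w, holomorphic_on A w -> Cmod (w z) <= Rmax (Cmod (u z)) (Cmod (v z)) ->
    locally z (fun x => Cmod (w x) < (1 + Rmax (Cmod (u z)) (Cmod (v z))) / 2)).
  { intros w Hw Hle. apply continuous_lt; [|lra].
    now apply continuous_Cmod, (holomorphic_on_continuous A). }
  assert (Hloc := filter_and _ _ (HA z Hz)
    (filter_and _ _ (Hcont u Hu (Rmax_l _ _)) (Hcont v Hv (Rmax_r _ _)))).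
  apply locally_Cmod in Hloc. destruct Hloc as [d [Hd Hloc]]. exists d. split; [exact Hd|].
  assert (Hsub : forall w, disc z d w -> A w) by (intros w Hw; now apply Hloc).
  apply (segment_mean_holomorphic (C_derive f) u v z d
    ((1 + Rmax (Cmod (u z)) (Cmod (v z))) / 2)); [lra| | | |].
  - now apply holomorphic_on_C_derive; [apply open_disk|].
  - now apply (holomorphic_on_subset A).
  - now apply (holomorphic_on_subset A).
  - intros w Hw. destruct (Hloc w Hw) as [_ [Hur Hvr]]. lra.
Qed.

(** * Ray means and starlikeness *)

Definition ray_mean (m : nat) (f : C -> C) (z : C) : C :=
  C_RInt (fun t => RtoC t ^ m * f (RtoC t * z))%C 0 1.

Lemma disc_0_ray (R0 : R) (z : C) (t : R) : Cmod z < R0 -> 0 <= t <= 1 ->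
  disc 0 R0 (RtoC t * z)%C.
Proof.
  intros Hz Ht. apply disc_0. rewrite Cmod_mult, Cmod_R_pos by lra.
  generalize (Cmod_ge_0 z). nra.
Qed.

Lemma is_ray_mean (R0 : R) (m : nat) (f : C -> C) (z : C) : holomorphic_on (disc 0 R0) f ->
  Cmod z < R0 -> is_C_RInt (fun t => RtoC t ^ m * f (RtoC t * z))%C 0 1 (ray_mean m f z).
Proof.
  intros Hf Hz. apply is_C_RInt_C_RInt, ex_C_RInt_continuous; [lra|]. intros t Ht.
  apply continuous_Cmult; [apply continuous_Cpow, continuous_RtoC, continuous_id|].
  apply (continuous_ray f z (fun s => s)); [|apply continuous_id].
  apply (holomorphic_on_continuous _ _ _ Hf). now apply disc_0_ray.
Qed.

(* Divide the [k]-th Taylor coefficient of [f] by [k + m + 1]. *)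
Lemma ex_Euler_primitive (R0 : R) (m : nat) (f : C -> C) : 0 < R0 -> holomorphic_on (disc 0 R0) f ->
  exists h, holomorphic_on (disc 0 R0) h /\
    forall z, Cmod z < R0 -> (z * C_derive h z + RtoC (INR (S m)) * h z)%C = f z.
Proof.
  intros HR Hf. destruct (holomorphic_pseries R0 f HR Hf) as [a Ha].
  set (b := fun k => (/ RtoC (INR (k + S m)) * a k)%C).
  assert (Hn : forall k, 1 <= INR (k + S m)) by (intro k; apply (le_INR 1); lia).
  destruct (pseries_on_ex_le R0 a b f Ha) as [h Hh].
  { intro k. unfold b. specialize (Hn k). rewrite Cmod_mult, Cmod_inv, Cmod_R_pos by
      (try apply RtoC_neq_0; lra).
    apply Rinv_le_contravar in Hn; [|lra]. rewrite Rinv_1 in Hn.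
    generalize (Cmod_ge_0 (a k)). nra. }
  destruct (pseries_on_derive_ex R0 b h Hh) as [dh Hdh].
  exists h. split; [now apply (pseries_on_holomorphic R0 b)|]. intros z Hz.
  rewrite (is_C_derive_unique _ _ _ (pseries_on_is_C_derive R0 b h dh Hh Hdh z Hz)).
  apply (is_C_pseries_functional a z); [|now apply Ha].
  refine (is_C_pseries_ext _ _ _ _ _ (is_C_pseries_plus _ _ _ _ _
    (is_C_pseries_incr_1 _ _ _ (Hdh z Hz)) (is_C_pseries_scal (RtoC (INR (S m))) _ _ _ (Hh z Hz)))).
  intro k. assert (Hk : RtoC (INR (k + S m)) <> 0) by (apply RtoC_neq_0; specialize (Hn k); lra).
  transitivity (RtoC (INR (k + S m)) * b k)%C; [|unfold b; field; exact Hk].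
  rewrite plus_INR, RtoC_plus. destruct k as [|k]; [simpl INR; ring|unfold C_PS_derive; ring].
Qed.

Lemma ray_mean_of_Euler (R0 : R) (m : nat) (f h : C -> C) (z : C) :
  holomorphic_on (disc 0 R0) f -> holomorphic_on (disc 0 R0) h ->
  (forall w, Cmod w < R0 -> (w * C_derive h w + RtoC (INR (S m)) * h w)%C = f w) ->
  Cmod z < R0 -> ray_mean m f z = h z.
Proof.
  intros Hf Hh E Hz. apply is_C_RInt_unique.
  set (g := fun w => (w ^ S m * h (w * z))%C).
  replace (h z) with (g (RtoC 1 * 1)%C - g (RtoC 0 * 1)%C)%C.
  2:{ unfold g. rewrite Cmult_0_l, !Cmult_1_l, Cpow_1_l, (Cpow_S 0). ring. }
  apply (is_C_RInt_derive (fun t => g (RtoC t * 1)%C)); [lra| |]; intros t Ht;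
    assert (Dt := disc_0_ray R0 z t Hz Ht).
  - rewrite <- E by (now apply disc_0). set (w := (RtoC t * z)%C).
    replace (RtoC t ^ m * (w * C_derive h w + RtoC (INR (S m)) * h w))%C with
      ((RtoC (INR (S m)) * RtoC t ^ m * 1 * h w + RtoC t ^ S m * (C_derive h w * z)) * 1)%C
      by (unfold w; rewrite Cpow_S; ring).
    apply is_path_derive_ray. rewrite Cmult_1_r.
    apply (is_C_derive_mult (fun w => w ^ S m)%C (fun w => h (w * z)%C)).
    + apply (is_C_derive_pow (fun w => w)), is_C_derive_id.
    + apply (is_C_derive_comp h (fun w => w * z)%C).
      * now apply (holomorphic_on_derive (disc 0 R0)).
      * apply (is_C_derive_ext (fun w => 0 + z * w)%C); [intro; ring|apply is_C_derive_affine].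
  - apply continuous_Cmult; [apply continuous_Cpow, continuous_RtoC, continuous_id|].
    apply (continuous_ray f z (fun s => s)); [|apply continuous_id].
    now apply (holomorphic_on_continuous _ _ _ Hf).
Qed.

Lemma ray_mean_Euler (R0 : R) (m : nat) (f : C -> C) : 0 < R0 -> holomorphic_on (disc 0 R0) f ->
  holomorphic_on (disc 0 R0) (ray_mean m f) /\ forall z, Cmod z < R0 ->
    (z * C_derive (ray_mean m f) z + RtoC (INR (S m)) * ray_mean m f z)%C = f z.
Proof.
  intros HR Hf. destruct (ex_Euler_primitive R0 m f HR Hf) as [h [Hh E]].
  assert (Eh : forall z, disc 0 R0 z -> h z = ray_mean m f z).
  { intros z Hz. rewrite disc_0 in Hz. symmetry. now apply (ray_mean_of_Euler R0). }
  assert (Hr : holomorphic_on (disc 0 R0) (ray_mean m f))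
    by (apply (holomorphic_on_ext _ h); auto; apply open_disc).
  split; [exact Hr|]. intros z Hz. rewrite <- E, <- Eh by (auto; now apply disc_0).
  do 2 f_equal. apply is_C_derive_unique. apply (is_C_derive_ext_loc h).
  - apply (filter_imp (disc 0 R0)); [exact Eh|]. now apply open_disc, disc_0.
  - now apply (holomorphic_on_derive (disc 0 R0)); [|apply disc_0].
Qed.

Lemma RtoC_INR_S_neq_0 (m : nat) : RtoC (INR (S m)) <> 0.
Proof. apply RtoC_neq_0, not_0_INR. lia. Qed.

Lemma holomorphic_on_ray_mean (m : nat) (f : C -> C) : holomorphic_on disk f ->
  holomorphic_on disk (ray_mean m f).
Proof.
  intro Hf. apply holomorphic_on_disc_0_1, ray_mean_Euler; [lra|now apply holomorphic_on_disc_0_1].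
Qed.

Lemma ray_mean_disk_Euler (m : nat) (f : C -> C) (z : C) : holomorphic_on disk f -> disk z ->
  (z * C_derive (ray_mean m f) z + RtoC (INR (S m)) * ray_mean m f z)%C = f z.
Proof.
  intro Hf. apply (ray_mean_Euler 1); [lra|now apply holomorphic_on_disc_0_1].
Qed.

Lemma ray_mean_at_0 (m : nat) (f : C -> C) : holomorphic_on disk f ->
  (RtoC (INR (S m)) * ray_mean m f 0)%C = f 0.
Proof.
  intro Hf. rewrite <- (ray_mean_disk_Euler m f 0 Hf disk_0). ring.
Qed.

Section RayMeanQuotients.

Variables (m : nat) (M : C -> C).
Hypotheses (HM : holomorphic_on disk M) (HMn : forall z, disk z -> M z <> 0)
  (Hconvex : forall z, disk z -> 0 < INR (S m) + Re (log_derive M z)).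

(* [F = z^(m+1) ray_mean m M] satisfies [z F' = z^(m+1) M]: the convexity of [F] makes it
   starlike. *)
Lemma ray_mean_quotient_Re_pos (z : C) : disk z -> 0 < Re (ray_mean m M z / M z).
Proof.
  set (h := ray_mean m M). assert (Hh : holomorphic_on disk h) by now apply holomorphic_on_ray_mean.
  assert (PN : 0 < INR (S m)) by (apply lt_0_INR; lia). intro Hz.
  enough (Hneg : Re (- (h z / M z)) < 0) by (rewrite re_opp in Hneg; lra). revert z Hz.
  apply (Re_neg_of_no_contact (fun z => - (h z / M z))%C).
  - now apply holomorphic_on_opp, holomorphic_on_div.
  - assert (Eh0 := ray_mean_at_0 m M HM). fold h in Eh0. assert (NM := HMn 0 disk_0).
    replace (- (h 0 / M 0))%C with (RtoC (- / INR (S m))).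
    + rewrite re_RtoC. generalize (Rinv_0_lt_compat _ PN). lra.
    + rewrite RtoC_opp, RtoC_inv by lra. f_equal. apply (Cmult_eq_reg_l (RtoC (INR (S m)))).
      { apply RtoC_INR_S_neq_0. }
      unfold Cdiv. rewrite Cmult_assoc, Eh0, !Cinv_r; auto. apply RtoC_INR_S_neq_0.
  - intros z k Hz Hz0 Hre Hk. assert (NM := HMn z Hz).
    assert (Dh := holomorphic_on_derive _ _ _ Hh Hz).
    assert (DM := holomorphic_on_derive _ _ _ HM Hz).
    assert (Dp : C_derive (fun w => - (h w / M w))%C z =
      (- ((C_derive h z * M z - h z * C_derive M z) / (M z * M z)))%C)
      by now apply is_C_derive_unique, is_C_derive_opp, (is_C_derive_div h M).
    assert (E : (h z / M z * (RtoC (INR (S m)) + log_derive M z))%C = RtoC (1 + k)).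
    { rewrite RtoC_plus, <- Hk, Dp. unfold log_derive.
      assert (E := ray_mean_disk_Euler m M z HM Hz). fold h in E.
      transitivity ((z * C_derive h z + RtoC (INR (S m)) * h z) / M z -
        z * (C_derive h z * M z - h z * C_derive M z) / (M z * M z))%C; [field; exact NM|].
      rewrite E. field. exact NM. }
    rewrite re_opp in Hre. specialize (Hconvex z Hz).
    set (s := (h z / M z)%C) in *. set (l := log_derive M z) in *.
    assert (ERe : Re (s * (RtoC (INR (S m)) + l)) = 1 + k) by (rewrite E; apply re_RtoC).
    assert (EIm : Im (s * (RtoC (INR (S m)) + l)) = 0) by (rewrite E; apply im_RtoC).
    rewrite re_mult, re_plus, re_RtoC in ERe. rewrite im_mult, re_plus, re_RtoC in EIm.
    assert (Is : Im s * (INR (S m) + Re l) = 0) by nra.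
    apply Rmult_integral in Is. nra.
Qed.

Lemma ray_mean_neq_0 (z : C) : disk z -> ray_mean m M z <> 0.
Proof.
  intros Hz E. generalize (ray_mean_quotient_Re_pos z Hz). rewrite E. unfold Cdiv.
  rewrite Cmult_0_l, re_RtoC. lra.
Qed.

Lemma ray_mean_ratio_Re_neg (G : C -> C) (z : C) : holomorphic_on disk G ->
  (forall w, disk w -> Re (G w / M w) < 0) -> disk z ->
  Re (ray_mean m G z / ray_mean m M z) < 0.
Proof.
  intros HG HGM. set (h := ray_mean m M). set (r := ray_mean m G). revert z.
  assert (Hh : holomorphic_on disk h) by now apply holomorphic_on_ray_mean.
  assert (Hr : holomorphic_on disk r) by now apply holomorphic_on_ray_mean.
  assert (Nh : forall w, disk w -> h w <> 0) by exact ray_mean_neq_0.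
  apply (Re_neg_of_no_contact (fun z => r z / h z)%C).
  - now apply holomorphic_on_div.
  - replace (r 0 / h 0)%C with (G 0 / M 0)%C; [now apply HGM, disk_0|].
    rewrite <- (ray_mean_at_0 m G HG), <- (ray_mean_at_0 m M HM). fold r h. field.
    split; [now apply Nh, disk_0|apply RtoC_INR_S_neq_0].
  - intros z k Hz Hz0 Hre Hk. assert (NM := HMn z Hz). assert (Nhz := Nh z Hz).
    assert (Dh := holomorphic_on_derive _ _ _ Hh Hz).
    assert (Dr := holomorphic_on_derive _ _ _ Hr Hz).
    assert (Dp : C_derive (fun w => r w / h w)%C z =
      ((C_derive r z * h z - r z * C_derive h z) / (h z * h z))%C)
      by now apply is_C_derive_unique, (is_C_derive_div r h).
    assert (E : (G z / M z)%C = (r z / h z + RtoC k * (h z / M z))%C).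
    { assert (EM := ray_mean_disk_Euler m M z HM Hz). fold h in EM.
      assert (EG := ray_mean_disk_Euler m G z HG Hz). fold r in EG.
      rewrite <- Hk, Dp, <- EG. apply (Cmult_eq_reg_l (M z)); [exact NM|].
      transitivity (z * C_derive r z + RtoC (INR (S m)) * r z)%C; [field; exact NM|].
      transitivity (r z / h z * M z + z * (C_derive r z * h z - r z * C_derive h z) / h z)%C;
        [|field; auto].
      rewrite <- EM. field. exact Nhz. }
    specialize (HGM z Hz). rewrite E, re_plus, Hre, re_scal_l in HGM.
    generalize (ray_mean_quotient_Re_pos z Hz). fold h. nra.
Qed.

End RayMeanQuotients.

(** * Variation along the extremal chains *)

Definition P_chain_slope (P : C -> C) (k : nat) (gamma : nat -> C) (x z : C) : C :=
  (C_derive P (schur_chain k gamma x z) * chain_slope k gamma x z)%C.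

Lemma holomorphic_on_P_chain (A : C -> Prop) (P : C -> C) (k : nat) (gamma : nat -> C)
    (w : C -> C) :
  holomorphic_on disk P -> disk_below (S k) gamma -> holomorphic_on A w ->
  (forall z, A z -> chain_domain (w z) z) ->
  holomorphic_on A (fun z => P (schur_chain (S k) gamma (w z) z)).
Proof.
  intros HP Hg Hw HA. apply (holomorphic_on_comp A disk P); [exact HP| |].
  - now apply holomorphic_on_schur_chain.
  - intros z Hz. now apply disk_schur_chain_S, HA.
Qed.

Lemma is_C_derive_P_chain (P : C -> C) (k : nat) (gamma : nat -> C) (x z : C) :
  holomorphic_on disk P -> disk_below (S k) gamma -> chain_domain x z ->
  is_C_derive (fun y => P (schur_chain (S k) gamma y z)) x
    (z ^ S k * P_chain_slope P (S k) gamma x z)%C.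
Proof.
  intros HP Hg Hz. apply (is_C_derive_eq _ _ (C_derive P (schur_chain (S k) gamma x z) *
    (z ^ S k * chain_slope (S k) gamma x z))%C); [unfold P_chain_slope; ring|].
  apply (is_C_derive_comp P (fun y => schur_chain (S k) gamma y z)).
  - apply (holomorphic_on_derive disk); [exact HP|now apply disk_schur_chain_S].
  - now apply is_C_derive_schur_chain.
Qed.

Lemma holomorphic_on_P_chain_slope (P : C -> C) (k : nat) (gamma : nat -> C) (x : C) :
  holomorphic_on disk P -> disk_below (S k) gamma ->
  holomorphic_on (chain_domain x) (P_chain_slope P (S k) gamma x).
Proof.
  intros HP Hg. apply holomorphic_on_mult; [|now apply holomorphic_on_chain_slope].
  apply (holomorphic_on_P_chain _ (C_derive P) k gamma (fun _ => x)); auto.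
  - now apply holomorphic_on_C_derive; [apply open_disk|].
  - apply holomorphic_on_const.
Qed.

Lemma continuous_P_chain_slope (P : C -> C) (k : nat) (gamma : nat -> C) (x z : C) :
  holomorphic_on disk P -> disk_below (S k) gamma -> chain_domain x z ->
  continuous (fun y => P_chain_slope P (S k) gamma y z) x.
Proof.
  intros HP Hg Hz. apply continuous_Cmult; [|now apply continuous_chain_slope].
  apply (continuous_comp (fun y => schur_chain (S k) gamma y z) (C_derive P)).
  - eapply is_C_derive_continuous. now apply is_C_derive_schur_chain.
  - apply (holomorphic_on_continuous_derive disk); [apply open_disk|exact HP|].
    now apply disk_schur_chain_S.
Qed.

Section Variation.

Variables (P : C -> C) (k : nat) (gamma : nat -> C).
Hypotheses (HP : convex_map P) (Hg : disk_below (S k) gamma).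

Let HPh : holomorphic_on disk P := proj1 (proj1 HP).

Lemma P_chain_slope_neq_0 (x z : C) : chain_domain x z -> P_chain_slope P (S k) gamma x z <> 0.
Proof.
  intro Hz. apply Cmult_neq_0; [|now apply chain_slope_neq_0].
  apply univalent_C_derive_neq_0; [apply HP|now apply disk_schur_chain_S].
Qed.

Lemma P_chain_slope_convexity (x z : C) : chain_domain x z ->
  0 < INR (S k) + Re (log_derive (P_chain_slope P (S k) gamma x) z).
Proof.
  intro Hz. assert (Hd := disk_schur_chain_S k gamma x z Hg Hz).
  assert (NP := univalent_C_derive_neq_0 P _ (proj1 HP) Hd).
  assert (Dc : is_C_derive (schur_chain (S k) gamma x) z (C_derive (schur_chain (S k) gamma x) z)).
  { apply (holomorphic_on_derive (chain_domain x)); [|exact Hz].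
    apply (holomorphic_on_schur_chain _ _ _ (fun _ => x)); auto. apply holomorphic_on_const. }
  set (dP := fun w => C_derive P (schur_chain (S k) gamma x w)).
  assert (DdP : is_C_derive dP z
    (C_derive (C_derive P) (schur_chain (S k) gamma x z) *
      C_derive (schur_chain (S k) gamma x) z)%C).
  { apply (is_C_derive_comp (C_derive P)); [|exact Dc].
    apply (holomorphic_on_derive disk); [|exact Hd].
    now apply holomorphic_on_C_derive; [apply open_disk|]. }
  assert (Ds := holomorphic_on_derive _ _ _ (holomorphic_on_chain_slope (S k) gamma x Hg) Hz).
  assert (E : log_derive (P_chain_slope P (S k) gamma x) z =
    (C_derive (C_derive P) (schur_chain (S k) gamma x z) /
      C_derive P (schur_chain (S k) gamma x z) *
      (z * C_derive (schur_chain (S k) gamma x) z) + log_derive (chain_slope (S k) gamma x) z)%C).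
  { transitivity (log_derive dP z + log_derive (chain_slope (S k) gamma x) z)%C.
    - apply (log_derive_mult dP _ z _ _ DdP Ds NP). now apply chain_slope_neq_0.
    - f_equal. unfold log_derive. rewrite (is_C_derive_unique _ _ _ DdP). unfold dP. field.
      exact NP. }
  rewrite E, re_plus. generalize (convexity_margin_convex_map P _ _ _ HP Hd
    (schur_chain_convexity_margin k gamma x z Hg Hz)). lra.
Qed.

Lemma P_chain_support_lt (x w z : C) : Cmod x <= 1 -> x <> 0 -> Cmod w <= Cmod x -> w <> x ->
  disk z -> z <> 0 ->
  Re ((P (schur_chain (S k) gamma w z) - P (schur_chain (S k) gamma x z)) /
    (x * (z ^ S k * P_chain_slope P (S k) gamma x z))) < 0.
Proof.
  intros Hx Nx Hw Hwx Hz Nz.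
  destruct (convex_map_schur_chain k P gamma z HP Hg Nz Hz) as [q [Hq E]].
  assert (Hzx := chain_domain_of_disk x z Hx Hz).
  assert (Dq : (z ^ S k * P_chain_slope P (S k) gamma x z)%C = (C_derive q (z * x) * (z * 1))%C).
  { apply (is_C_derive_functional (fun y => P (schur_chain (S k) gamma y z)) x);
      [now apply is_C_derive_P_chain|].
    apply (is_C_derive_ext (fun y => q (z * y)%C)); [intro y; now rewrite E|].
    apply (is_C_derive_comp q (fun y => z * y)%C); [|apply is_C_derive_scal, is_C_derive_id].
    apply (holomorphic_on_derive disk); [apply Hq|apply Hzx]. }
  rewrite Dq, !E. replace (x * (C_derive q (z * x) * (z * 1)))%C
    with (z * x * C_derive q (z * x))%C by ring.
  apply convex_map_support_lt; [exact Hq|apply Hzx|now apply Cmult_neq_0| |].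
  - rewrite !Cmod_mult. apply Rmult_le_compat_l; [apply Cmod_ge_0|exact Hw].
  - intro Ez. apply Hwx. now apply Cmult_eq_reg_l in Ez.
Qed.

Lemma P_chain_minus (v w : C -> C) : holomorphic_on disk v -> holomorphic_on disk w ->
  (forall z, disk z -> Cmod (v z) <= 1 /\ Cmod (w z) <= 1) ->
  exists G, holomorphic_on disk G /\ forall z, disk z ->
    (P (schur_chain (S k) gamma (v z) z) - P (schur_chain (S k) gamma (w z) z))%C =
      (z ^ S k * G z)%C.
Proof.
  intros Hv Hw Hb.
  assert (Hvd : forall z, disk z -> chain_domain (v z) z)
    by (intros z Hz; apply chain_domain_of_disk; [now apply Hb|exact Hz]).
  assert (Hwd : forall z, disk z -> chain_domain (w z) z)
    by (intros z Hz; apply chain_domain_of_disk; [now apply Hb|exact Hz]).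
  destruct (schur_chain_minus disk (S k) gamma v w Hg Hv Hw) as [h [Hh Eh]]; [now split; auto|].
  destruct (holomorphic_comp_minus_factor disk P (fun z => schur_chain (S k) gamma (v z) z)
    (fun z => schur_chain (S k) gamma (w z) z)) as [q [Hq Eq]]; auto.
  { apply open_disk. }
  { now apply holomorphic_on_schur_chain. }
  { now apply holomorphic_on_schur_chain. }
  { intros z Hz. split; apply disk_schur_chain_S; auto. }
  exists (fun z => h z * q z)%C. split; [now apply holomorphic_on_mult|]. intros z Hz.
  rewrite Eq, Eh by exact Hz. ring.
Qed.

Lemma P_chain_variation (x : C) (w : C -> C) : Cmod x <= 1 -> x <> 0 -> holomorphic_on disk w ->
  (forall z, disk z -> Cmod (w z) <= Cmod x /\ w z <> x) ->
  exists G, holomorphic_on disk G /\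
    (forall z, disk z -> (P (schur_chain (S k) gamma (w z) z) - P (schur_chain (S k) gamma x z))%C =
      (z ^ S k * (x * G z))%C) /\
    forall z, disk z -> Re (G z / P_chain_slope P (S k) gamma x z) < 0.
Proof.
  intros Hx Nx Hw Hwx.
  assert (Hxd : forall z, disk z -> chain_domain x z) by (intros; now apply chain_domain_of_disk).
  destruct (P_chain_minus w (fun _ => x) Hw (holomorphic_on_const disk x)) as [h [Hh Eh]].
  { intros z Hz. destruct (Hwx z Hz). lra. }
  set (G := fun z => (/ x * h z)%C).
  assert (HG : holomorphic_on disk G) by now apply holomorphic_on_scal.
  assert (EG : forall z, disk z -> (P (schur_chain (S k) gamma (w z) z) -
    P (schur_chain (S k) gamma x z))%C = (z ^ S k * (x * G z))%C).
  { intros z Hz. rewrite Eh by exact Hz. unfold G. field. exact Nx. }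
  exists G. split; [exact HG|]. split; [exact EG|].
  assert (Hneg : forall z, disk z -> z <> 0 -> Re (G z / P_chain_slope P (S k) gamma x z) < 0).
  { intros z Hz Nz. destruct (Hwx z Hz) as [Hle Hne].
    assert (Hlt := P_chain_support_lt x (w z) z Hx Nx Hle Hne Hz Nz). rewrite EG in Hlt by exact Hz.
    replace (G z / P_chain_slope P (S k) gamma x z)%C with (z ^ S k * (x * G z) /
      (x * (z ^ S k * P_chain_slope P (S k) gamma x z)))%C; [exact Hlt|].
    assert (NM := P_chain_slope_neq_0 x z (Hxd z Hz)). assert (Nzk := Cpow_nz z (S k) Nz).
    field. auto. }
  intros z Hz. destruct (Ceq_dec z 0) as [->|Nz]; [|now apply Hneg].
  apply (Re_neg_at_0 (fun z => G z / P_chain_slope P (S k) gamma x z)%C); [|exact Hneg].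
  apply holomorphic_on_div; [exact HG| |intros y Hy; now apply P_chain_slope_neq_0, Hxd].
  apply (holomorphic_on_subset (chain_domain x));
    [exact Hxd|now apply holomorphic_on_P_chain_slope].
Qed.

End Variation.

(** * Weighted integrals *)

(* The exponent [j >= -1] is written [J - 1] with [J] a natural number. *)
Definition is_weighted_int (J : nat) (g : C -> C) (g0 z l : C) : Prop :=
  is_C_RInt (fun t => Cpowz (RtoC t * z) (Z.of_nat J - 1) * (g (RtoC t * z) - g0) * z)%C 0 1 l.

Lemma is_weighted_int_unique (J : nat) (g : C -> C) (g0 z l : C) : is_weighted_int J g g0 z l ->
  weighted_int (Z.of_nat J - 1) g g0 z = l.
Proof. apply is_C_RInt_unique. Qed.

Lemma weighted_int_ext (j : Z) (f g : C -> C) (g0 z : C) :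
  (forall t, 0 < t < 1 -> f (RtoC t * z)%C = g (RtoC t * z)%C) ->
  weighted_int j f g0 z = weighted_int j g g0 z.
Proof.
  intro E. refine (RInt_ext (V := C_R_CompleteNormedModule) _ _ 0 1 _).
  rewrite Rmin_left, Rmax_right by lra. intros t Ht. now rewrite E.
Qed.

Lemma Cpowz_Cpow (z : C) (J k : nat) : z <> 0 ->
  (Cpowz z (Z.of_nat J - 1) * z ^ S k)%C = (z ^ (k + J))%C.
Proof.
  intro Hz. destruct J as [|J].
  - simpl Z.of_nat. simpl Z.sub. simpl Cpowz. change (Pos.to_nat 1) with 1%nat.
    rewrite Nat.add_0_r, !Cpow_S. simpl. field. exact Hz.
  - replace (Z.of_nat (S J) - 1)%Z with (Z.of_nat J) by lia.
    assert (E : Cpowz z (Z.of_nat J) = (z ^ J)%C).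
    { destruct J as [|J]; [reflexivity|]. simpl. now rewrite SuccNat2Pos.id_succ. }
    rewrite E, <- Cpow_add_r. f_equal. lia.
Qed.

Lemma ray_neq_0 (z : C) (t : R) : z <> 0 -> 0 < t -> (RtoC t * z)%C <> 0.
Proof. intros Hz Ht. apply Cmult_neq_0; [apply RtoC_neq_0; lra|exact Hz]. Qed.

Lemma Cpowz_ray (z h : C) (J k : nat) (t : R) : z <> 0 -> 0 < t ->
  (Cpowz (RtoC t * z) (Z.of_nat J - 1) * ((RtoC t * z) ^ S k * h) * z)%C =
    (z ^ S (k + J) * (RtoC t ^ (k + J) * h))%C.
Proof.
  intros Hz Ht. rewrite Cmult_assoc, Cpowz_Cpow by now apply ray_neq_0.
  rewrite Cpow_mult_l, (Cpow_S z). ring.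
Qed.

Lemma is_weighted_int_pow (J k : nat) (g h : C -> C) (g0 z l : C) : z <> 0 ->
  (forall t, 0 < t < 1 -> (g (RtoC t * z) - g0)%C = ((RtoC t * z) ^ S k * h (RtoC t * z))%C) ->
  is_C_RInt (fun t => RtoC t ^ (k + J) * h (RtoC t * z))%C 0 1 l ->
  is_weighted_int J g g0 z (z ^ S (k + J) * l)%C.
Proof.
  intros Hz E Hl. apply (is_C_RInt_scal (z ^ S (k + J))) in Hl. revert Hl.
  apply is_C_RInt_ext; [lra|]. intros t Ht. rewrite E by exact Ht. symmetry.
  apply Cpowz_ray; [exact Hz|lra].
Qed.

Lemma is_weighted_int_weighted_int (R0 : R) (J : nat) (g : C -> C) (z : C) :
  holomorphic_on (disc 0 R0) g -> z <> 0 -> Cmod z < R0 ->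
  is_weighted_int J g (g 0) z (weighted_int (Z.of_nat J - 1) g (g 0) z).
Proof.
  intros Hg Hz HR. assert (PR : 0 < R0) by (generalize (Cmod_ge_0 z); lra).
  destruct (holomorphic_factor R0 g PR Hg) as [f [Hf E]].
  assert (Hw : is_weighted_int J g (g 0) z (z ^ S (0 + J) * ray_mean (0 + J) f z)%C).
  { apply (is_weighted_int_pow J 0 g f); [exact Hz| |now apply (is_ray_mean R0)].
    intros t Ht. rewrite E by (apply disc_0, disc_0_ray; [exact HR|lra]). simpl. ring. }
  now rewrite (is_weighted_int_unique _ _ _ _ _ Hw).
Qed.

Lemma weighted_int_minus (J k : nat) (f g G : C -> C) (z : C) : holomorphic_on disk f ->
  holomorphic_on disk g -> holomorphic_on disk G -> f 0 = g 0 -> disk z -> z <> 0 ->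
  (forall w, disk w -> (f w - g w)%C = (w ^ S k * G w)%C) ->
  (weighted_int (Z.of_nat J - 1) f (f 0) z - weighted_int (Z.of_nat J - 1) g (g 0) z)%C =
    (z ^ S (k + J) * ray_mean (k + J) G z)%C.
Proof.
  intros Hf Hg HG E0 Hz Nz E. apply holomorphic_on_disc_0_1 in Hf, Hg, HG.
  assert (If := is_weighted_int_weighted_int 1 J f z Hf Nz Hz).
  assert (Ig := is_weighted_int_weighted_int 1 J g z Hg Nz Hz).
  apply (is_C_RInt_functional _ _ _ _ _ (is_C_RInt_minus _ _ _ _ _ _ If Ig)).
  generalize (is_C_RInt_scal (z ^ S (k + J)) _ _ _ _ (is_ray_mean 1 (k + J) G z HG Hz)).
  apply is_C_RInt_ext; [lra|]. intros t Ht. rewrite <- Cpowz_ray by (auto; lra).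
  rewrite <- E by (apply disc_0_1, disc_0_ray; [exact Hz|lra]). rewrite E0. ring.
Qed.

(** * The extremal integral *)

Section ExtremalIntegral.

Variables (P : C -> C) (k : nat) (gamma : nat -> C) (J : nat) (z0 : C) (rho : R).
Hypotheses (HP : convex_map P) (Hg : disk_below (S k) gamma) (Nz0 : z0 <> 0)
  (Hrho : 1 < rho) (Hz0 : rho * Cmod z0 < 1).

Let HPh : holomorphic_on disk P := proj1 (proj1 HP).

Definition extremal_int (x : C) : C :=
  weighted_int (Z.of_nat J - 1) (fun z => P (schur_chain (S k) gamma x z)) (P (gamma 0%nat)) z0.

Lemma chain_domain_of_disc (x z : C) : Cmod x < rho -> Cmod z < / rho -> chain_domain x z.
Proof.
  intros Hx Hz. assert (Hr : / rho * rho = 1) by (apply Rinv_l; lra).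
  generalize (Cmod_ge_0 x) (Cmod_ge_0 z). intros Hx0 Hz0'. split; unfold disk; [nra|].
  rewrite Cmod_mult. nra.
Qed.

Lemma Cmod_z0_lt_inv : Cmod z0 < / rho.
Proof. apply Rmult_lt_reg_l with rho; [lra|]. now rewrite Rinv_r by lra. Qed.

Lemma extremal_int_correct (x : C) : Cmod x < rho ->
  is_weighted_int J (fun z => P (schur_chain (S k) gamma x z)) (P (gamma 0%nat)) z0
    (extremal_int x).
Proof.
  intro Hx. unfold extremal_int. rewrite <- (schur_chain_at_0 k gamma x).
  apply (is_weighted_int_weighted_int (/ rho) J (fun z => P (schur_chain (S k) gamma x z)));
    [|exact Nz0|exact Cmod_z0_lt_inv].
  apply (holomorphic_on_P_chain _ P k gamma (fun _ => x)); auto; [apply holomorphic_on_const|].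
  intros z Hz. apply chain_domain_of_disc; [exact Hx|now apply disc_0].
Qed.

Lemma is_ray_mean_P_chain_slope (m : nat) (x : C) : Cmod x < rho ->
  is_C_RInt (fun t => RtoC t ^ m * P_chain_slope P (S k) gamma x (RtoC t * z0))%C 0 1
    (ray_mean m (P_chain_slope P (S k) gamma x) z0).
Proof.
  intro Hx. apply (is_ray_mean (/ rho)); [|exact Cmod_z0_lt_inv].
  apply (holomorphic_on_subset (chain_domain x)); [|now apply holomorphic_on_P_chain_slope].
  intros z Hz. apply chain_domain_of_disc; [exact Hx|now apply disc_0].
Qed.

(* Schwarz's lemma on the disc of radius [|z0|]: the factor [|z|] absorbs the pole of the weight. *)
Lemma P_chain_minus_at_0_bounded : exists B, forall x z, Cmod x < rho -> Cmod z < Cmod z0 ->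
  Cmod (P (schur_chain (S k) gamma x z) - P (gamma 0%nat)) <= B * Cmod z.
Proof.
  assert (Pz0 := proj1 (Cmod_gt_0 z0) Nz0). assert (Hlt := Cmod_z0_lt_inv).
  destruct (Cmod_sigma_le_uniform (gamma 0%nat) (rho * Cmod z0)) as [s [Hs0 [Hs1 Hs]]];
    [now apply (disk_below_0 k)|nra|]. specialize (Hs1 Hz0).
  destruct (bounded_on_closed_disc 0 s P) as [B [_ HB]].
  { intros z Hz. apply (holomorphic_on_continuous disk); [exact HPh|].
    rewrite Cminus_0_r in Hz. unfold disk. lra. }
  assert (Hdom : forall x z, Cmod x < rho -> Cmod z < Cmod z0 -> chain_domain x z)
    by (intros x z Hx Hz; apply chain_domain_of_disc; lra).
  assert (Hbound : forall x z, Cmod x < rho -> Cmod z < Cmod z0 ->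
    Cmod (P (schur_chain (S k) gamma x z)) <= B).
  { intros x z Hx Hz. apply HB. rewrite Cminus_0_r. apply Hs.
    eapply Rle_trans; [apply Cmod_Cmult_schur_chain_le; [now apply disk_below_S|now apply Hdom]|].
    apply Rmult_le_compat; [generalize (Rmax_l 1 (Cmod x)); lra|apply Cmod_ge_0| |lra].
    apply Rmax_lub; lra. }
  exists (2 * B / Cmod z0). intros x z Hx Hz.
  destruct (holomorphic_factor (Cmod z0) (fun z => P (schur_chain (S k) gamma x z))) as [G [HG EG]];
    [exact Pz0| |].
  { apply (holomorphic_on_P_chain _ P k gamma (fun _ => x)); auto; [apply holomorphic_on_const|].
    intros y Hy. apply Hdom; [exact Hx|now apply disc_0]. }
  rewrite schur_chain_at_0 in EG. rewrite (EG z Hz).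
  assert (HGB : Cmod (G z) * Cmod z0 <= 2 * B).
  { apply Cmod_factor_le; [exact HG| |exact Hz]. intros y Hy.
    replace (y * G y)%C with (P (schur_chain (S k) gamma x y) - P (gamma 0%nat))%C
      by (rewrite EG by exact Hy; ring).
    eapply Rle_trans; [apply Cmod_minus_le|].
    assert (Hy1 := Hbound x y Hx Hy). assert (Hc0 := Hbound x 0 Hx).
    rewrite Cmod_0, schur_chain_at_0 in Hc0.
    specialize (Hc0 Pz0). lra. }
  replace (P (gamma 0%nat) + z * G z - P (gamma 0%nat))%C with (z * G z)%C by ring.
  rewrite Cmod_mult, Rmult_comm. apply Rmult_le_compat_r; [apply Cmod_ge_0|].
  now apply Rle_div_r.
Qed.

Definition extremal_integrand (t : R) (x : C) : C :=
  (Cpowz (RtoC t * z0) (Z.of_nat J - 1) *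
    (P (schur_chain (S k) gamma x (RtoC t * z0)) - P (gamma 0%nat)) * z0)%C.

Lemma is_C_derive_extremal_integrand (t : R) (x : C) : 0 < t < 1 -> Cmod x < rho ->
  is_C_derive (extremal_integrand t) x (z0 ^ S (k + J) *
    (RtoC t ^ (k + J) * P_chain_slope P (S k) gamma x (RtoC t * z0)))%C.
Proof.
  intros Ht Hx. rewrite <- Cpowz_ray by (auto; lra).
  assert (Hz : chain_domain x (RtoC t * z0)%C).
  { apply chain_domain_of_disc; [exact Hx|]. apply disc_0, disc_0_ray; [exact Cmod_z0_lt_inv|lra]. }
  set (p := Cpowz (RtoC t * z0) (Z.of_nat J - 1)).
  apply (is_C_derive_ext (fun y => (p * z0) *
    (P (schur_chain (S k) gamma y (RtoC t * z0)) - P (gamma 0%nat)))%C).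
  { intro y. unfold extremal_integrand. fold p. ring. }
  apply (is_C_derive_eq _ _ (p * z0 *
    ((RtoC t * z0) ^ S k * P_chain_slope P (S k) gamma x (RtoC t * z0) - 0))%C); [ring|].
  apply is_C_derive_scal, is_C_derive_minus;
    [now apply is_C_derive_P_chain|apply is_C_derive_const].
Qed.

Lemma holomorphic_on_extremal_integrand (t : R) : 0 < t < 1 ->
  holomorphic_on (disc 0 rho) (extremal_integrand t).
Proof.
  intro Ht. eexists. intros x Hx. rewrite disc_0 in Hx. split.
  - now apply is_C_derive_extremal_integrand.
  - repeat (apply continuous_Cmult; [apply continuous_const|]).
    apply continuous_P_chain_slope; [exact HPh|exact Hg|].
    apply chain_domain_of_disc; [exact Hx|]. apply disc_0, disc_0_ray; [exact Cmod_z0_lt_inv|lra].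
Qed.

Lemma extremal_integrand_bounded : exists B, forall t x, 0 < t < 1 -> disc 0 rho x ->
  Cmod (extremal_integrand t x) <= B.
Proof.
  destruct P_chain_minus_at_0_bounded as [B HB]. exists (Rabs B). intros t x Ht Hx.
  rewrite disc_0 in Hx. assert (Pz0 := proj1 (Cmod_gt_0 z0) Nz0). assert (Hlt := Cmod_z0_lt_inv).
  assert (Mt : Cmod (RtoC t * z0) = t * Cmod z0) by (rewrite Cmod_mult, Cmod_R_pos; lra).
  assert (Nt := ray_neq_0 z0 t Nz0 (proj1 Ht)).
  assert (Hpow : Cmod (Cpowz (RtoC t * z0) (Z.of_nat J - 1)) * Cmod (RtoC t * z0) <= 1).
  { assert (E := Cpowz_Cpow (RtoC t * z0) J 0 Nt). apply (f_equal Cmod) in E.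
    rewrite Cpow_1_r, Cmod_mult, Cmod_pow in E. rewrite E.
    rewrite <- (pow1 (0 + J)). apply pow_incr. rewrite Mt. nra. }
  unfold extremal_integrand. rewrite !Cmod_mult.
  set (p := Cmod (Cpowz (RtoC t * z0) (Z.of_nat J - 1))) in *.
  assert (Hp0 : 0 <= p) by apply Cmod_ge_0.
  apply Rle_trans with (p * (Rabs B * Cmod (RtoC t * z0)) * 1).
  - apply Rmult_le_compat; [|lra| |nra].
    + apply Rmult_le_pos; [exact Hp0|apply Cmod_ge_0].
    + apply Rmult_le_compat_l; [exact Hp0|].
      eapply Rle_trans; [apply HB; [exact Hx|rewrite Mt; nra]|].
      apply Rmult_le_compat_r; [apply Cmod_ge_0|apply Rle_abs].
  - generalize (Rabs_pos B). nra.
Qed.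

Lemma extremal_int_holomorphic : holomorphic_on (disc 0 rho) extremal_int /\
  forall x, Cmod x < rho -> C_derive extremal_int x =
    (z0 ^ S (k + J) * ray_mean (k + J) (P_chain_slope P (S k) gamma x) z0)%C.
Proof.
  assert (HI : forall x, disc 0 rho x ->
    is_C_RInt (fun t => extremal_integrand t x) 0 1 (extremal_int x)).
  { intros x Hx. apply extremal_int_correct. now rewrite <- disc_0. }
  assert (HdI : forall x, disc 0 rho x ->
    is_C_RInt (fun t => C_derive (extremal_integrand t) x) 0 1
      (z0 ^ S (k + J) * ray_mean (k + J) (P_chain_slope P (S k) gamma x) z0)%C).
  { intros x Hx. rewrite disc_0 in Hx.
    generalize (is_C_RInt_scal (z0 ^ S (k + J)) _ _ _ _ (is_ray_mean_P_chain_slope (k + J) x Hx)).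
    apply is_C_RInt_ext; [lra|]. intros t Ht. symmetry.
    now apply is_C_derive_unique, is_C_derive_extremal_integrand. }
  destruct extremal_integrand_bounded as [B HB].
  assert (Hex : forall x, disc 0 rho x ->
    exists l : C, is_C_RInt (fun t => extremal_integrand t x) 0 1 l)
    by (intros x Hx; eexists; now apply HI).
  assert (Hdex : forall x, disc 0 rho x ->
    exists l : C, is_C_RInt (fun t => C_derive (extremal_integrand t) x) 0 1 l)
    by (intros x Hx; eexists; now apply HdI).
  assert (E : forall x, disc 0 rho x ->
    C_RInt (fun t => extremal_integrand t x) 0 1 = extremal_int x)
    by (intros x Hx; now apply is_C_RInt_unique, HI).
  split.
  - apply (holomorphic_on_ext _ _ _ (open_disc 0 rho) E).
    now apply (holomorphic_RInt_param extremal_integrand 0 1 0 rho B Rlt_0_1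
      holomorphic_on_extremal_integrand).
  - intros x Hx. apply (proj2 (disc_0 rho x)) in Hx. apply is_C_derive_unique.
    rewrite <- (is_C_RInt_unique _ _ _ _ (HdI x Hx)).
    apply (is_C_derive_ext_loc (fun x => C_RInt (fun t => extremal_integrand t x) 0 1)).
    + apply (filter_imp (disc 0 rho)); [exact E|now apply open_disc].
    + now apply (is_C_derive_RInt_param extremal_integrand 0 1 0 rho B Rlt_0_1
        holomorphic_on_extremal_integrand).
Qed.

Lemma P_chain_slope_disk (x : C) : Cmod x <= 1 ->
  holomorphic_on disk (P_chain_slope P (S k) gamma x) /\
  (forall z, disk z -> P_chain_slope P (S k) gamma x z <> 0) /\
  forall z, disk z ->
    0 < INR (S (k + J)) + Re (log_derive (P_chain_slope P (S k) gamma x) z).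
Proof.
  intro Hx. assert (Hd : forall z, disk z -> chain_domain x z)
    by (intros; now apply chain_domain_of_disk).
  split; [|split].
  - apply (holomorphic_on_subset (chain_domain x));
      [exact Hd|now apply holomorphic_on_P_chain_slope].
  - intros z Hz. now apply P_chain_slope_neq_0, Hd.
  - intros z Hz. generalize (P_chain_slope_convexity P k gamma HP Hg x z (Hd z Hz)).
    replace (S (k + J)) with (S k + J)%nat by lia. rewrite plus_INR. generalize (pos_INR J). lra.
Qed.

Lemma disk_z0 : disk z0.
Proof. unfold disk. generalize (Cmod_ge_0 z0). nra. Qed.

Lemma extremal_int_C_derive_neq_0 (x : C) : Cmod x <= 1 -> C_derive extremal_int x <> 0.
Proof.
  intro Hx. destruct (P_chain_slope_disk x Hx) as [HM [NM Hc]].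
  rewrite (proj2 extremal_int_holomorphic) by lra. apply Cmult_neq_0; [now apply Cpow_nz|].
  apply ray_mean_neq_0; [exact HM|exact NM|exact Hc|exact disk_z0].
Qed.

Lemma weighted_int_support_lt (x : C) (w g : C -> C) : Cmod x <= 1 -> x <> 0 ->
  holomorphic_on disk w -> (forall z, disk z -> Cmod (w z) <= Cmod x /\ w z <> x) ->
  (forall z, disk z -> g z = P (schur_chain (S k) gamma (w z) z)) ->
  Re ((weighted_int (Z.of_nat J - 1) g (g 0) z0 - extremal_int x) /
    (x * C_derive extremal_int x)) < 0.
Proof.
  intros Hx Nx Hw Hwx Eg. destruct (P_chain_slope_disk x Hx) as [HM [NM Hc]].
  destruct (P_chain_variation P k gamma HP Hg x w Hx Nx Hw Hwx) as [G [HG [EG Hneg]]].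
  assert (Hhol : forall v, holomorphic_on disk v -> (forall z, disk z -> Cmod (v z) <= 1) ->
    holomorphic_on disk (fun z => P (schur_chain (S k) gamma (v z) z))).
  { intros v Hv Hv1. apply holomorphic_on_P_chain; auto. intros z Hz.
    now apply chain_domain_of_disk; auto. }
  assert (Hfg : holomorphic_on disk g).
  { apply (holomorphic_on_ext _ (fun z => P (schur_chain (S k) gamma (w z) z)) _ open_disk);
      [intros z Hz; now rewrite Eg|]. apply Hhol; [exact Hw|]. intros z Hz. destruct (Hwx z Hz).
      lra. }
  assert (E : (weighted_int (Z.of_nat J - 1) g (g 0) z0 - extremal_int x)%C =
    (z0 ^ S (k + J) * ray_mean (k + J) (fun z => x * G z) z0)%C).
  { unfold extremal_int. rewrite <- (schur_chain_at_0 k gamma x).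
    apply (weighted_int_minus J k g (fun z => P (schur_chain (S k) gamma x z)));
      [exact Hfg| |now apply holomorphic_on_scal| |exact disk_z0|exact Nz0|].
    - apply (Hhol (fun _ => x)); [apply holomorphic_on_const|auto].
    - rewrite Eg by apply disk_0. now rewrite !schur_chain_at_0.
    - intros z Hz. rewrite Eg by exact Hz. now apply EG. }
  assert (Ex : ray_mean (k + J) (fun z => x * G z)%C z0 = (x * ray_mean (k + J) G z0)%C).
  { apply is_C_RInt_unique. apply holomorphic_on_disc_0_1 in HG.
    generalize (is_C_RInt_scal x _ _ _ _ (is_ray_mean 1 (k + J) G z0 HG disk_z0)).
    apply is_C_RInt_ext; [lra|]. intros t _. ring. }
  rewrite E, Ex, (proj2 extremal_int_holomorphic) by lra.
  assert (Hlt := ray_mean_ratio_Re_neg (k + J) _ HM NM Hc G z0 HG Hneg disk_z0).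
  assert (Nh := ray_mean_neq_0 (k + J) _ HM NM Hc z0 disk_z0).
  set (h := ray_mean (k + J) (P_chain_slope P (S k) gamma x) z0) in *.
  assert (Npow := Cpow_nz z0 (S (k + J)) Nz0). set (p := (z0 ^ S (k + J))%C) in *.
  replace (p * (x * ray_mean (k + J) G z0) / (x * (p * h)))%C with (ray_mean (k + J) G z0 / h)%C;
    [exact Hlt|]. field. auto.
Qed.

Lemma extremal_int_support_lt (x y : C) : Cmod x <= 1 -> x <> 0 -> Cmod y <= Cmod x -> y <> x ->
  Re ((extremal_int y - extremal_int x) / (x * C_derive extremal_int x)) < 0.
Proof.
  intros Hx Nx Hy Hyx.
  generalize (weighted_int_support_lt x (fun _ => y) (fun z => P (schur_chain (S k) gamma y z))
    Hx Nx (holomorphic_on_const disk y) (fun _ _ => conj Hy Hyx) (fun _ _ => eq_refl)).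
  cbv beta. now rewrite schur_chain_at_0.
Qed.

End ExtremalIntegral.

(** * The Schur algorithm *)

Definition conv_tail (b a : nat -> C) (p : nat) : C :=
  sum_n_m (fun l => b (p - l)%nat * a l)%C 1 p.

Lemma conv_tail_0 (b a : nat -> C) : conv_tail b a 0 = 0.
Proof. unfold conv_tail. now rewrite sum_n_m_zero by lia. Qed.

Lemma conv_tail_S (b a : nat -> C) (p : nat) :
  conv_tail b a (S p) = (b p * a 1%nat + conv_tail b (fun k => a (S k)) p)%C.
Proof.
  unfold conv_tail. rewrite sum_Sn_m by lia. replace (S p - 1)%nat with p by lia.
  now rewrite <- sum_n_m_S.
Qed.

Lemma conv_tail_ext (a a' b b' : nat -> C) (p : nat) : (forall k, (k < p)%nat -> b k = b' k) ->
  (forall k, (k <= p)%nat -> a k = a' k) -> conv_tail b a p = conv_tail b' a' p.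
Proof.
  intros Hb Ha. apply sum_n_m_ext_loc. intros l Hl. now rewrite Hb, Ha by lia.
Qed.

Lemma pseries_on_mult_coef (R0 : R) (b : nat -> C) (h : C -> C) (k : nat) : 0 < R0 ->
  pseries_on R0 b h -> forall a f e, pseries_on R0 a f ->
  pseries_on R0 e (fun z => f z * h z)%C -> e k = (b k * a 0%nat + conv_tail b a k)%C.
Proof.
  intros HR Hh. induction k as [|k IHk]; intros a f e Hf He;
    destruct (pseries_on_factor R0 a f HR Hf) as [f1 [Hf1 E1]].
  - rewrite conv_tail_0, <- (pseries_on_at_0 R0 e _ HR He), E1, <- (pseries_on_at_0 R0 b h HR Hh)
      by (rewrite Cmod_0; exact HR). ring.
  - destruct (holomorphic_pseries R0 (fun z => f1 z * h z)%C HR) as [e1 He1].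
    { apply holomorphic_on_mult; eapply pseries_on_holomorphic; eassumption. }
    assert (E : e (S k) = (a 0%nat * b (S k) + e1 k)%C).
    { apply (pseries_on_coef_unique R0 e
        (fun k => a 0%nat * b k + match k with O => RtoC 0 | S k => e1 k end)%C _ HR He)
          with (k := S k).
      intros z Hz. rewrite E1 by exact Hz.
      replace ((a 0%nat + z * f1 z) * h z)%C with (a 0%nat * h z + z * (f1 z * h z))%C by ring.
      apply is_C_pseries_plus;
        [now apply is_C_pseries_scal, Hh|now apply is_C_pseries_incr_1, He1]. }
    rewrite E, (IHk _ f1 e1 Hf1 He1), conv_tail_S. ring.
Qed.

(* The recursion for [c^(i+1)], with [g = gamma_i], cleared of its denominator. *)
Definition schur_rel (g : C) (a b : nat -> C) (p : nat) : Prop :=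
  (b p * RtoC (1 - Cmod g ^ 2))%C = (a (S p) + Cconj g * conv_tail b a p)%C.

Lemma schur_rel_of_sigma (a b : nat -> C) (f h : C -> C) (p : nat) : pseries_on 1 a f ->
  pseries_on 1 b h -> Cmod (a 0%nat) < 1 -> (forall z, disk z -> Cmod (h z) <= 1) ->
  (forall z, disk z -> f z = sigma (a 0%nat) (z * h z)) -> schur_rel (a 0%nat) a b p.
Proof.
  intros Hf Hh Ha Bh E. set (g := a 0%nat) in *.
  destruct (holomorphic_pseries 1 (fun z => f z * h z)%C Rlt_0_1) as [e He].
  { apply holomorphic_on_mult; eapply pseries_on_holomorphic; eassumption. }
  assert (Ee := pseries_on_mult_coef 1 b h p Rlt_0_1 Hh a f e Hf He). fold g in Ee.
  assert (Ea : a (S p) = (b p - Cconj g * e p)%C).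
  { apply (pseries_on_coef_unique 1 a
      (fun k => match k with O => g | S k => (b k - Cconj g * e k)%C end) f Rlt_0_1 Hf)
        with (k := S p).
    intros z Hz. replace (f z) with (g + z * (h z - Cconj g * (f z * h z)))%C.
    - apply (is_C_pseries_cons g (fun k => b k - Cconj g * e k)%C).
      apply is_C_pseries_minus; [now apply Hh|now apply is_C_pseries_scal, He].
    - assert (Hd : (1 + Cconj g * (z * h z))%C <> 0).
      { apply sigma_denom_neq_0; [exact Ha|]. left. apply Cmod_mult_lt_1; [exact Hz|now apply Bh]. }
      rewrite (E z Hz). unfold sigma. field. exact Hd. }
  unfold schur_rel. rewrite Ea, Ee, <- one_minus_Cmult_Cconj. ring.
Qed.

Lemma schur_rel_inj_r (g : C) (n : nat) (a a' b b' : nat -> C) : Cmod g < 1 ->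
  (forall p, (p <= n)%nat -> schur_rel g a b p) ->
  (forall p, (p <= n)%nat -> schur_rel g a' b' p) ->
  (forall k, (k <= S n)%nat -> a k = a' k) -> forall p, (p <= n)%nat -> b p = b' p.
Proof.
  intros Hg Hb Hb' Ha p. induction p as [p IHp] using lt_wf_ind. intro Hp.
  assert (Hn : RtoC (1 - Cmod g ^ 2) <> 0)
    by (apply RtoC_neq_0; generalize (one_minus_Cmod_sqr_pos g Hg); lra).
  apply (Cmult_eq_reg_l _ _ _ Hn). rewrite !(Cmult_comm (RtoC _)), (Hb p Hp), (Hb' p Hp), Ha by lia.
  do 2 f_equal. apply conv_tail_ext; intros k Hk; [apply IHp; lia|apply Ha; lia].
Qed.

Lemma schur_rel_inj_l (g : C) (n : nat) (a a' b b' : nat -> C) : a 0%nat = a' 0%nat ->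
  (forall p, (p <= n)%nat -> schur_rel g a b p) ->
  (forall p, (p <= n)%nat -> schur_rel g a' b' p) ->
  (forall p, (p <= n)%nat -> b p = b' p) -> forall k, (k <= S n)%nat -> a k = a' k.
Proof.
  intros Haa' Ha Ha' Hb k. induction k as [k IHk] using lt_wf_ind. intro Hk.
  destruct k as [|p]; [exact Haa'|].
  assert (E : (a (S p) + Cconj g * conv_tail b a p)%C = (a' (S p) + Cconj g * conv_tail b' a' p)%C).
  { rewrite <- (Ha p), <- (Ha' p), Hb by lia. reflexivity. }
  rewrite (conv_tail_ext a a' b b') in E;
    [|intros q Hq; apply Hb; lia|intros q Hq; apply IHk; lia].
  apply (f_equal (fun x => x - Cconj g * conv_tail b' a' p)%C) in E.
  replace (a (S p)) with (a (S p) + Cconj g * conv_tail b' a' p - Cconj g * conv_tail b' a' p)%C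
    by ring.
  rewrite E. ring.
Qed.

Lemma taylor_on_disk_holomorphic (n : nat) (c : nat -> C) (f : C -> C) : taylor_on_disk n c f ->
  holomorphic_on disk f /\ f 0 = c 0%nat.
Proof.
  intros [a [Ea Ha]]. split.
  - apply holomorphic_on_disc_0_1. now apply (pseries_on_holomorphic 1 a).
  - rewrite <- Ea by lia. now apply (pseries_on_at_0 1); [lra|].
Qed.

Lemma taylor_on_disk_sigma (n : nat) (g : C) (c c' : nat -> C) (f h : C -> C) : Cmod g < 1 ->
  c 0%nat = g -> (forall p, (p <= n)%nat -> schur_rel g c c' p) ->
  holomorphic_on disk h -> (forall z, disk z -> Cmod (h z) <= 1) ->
  (forall z, disk z -> f z = sigma g (z * h z)) ->
  taylor_on_disk (S n) c f <-> taylor_on_disk n c' h.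
Proof.
  intros Hg Hc0 Hcc Hh Bh E.
  assert (Bu : forall z, disk z -> Cmod (z * h z) <= 1)
    by (intros z Hz; left; apply Cmod_mult_lt_1; auto).
  assert (Hf : holomorphic_on disk f).
  { apply (holomorphic_on_ext disk (fun z => sigma g (z * h z)%C) _ open_disk);
      [intros z Hz; now rewrite E|].
    apply (holomorphic_on_sigma_comp disk g (fun z => z * h z)%C); [|exact Hg|exact Bu].
    apply holomorphic_on_mult; [apply holomorphic_on_id|exact Hh]. }
  destruct (holomorphic_pseries 1 f Rlt_0_1 (proj2 (holomorphic_on_disc_0_1 f) Hf)) as [a Ha].
  destruct (holomorphic_pseries 1 h Rlt_0_1 (proj2 (holomorphic_on_disc_0_1 h) Hh)) as [b Hb].
  assert (Ea0 : a 0%nat = g).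
  { rewrite <- (pseries_on_at_0 1 a f Rlt_0_1 Ha), (E 0 disk_0), Cmult_0_l. apply sigma_at_0. }
  assert (Hab : forall p, (p <= n)%nat -> schur_rel g a b p).
  { intros p _. rewrite <- Ea0 in E, Hg |- *. now apply (schur_rel_of_sigma a b f h). }
  split; intros [a' [Ea' Ha']].
  - exists b. split; [|exact Hb]. apply (schur_rel_inj_r g n a c b c' Hg Hab Hcc).
    intros k Hk. rewrite <- Ea' by exact Hk. now apply (pseries_on_coef_unique 1 a a' f Rlt_0_1).
  - exists a. split; [|exact Ha]. apply (schur_rel_inj_l g n a c b c');
      [congruence|exact Hab|exact Hcc|].
    intros k Hk. rewrite <- Ea' by exact Hk. now apply (pseries_on_coef_unique 1 b a' h Rlt_0_1).
Qed.

Lemma schur_parameter_at_0 (n : nat) (c gamma : nat -> C) : schur_parameter n c gamma ->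
  c 0%nat = gamma 0%nat.
Proof. intros [d [Hc [Hd _]]]. now rewrite Hd, Hc by lia. Qed.

Lemma schur_parameter_tail (n : nat) (c gamma : nat -> C) : schur_parameter (S n) c gamma ->
  Cmod (gamma 0%nat) < 1 -> exists c', schur_parameter n c' (fun i => gamma (S i)) /\
    forall p, (p <= n)%nat -> schur_rel (gamma 0%nat) c c' p.
Proof.
  intros [d [Hc [Hd [Hd0 HdS]]]] Hg.
  assert (Hn : RtoC (1 - Cmod (gamma 0%nat) ^ 2) <> 0)
    by (apply RtoC_neq_0; generalize (one_minus_Cmod_sqr_pos _ Hg); lra).
  exists (d 1%nat). split.
  - exists (fun i => d (S i)). split; [reflexivity|]. split; [intros i Hi; apply Hd; lia|].
    split; [intros i Hi; apply Hd0; lia|]. intros i p Hi Hp. apply HdS; lia.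
  - intros p Hp. unfold schur_rel. destruct p as [|p].
    + rewrite conv_tail_0, Hd0, Hc by lia. field. exact Hn.
    + rewrite (conv_tail_ext c (d 0%nat) _ (d 1%nat)) by (intros; auto; now rewrite Hc by lia).
      rewrite HdS, Hc by lia. unfold conv_tail. field. exact Hn.
Qed.

Lemma Schur_function_step (f : C -> C) (rho : R) : holomorphic_on disk f ->
  (forall z, disk z -> Cmod (f z) <= rho) -> rho <= 1 -> Cmod (f 0) < 1 ->
  exists h rho', holomorphic_on disk h /\ (forall z, disk z -> Cmod (h z) <= rho') /\ rho' <= 1 /\
    (rho < 1 -> rho' < 1) /\ forall z, disk z -> f z = sigma (f 0) (z * h z).
Proof.
  intros Hf Bf Hrho Hf0. assert (Hn : Cmod (- f 0) < 1) by now rewrite Cmod_opp.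
  assert (Bf1 : forall z, disk z -> Cmod (f z) <= 1) by (intros z Hz; specialize (Bf z Hz); lra).
  destruct (Cmod_sigma_le_uniform (- f 0) rho Hn) as [rho' [Hr' [Hlt Bs]]].
  { split; [|exact Hrho]. eapply Rle_trans; [apply Cmod_ge_0|apply (Bf 0 disk_0)]. }
  destruct (Schwarz_lemma (fun z => sigma (- f 0) (f z)) rho') as [h [Hh [E Bh]]].
  - now apply holomorphic_on_sigma_comp.
  - apply sigma_opp_self.
  - intros z Hz. now apply Bs, Bf.
  - exists h, rho'. split; [exact Hh|]. split; [exact Bh|]. split; [apply Hr'|].
    split; [exact Hlt|].
    intros z Hz. rewrite <- E by exact Hz. now rewrite sigma_sigma_opp by auto.
Qed.

Lemma schur_parameter_disk_below (n : nat) (c gamma : nat -> C) (f : C -> C) (rho : R) :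
  schur_parameter n c gamma -> taylor_on_disk n c f ->
  (forall z, disk z -> Cmod (f z) <= rho) -> rho < 1 -> disk_below (S n) gamma.
Proof.
  revert c gamma f rho. induction n as [|n IHn]; intros c gamma f rho Hs Ht Bf Hrho;
    destruct (taylor_on_disk_holomorphic _ _ _ Ht) as [Hf Ef0];
    assert (Ec0 := schur_parameter_at_0 _ _ _ Hs); rewrite Ec0 in Ef0;
    assert (Hg : Cmod (gamma 0%nat) < 1) by (rewrite <- Ef0; specialize (Bf 0 disk_0); lra).
  - intros i Hi. now replace i with 0%nat by lia.
  - destruct (schur_parameter_tail _ _ _ Hs Hg) as [c' [Hs' Hcc]].
    destruct (Schur_function_step f rho Hf Bf) as [h [rho' [Hh [Bh [Hr' [Hlt E]]]]]];
      [lra|now rewrite Ef0|]. rewrite Ef0 in E.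
    assert (Hg' : disk_below (S n) (fun i => gamma (S i))).
    { apply (IHn c' _ h rho'); auto. apply (taylor_on_disk_sigma n (gamma 0%nat) c c' f h); auto.
      intros z Hz. specialize (Bh z Hz). lra. }
    intros [|i] Hi; [exact Hg|]. apply Hg'. lia.
Qed.

Lemma schur_chain_representation (n : nat) (c gamma : nat -> C) (f : C -> C) :
  schur_parameter n c gamma -> disk_below (S n) gamma -> taylor_on_disk n c f ->
  (forall z, disk z -> Cmod (f z) <= 1) ->
  exists w, holomorphic_on disk w /\ (forall z, disk z -> Cmod (w z) <= 1) /\
    forall z, disk z -> f z = schur_chain (S n) gamma (w z) z.
Proof.
  revert c gamma f. induction n as [|n IHn]; intros c gamma f Hs Hg Ht Bf;
    destruct (taylor_on_disk_holomorphic _ _ _ Ht) as [Hf Ef0];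
    assert (Ec0 := schur_parameter_at_0 _ _ _ Hs); rewrite Ec0 in Ef0;
    assert (Hg0 := disk_below_0 _ _ Hg);
    destruct (Schur_function_step f 1 Hf Bf (Rle_refl 1)) as [h [rho [Hh [Bh [Hr [_ E]]]]]];
    try (now rewrite Ef0); rewrite Ef0 in E;
    assert (Bh1 : forall z, disk z -> Cmod (h z) <= 1) by (intros z Hz; specialize (Bh z Hz); lra).
  - now exists h.
  - destruct (schur_parameter_tail _ _ _ Hs Hg0) as [c' [Hs' Hcc]].
    destruct (IHn c' (fun i => gamma (S i)) h Hs' (disk_below_S _ _ Hg)) as [w [Hw [Bw Ew]]].
    + now apply (taylor_on_disk_sigma n (gamma 0%nat) c c' f h).
    + exact Bh1.
    + exists w. split; [exact Hw|]. split; [exact Bw|]. intros z Hz.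
      rewrite E, Ew by exact Hz. reflexivity.
Qed.

Lemma schur_chain_taylor (n : nat) (c gamma : nat -> C) (x : C) : schur_parameter n c gamma ->
  disk_below (S n) gamma -> Cmod x <= 1 -> taylor_on_disk n c (schur_chain (S n) gamma x).
Proof.
  intros Hs Hg Hx. revert c gamma Hs Hg.
  assert (Hhol : forall k gamma, disk_below k gamma -> holomorphic_on disk (schur_chain k gamma x)).
  { intros k gamma Hg. apply (holomorphic_on_schur_chain _ _ _ (fun _ => x)); auto.
    - apply holomorphic_on_const.
    - intros z Hz. now apply chain_domain_of_disk. }
  induction n as [|n IHn]; intros c gamma Hs Hg; assert (Ec0 := schur_parameter_at_0 _ _ _ Hs).
  - destruct (holomorphic_pseries 1 (schur_chain 1 gamma x) Rlt_0_1) as [a Ha].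
    { now apply holomorphic_on_disc_0_1, Hhol. }
    exists a. split; [|exact Ha]. intros k Hk. replace k with 0%nat by lia.
    rewrite Ec0, <- (pseries_on_at_0 1 a _ Rlt_0_1 Ha). apply schur_chain_at_0.
  - assert (Hg0 := disk_below_0 _ _ Hg). assert (Hg' := disk_below_S _ _ Hg).
    destruct (schur_parameter_tail _ _ _ Hs Hg0) as [c' [Hs' Hcc]].
    apply (taylor_on_disk_sigma n (gamma 0%nat) c c' _
      (schur_chain (S n) (fun i => gamma (S i)) x)); auto.
    intros z Hz. now apply Cmod_schur_chain_le_1.
Qed.

Lemma Cmod_bounded_upto (n : nat) (c : nat -> C) :
  exists B, 0 < B /\ forall k, (k <= n)%nat -> Cmod (c k) < B.
Proof.
  induction n as [|n [B [HB IHn]]].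
  - exists (Cmod (c 0%nat) + 1). split; [generalize (Cmod_ge_0 (c 0%nat)); lra|].
    intros k Hk. replace k with 0%nat by lia. lra.
  - exists (B + Cmod (c (S n)) + 1). generalize (Cmod_ge_0 (c (S n))). intro Hc0. split; [lra|].
    intros k Hk. destruct (Nat.eq_dec k (S n)) as [->|Hne]; [lra|]. specialize (IHn k ltac:(lia)).
    lra.
Qed.

(* A slight dilation [(1 + eta) c] of an interior point stays in the coefficient body. *)
Lemma Int_coeff_body_strict (n : nat) (c : nat -> C) : Int_coeff_body n c ->
  exists f rho, taylor_on_disk n c f /\ (forall z, disk z -> Cmod (f z) <= rho) /\ rho < 1.
Proof.
  intros [delta [Hd H]]. destruct (Cmod_bounded_upto n c) as [B [HB Bc]].
  set (eta := delta / B). assert (He : 0 < eta) by now apply Rdiv_lt_0_compat.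
  assert (Hn : RtoC (1 + eta) <> 0) by (apply RtoC_neq_0; lra).
  destruct (H (fun k => RtoC (1 + eta) * c k)%C) as [w [[_ Bw] [a [Ea Ha]]]].
  { intros k Hk. replace (RtoC (1 + eta) * c k - c k)%C with (RtoC eta * c k)%C
      by (rewrite RtoC_plus; ring).
    rewrite Cmod_mult, Cmod_R_pos by lra. replace delta with (eta * B) by (unfold eta; field; lra).
    apply Rmult_lt_compat_l; auto. }
  exists (fun z => / RtoC (1 + eta) * w z)%C, (/ (1 + eta)). split; [|split].
  - exists (fun k => / RtoC (1 + eta) * a k)%C. split.
    + intros k Hk. rewrite Ea by exact Hk. field. exact Hn.
    + intros z Hz. apply is_C_pseries_scal. exact (Ha z Hz).
  - intros z Hz. rewrite Cmod_mult, Cmod_inv, Cmod_R_pos by (auto; lra). specialize (Bw z Hz).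
    generalize (Rinv_0_lt_compat (1 + eta) ltac:(lra)). nra.
  - rewrite <- Rinv_1. apply Rinv_lt_contravar; lra.
Qed.

(** * Convex univalence from supporting half-planes *)

Lemma Cmod_closest_boundary (f : C -> C) (w e l : C) : is_C_derive f e l -> e <> 0 -> l <> 0 ->
  (forall x, Cmod x <= Cmod e -> Cmod (f e - w) <= Cmod (f x - w)) -> f e <> w ->
  0 < Re ((w - f e) / (e * l)).
Proof.
  intros Hf Ne Nl Hmin Hne. set (d := (w - f e)%C).
  assert (Nd : d <> 0) by (apply Cminus_eq_contra; congruence). assert (Ncd := Cconj_neq_0 d Nd).
  destruct (real_nonneg_of_right_half_plane (Cconj d * l * e)) as [Eq Hq].
  { intros k Hk. apply Rnot_lt_le. intro Hneg.
    assert (Hlt : at_right 0 (fun t => Cmod (f (e + RtoC t * - (e * k))%C - w) < Cmod (f e - w))).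
    { apply (at_right_Cmod_minus_lt f e l); [exact Hf|]. fold d.
      replace (Cconj d * (l * - (e * k)))%C with (- (Cconj d * l * e * k))%C by ring.
      rewrite re_opp. lra. }
    destruct (filter_ex _ (filter_and _ _ Hlt (at_right_Cmod_inward e k Ne Hk)))
      as [t [Hcloser Hinward]].
    specialize (Hmin _ (Rlt_le _ _ Hinward)). lra. }
  assert (Nq : (Cconj d * l * e)%C <> 0) by now repeat apply Cmult_neq_0.
  assert (Pq : 0 < Re (Cconj d * l * e)).
  { destruct Hq as [|Eq0]; [assumption|]. exfalso. apply Nq. now rewrite Eq, <- Eq0. }
  replace (d / (e * l))%C with (RtoC (Cmod d ^ 2 / Re (Cconj d * l * e))).
  - rewrite re_RtoC. apply Rdiv_lt_0_compat; [now apply pow_lt, Cmod_gt_0|exact Pq].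
  - rewrite RtoC_div, <- Eq, <- Cmult_Cconj by lra. field. auto.
Qed.

Lemma ex_preimage_of_tangent_half_planes (f : C -> C) (r : R) (w : C) : 0 < r ->
  (forall x, Cmod x <= r -> is_C_derive f x (C_derive f x) /\ C_derive f x <> 0) ->
  (forall x, Cmod x = r -> Re ((w - f x) / (x * C_derive f x)) <= 0) ->
  exists x, Cmod x <= r /\ f x = w.
Proof.
  intros Hr Hf Hw.
  destruct (Cmod_argmin_closed_disc 0 r (fun x => f x - w)%C) as [e [He Hmin]]; [lra| |].
  { intros x Hx. rewrite Cminus_0_r in Hx. apply continuous_Cminus; [|apply continuous_const].
    eapply is_C_derive_continuous. now apply Hf. }
  rewrite Cminus_0_r in He. exists e. split; [exact He|]. apply NNPP. intro Hne.
  destruct (Hf e He) as [De Nl].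
  assert (Hmin' : forall x, Cmod x <= r -> Cmod (f e - w) <= Cmod (f x - w))
    by (intros x Hx; apply Hmin; now rewrite Cminus_0_r).
  destruct He as [Hlt|Heq].
  - apply Nl. apply (local_min_Cmod_C_derive_0 f e _ w De); [|exact Hne].
    apply (filter_imp (fun x => Cmod x < r)); [intros x Hx; apply Hmin'; now left|].
    apply continuous_lt; [apply continuous_Cmod, continuous_id|exact Hlt].
  - specialize (Hw e Heq). rewrite <- Heq in Hmin'.
    assert (Ne : e <> 0) by (apply Cmod_gt_0; lra).
    generalize (Cmod_closest_boundary f w e _ De Ne Nl Hmin' Hne). lra.
Qed.

Section StrictSupport.

Variables (f : C -> C) (R0 : R).
Hypotheses (HR0 : 1 < R0) (Hf : holomorphic_on (disc 0 R0) f)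
  (Hdf : forall x, Cmod x <= 1 -> C_derive f x <> 0)
  (Hsupport : forall x y, Cmod x <= 1 -> x <> 0 -> Cmod y <= Cmod x -> y <> x ->
    Re ((f y - f x) / (x * C_derive f x)) < 0).

Lemma image_cdisk_of_half_planes (w : C) :
  (forall x, Cmod x = 1 -> Re ((w - f x) / (x * C_derive f x)) <= 0) -> image f cdisk w.
Proof.
  apply (ex_preimage_of_tangent_half_planes f 1); [lra|]. intros x Hx. split; [|now apply Hdf].
  apply (holomorphic_on_derive (disc 0 R0)); [exact Hf|]. apply disc_0. lra.
Qed.

Lemma image_disk_of_half_planes (w : C) :
  (forall x, Cmod x = 1 -> Re ((w - f x) / (x * C_derive f x)) < 0) -> image f disk w.
Proof.
  intro Hw. destruct (image_cdisk_of_half_planes w) as [x [[Hx|Hx] E]].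
  - intros x Hx. left. now apply Hw.
  - now exists x.
  - specialize (Hw x Hx). rewrite <- E, Re_Cminus_diag_div in Hw. lra.
Qed.

Lemma injective_of_strict_support : injective_on cdisk f.
Proof.
  assert (Hle : forall x y, Cmod x <= 1 -> Cmod y <= Cmod x -> f x = f y -> x = y).
  { intros x y Hx Hy E. apply NNPP. intro Hne. assert (Hx0 : x <> 0).
    { intros ->. apply Hne. symmetry. apply Cmod_eq_0. rewrite Cmod_0 in Hy.
      generalize (Cmod_ge_0 y). lra. }
    generalize (Hsupport x y Hx Hx0 Hy (not_eq_sym Hne)). rewrite E, Re_Cminus_diag_div. lra. }
  intros x y Hx Hy E. destruct (Rle_lt_dec (Cmod y) (Cmod x)) as [H|H].
  - now apply Hle.
  - symmetry. apply Hle; [exact Hy|lra|now symmetry].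
Qed.

Lemma convex_image_of_strict_support : convex_set (image f disk).
Proof.
  intros z w t [y1 [Hy1 <-]] [y2 [Hy2 <-]] Ht. apply image_disk_of_half_planes. intros x Hx.
  assert (Nx : x <> 0) by (apply Cmod_gt_0; lra). assert (Ndf := Hdf x (Req_le _ _ Hx)).
  assert (Hy : forall y, disk y -> Re ((f y - f x) / (x * C_derive f x)) < 0).
  { intros y Hy. unfold disk in Hy. apply Hsupport; [lra|exact Nx|lra|]. intros ->. lra. }
  replace ((RtoC (1 - t) * f y1 + RtoC t * f y2 - f x) / (x * C_derive f x))%C with
    (RtoC (1 - t) * ((f y1 - f x) / (x * C_derive f x)) +
      RtoC t * ((f y2 - f x) / (x * C_derive f x)))%C by (rewrite RtoC_minus; field; auto).
  rewrite re_plus, !re_scal_l. generalize (Hy y1 Hy1) (Hy y2 Hy2). nra.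
Qed.

Lemma convex_univalent_of_strict_support : convex_univalent f.
Proof.
  assert (Hsub : forall x, cdisk x -> disc 0 R0 x)
    by (intros x Hx; apply disc_0; unfold cdisk in Hx; lra).
  split; [|split; [exact injective_of_strict_support|split; [|split]]].
  - intros x Hx. apply (proj2 (analytic_on_holomorphic _ _ (open_disc 0 R0)) Hf). now apply Hsub.
  - apply univalent_open_image. split.
    + apply (holomorphic_on_subset (disc 0 R0)); [|exact Hf]. intros x Hx. apply Hsub. now left.
    + intros x y Hx Hy. now apply injective_of_strict_support; left.
  - exists (f 0), (RtoC 0). split; [apply disk_0|reflexivity].
  - exact convex_image_of_strict_support.
Qed.

End StrictSupport.

(** * The class [F] and the variability region *)

Lemma conformal_convex_map (P : C -> C) (Omega : C -> Prop) : conformal_map P Omega ->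
  convex_domain Omega -> convex_map P.
Proof.
  intros [Ha [Hinj Him]] [_ [_ Hcv]].
  split; [split; [now apply analytic_on_holomorphic; [apply open_disk|]|exact Hinj]|].
  intros x y t Hx Hy Ht. apply Him, Hcv; [now apply Him|now apply Him|exact Ht].
Qed.

Section VariabilityRegion.

Variables (Omega : C -> Prop) (P : C -> C) (n J : nat) (c gamma : nat -> C) (z0 : C).
Hypotheses (HPOmega : conformal_map P Omega) (HP : convex_map P)
  (Hs : schur_parameter n c gamma) (Hg : disk_below (S n) gamma)
  (Hz0 : disk z0) (Nz0 : z0 <> 0).

Lemma F_class_representation (g : C -> C) : F_class Omega P n c g ->
  exists w, holomorphic_on disk w /\ (forall z, disk z -> Cmod (w z) <= 1) /\
    forall z, disk z -> g z = P (schur_chain (S n) gamma (w z) z).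
Proof.
  intros [_ [HgO Ht]].
  assert (Hinv : forall z, disk z -> disk (disk_inv P (g z)) /\ P (disk_inv P (g z)) = g z).
  { intros z Hz. apply disk_inv_spec. now apply HPOmega, HgO. }
  destruct (schur_chain_representation n c gamma _ Hs Hg Ht) as [w [Hw [Bw Ew]]].
  { intros z Hz. left. now apply Hinv. }
  exists w. split; [exact Hw|]. split; [exact Bw|]. intros z Hz. rewrite <- Ew by exact Hz.
  symmetry. now apply Hinv.
Qed.

Lemma F_class_P_chain (x : C) : Cmod x <= 1 ->
  F_class Omega P n c (fun z => P (schur_chain (S n) gamma x z)).
Proof.
  intro Hx. assert (Hd : forall z, disk z -> chain_domain x z)
    by (intros z Hz; now apply chain_domain_of_disk).
  assert (Hchain : forall z, disk z -> disk (schur_chain (S n) gamma x z))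
    by (intros z Hz; now apply disk_schur_chain_S, Hd).
  split; [|split].
  - apply analytic_on_holomorphic; [apply open_disk|].
    apply (holomorphic_on_P_chain disk P n gamma (fun _ => x)); auto;
      [apply HP|apply holomorphic_on_const].
  - intros z Hz. apply HPOmega. exists (schur_chain (S n) gamma x z). auto.
  - destruct (schur_chain_taylor n c gamma x Hs Hg Hx) as [a [Ea Ha]]. exists a. split; [exact Ea|].
    intros z Hz. rewrite disk_inv_image; [now apply Ha|apply HP|now apply Hchain].
Qed.

Lemma weighted_int_ext_disk (j : Z) (g h : C -> C) : (forall z, disk z -> g z = h z) ->
  weighted_int j g (g 0) z0 = weighted_int j h (h 0) z0.
Proof.
  intro E. rewrite (E 0 disk_0). apply weighted_int_ext. intros t Ht.
  apply E, disc_0_1, disc_0_ray; [exact Hz0|lra].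
Qed.

Notation extremal := (extremal_int P n gamma J z0).
Notation weighted := (fun g => weighted_int (Z.of_nat J - 1) g (g (RtoC 0)) z0).

Lemma weighted_int_P_chain (g : C -> C) (x : C) :
  (forall z, disk z -> g z = P (schur_chain (S n) gamma x z)) -> weighted g = extremal x.
Proof.
  intro E. cbv beta. rewrite (weighted_int_ext_disk _ g _ E). unfold extremal_int.
  now rewrite schur_chain_at_0.
Qed.

Lemma extends_beyond_disk : 1 < 2 / (1 + Cmod z0) /\ 2 / (1 + Cmod z0) * Cmod z0 < 1.
Proof.
  unfold disk in Hz0. generalize (Cmod_ge_0 z0). intro H0. split.
  - apply Rlt_div_r; lra.
  - replace (2 / (1 + Cmod z0) * Cmod z0) with (2 * Cmod z0 / (1 + Cmod z0)) by (field; lra).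
    apply Rlt_div_l; lra.
Qed.

Lemma F_class_extremal_or_support_lt (g : C -> C) (x : C) : F_class Omega P n c g -> Cmod x = 1 ->
  (forall z, disk z -> g z = P (schur_chain (S n) gamma x z)) \/
  Re ((weighted g - extremal x) / (x * C_derive extremal x)) < 0.
Proof.
  intros HgF Hx. destruct (F_class_representation g HgF) as [w [Hw [Bw Ew]]].
  assert (Nx : x <> 0) by (apply Cmod_gt_0; lra). destruct extends_beyond_disk as [Hrho Hrz0].
  destruct (classic (forall z, disk z -> w z = x)) as [Hwx|Hwx].
  { left. intros z Hz. now rewrite Ew, Hwx. }
  right. apply (weighted_int_support_lt P n gamma J z0 _ HP Hg Nz0 Hrho Hrz0 x w g); auto; [lra|].
  intros z Hz. split; [rewrite Hx; auto|]. intro E. apply Hwx.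
  destruct (Bw 0 disk_0) as [Hlt|Heq].
  - generalize (Cmod_lt_1_of_center w z Hw Bw Hlt Hz). rewrite E. lra.
  - intros y Hy. rewrite (maximum_modulus_const w y Hw Bw Heq Hy), <- E.
    symmetry. now apply maximum_modulus_const.
Qed.

Lemma extremal_int_convex_univalent : convex_univalent extremal.
Proof.
  destruct extends_beyond_disk as [Hrho Hrz0].
  apply (convex_univalent_of_strict_support _ (2 / (1 + Cmod z0)) Hrho).
  - now apply extremal_int_holomorphic.
  - intros x Hx. now apply (extremal_int_C_derive_neq_0 P n gamma J z0 (2 / (1 + Cmod z0))).
  - intros x y. now apply (extremal_int_support_lt P n gamma J z0 (2 / (1 + Cmod z0))).
Qed.

Lemma V_region_extremal_int (w : C) :
  V_region Omega P n c (Z.of_nat J - 1) z0 w <-> image extremal cdisk w.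
Proof.
  destruct extends_beyond_disk as [Hrho Hrz0]. split.
  - intros [g [HgF ->]]. apply (image_cdisk_of_half_planes extremal (2 / (1 + Cmod z0)) Hrho).
    + now apply extremal_int_holomorphic.
    + intros x Hx. now apply (extremal_int_C_derive_neq_0 P n gamma J z0 (2 / (1 + Cmod z0))).
    + intros x Hx. destruct (F_class_extremal_or_support_lt g x HgF Hx) as [E|Hlt]; [|now left].
      rewrite (weighted_int_P_chain g x E), Re_Cminus_diag_div. lra.
  - intros [x [Hx <-]]. exists (fun z => P (schur_chain (S n) gamma x z)).
    split; [now apply F_class_P_chain|]. symmetry. now apply weighted_int_P_chain.
Qed.

Lemma weighted_int_extremal_iff (g : C -> C) (x : C) : F_class Omega P n c g -> Cmod x = 1 ->
  weighted g = extremal x <-> forall z, disk z -> g z = P (schur_chain (S n) gamma x z).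
Proof.
  intros HgF Hx. split; [|apply weighted_int_P_chain]. intro E.
  destruct (F_class_extremal_or_support_lt g x HgF Hx) as [Eg|Hlt]; [exact Eg|].
  rewrite E, Re_Cminus_diag_div in Hlt. lra.
Qed.

Lemma Q_extremal_int (x : C) : Q P n c gamma (Z.of_nat J - 1) z0 x = extremal x.
Proof.
  unfold Q, extremal_int. rewrite (schur_parameter_at_0 n c gamma Hs). apply weighted_int_ext.
  intros t _. now rewrite omega_schur_chain.
Qed.

End VariabilityRegion.

Theorem theorem2p2 (Omega : C -> Prop) (P : C -> C) (n : nat) (j : Z)
    (c gamma : nat -> C)
    (hOmega : convex_domain Omega)
    (hOmega_ne : exists w : C, ~ Omega w)
    (hP : conformal_map P Omega)
    (hj : (-1 <= j)%Z)
    (hc : Int_coeff_body n c)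
    (hgamma : schur_parameter n c gamma)
    (z0 : C) (hz0 : disk z0) (hz0_ne : z0 <> RtoC 0) :
  convex_univalent (fun eps : C => Q P n c gamma j z0 eps) /\
  (forall w : C,
     V_region Omega P n c j z0 w <->
     image (fun eps : C => Q P n c gamma j z0 eps) cdisk w) /\
  (forall (g : C -> C) (eps : C),
     F_class Omega P n c g -> Cmod eps = 1 ->
     (weighted_int j g (g (RtoC 0)) z0 = Q P n c gamma j z0 eps <->
      forall z : C, disk z -> g z = P (omega n gamma eps z))).
Proof.
  assert (HP := conformal_convex_map P Omega hP hOmega).
  assert (Hg : disk_below (S n) gamma).
  { destruct (Int_coeff_body_strict n c hc) as [f [rho [Ht [Bf Hrho]]]].
    now apply (schur_parameter_disk_below n c gamma f rho). }
  replace j with (Z.of_nat (Z.to_nat (j + 1)) - 1)%Z by lia. set (J := Z.to_nat (j + 1)).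
  assert (EQ : (fun eps => Q P n c gamma (Z.of_nat J - 1) z0 eps) = extremal_int P n gamma J z0)
    by (apply functional_extensionality; intro x; now apply Q_extremal_int).
  split; [|split].
  - rewrite EQ. now apply extremal_int_convex_univalent.
  - rewrite EQ. intro w. now apply V_region_extremal_int.
  - intros g eps HgF Heps. rewrite (Q_extremal_int P n J c gamma z0 hgamma).
    rewrite (weighted_int_extremal_iff Omega P n J c gamma z0) by assumption.
    now setoid_rewrite omega_schur_chain.
Qed.
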